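(* Let $\mathfrak{g}$ be a finite-dimensional real Lie algebra, let $G$ be a connected Lie group with Lie algebra $\mathfrak{g}$, and let $\mathfrak{g}_n \subset \mathfrak{g}$ be the non-compact part of $\mathfrak{g}$ (defined in the context), so that $\mathfrak{g}/\mathfrak{g}_n \cong \mathfrak{s}_c$ is compact semisimple. Fix a Levi factor of $\mathfrak{g}$, and the resulting vector space decomposition $\mathfrak{g} = \mathfrak{g}_n \oplus \mathfrak{s}_c$. If $\mathcal{O} \subset \mathfrak{g}^*$ is a bounded coadjoint orbit of $G$, then $\mathcal{O}$ is closed in $\mathfrak{g}^*$, hence compact, and it has the form $\mathcal{O} = f_1 + \mathcal{O}_c$, where $f_1$ is a $G$-fixed element of $\mathfrak{g}_n^*$, regarded as an element of $\mathfrak{g}^*$ by extending it by $0$ on $\mathfrak{s}_c$, and $\mathcal{O}_c \subset \mathfrak{g}^*$ is the pull-back, under the quotient map $\mathfrak{g} \to \mathfrak{g}/\mathfrak{g}_n$, of a coadjoint orbit of the compact semisimple quotient $\mathfrak{g}/\mathfrak{g}_n$.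
   Context: All Lie algebras are real and finite-dimensional. For a connected Lie group $G$ with Lie algebra $\mathfrak{g}$, the coadjoint action of $G$ on $\mathfrak{g}^*$ is $(g\cdot f)(x) = f(\mathrm{Ad}(g^{-1})x)$. Its orbits are the coadjoint orbits; they depend only on $\mathfrak{g}$, not on the choice of connected $G$, so one may speak of coadjoint orbits of a Lie algebra. An orbit is bounded if it is a bounded subset of the finite-dimensional real vector space $\mathfrak{g}^*$ (with respect to any norm). Let $\mathfrak{r}$ be the solvable radical of $\mathfrak{g}$ and $\mathfrak{s} = \mathfrak{g}/\mathfrak{r}$, which is semisimple (possibly zero). Write $\mathfrak{s} = \mathfrak{s}_c \oplus \mathfrak{s}_n$, where $\mathfrak{s}_c$ is the sum of the compact simple ideals of $\mathfrak{s}$ (those with negative definite Killing form) and $\mathfrak{s}_n$ is the sum of the non-compact simple ideals. The non-compact part $\mathfrak{g}_n$ is the preimage of $\mathfrak{s}_n$ under $\mathfrak{g} \to \mathfrak{s}$; it is an ideal of $\mathfrak{g}$ containing $\mathfrak{r}$, with $\mathfrak{g}_n/\mathfrak{r} \cong \mathfrak{s}_n$ and $\mathfrak{g}/\mathfrak{g}_n \cong \mathfrak{s}_c$. A Levi factor is a subalgebra of $\mathfrak{g}$ mapped isomorphically onto $\mathfrak{s}$ by the quotient map; choosing one identifies $\mathfrak{s}$, and hence $\mathfrak{s}_c$ and $\mathfrak{s}_n$, with subalgebras of $\mathfrak{g}$, so that $\mathfrak{g}_n = \mathfrak{r} \oplus \mathfrak{s}_n$ and $\mathfrak{g} = \mathfrak{g}_n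 \oplus \mathfrak{s}_c$ as vector spaces. The group $G$ acts on $\mathfrak{g}_n^*$ by $(g\cdot \lambda)(x) = \lambda(\mathrm{Ad}(g^{-1})x)$ for $x \in \mathfrak{g}_n$, since $\mathfrak{g}_n$ is an ideal; $G$-fixed refers to this action. The pull-back of a subset of $(\mathfrak{g}/\mathfrak{g}_n)^*$ is its image under the dual map $(\mathfrak{g}/\mathfrak{g}_n)^* \to \mathfrak{g}^*$ of the quotient map. *)

(* Defs.v *)
From HB Require Import structures.
From mathcomp Require Import all_boot all_order all_algebra.
From mathcomp Require Import all_classical all_reals all_analysis.

Set Implicit Arguments.
Unset Strict Implicit.
Unset Printing Implicit Defensive.

Import Order.TTheory GRing.Theory Num.Theory.
Import numFieldNormedType.Exports.

Local Open Scope classical_set_scope.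
Local Open Scope ring_scope.

HB.mixin Record Vector_isLieAlg (R : fieldType) (V : Type) of Vector R V := {
  lie : V -> V -> V;
  lie_is_linearl : forall y, linear (lie^~ y);
  lie_is_linearr : forall x, linear (lie x);
  liexx : forall x, lie x x = 0;
  lie_jacobi : forall x y z,
    lie x (lie y z) + lie y (lie z x) + lie z (lie x y) = 0
}.

#[short(type="lieAlgType")]
HB.structure Definition LieAlg (R : fieldType) :=
  { V of Vector_isLieAlg R V & Vector R V }.

Section LieAlgebras.
Context {R : fieldType}.

Section Sup.
Context {V : vectType R}.

(* The sum of a family of subspaces, i.e. the smallest subspace containing all
   its members; [vsupP] shows that it exists. *)
Definition is_vsup (P : set {vspace V}) (U : {vspace V}) : Prop :=
  (forall W, P W -> (W <= U)%VS) /\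
  (forall U' : {vspace V}, (forall W, P W -> (W <= U')%VS) -> (U <= U')%VS).

Definition vsup (P : set {vspace V}) : {vspace V} := xget 0%VS (is_vsup P).

Lemma vsupP P : is_vsup P (vsup P).
Proof.
suff [U HU] : exists U, is_vsup P U by apply: (xgetPex 0%VS); exists U.
pose ub (U : {vspace V}) := forall W, P W -> (W <= U)%VS.
pose Q n := `[< exists2 U, ub U & \dim U = n >].
have exQ : exists n, Q n.
  by exists (\dim {:V}); apply/asboolP; exists fullv => // W _; exact: subvf.
case: (ex_minnP exQ) => n /asboolP [U ubU dU] minn.
exists U; split=> // U' ubU'.
have ubI : ub (U :&: U')%VS by move=> W PW; rewrite subv_cap ubU //= ubU'.
have le_n : (n <= \dim (U :&: U')%VS)%N.
  by apply: minn; apply/asboolP; exists (U :&: U')%VS.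
have /eqP <- : (U :&: U')%VS == U by rewrite eqEdim capvSl dU.
exact: capvSr.
Qed.

End Sup.

Context {g : lieAlgType R}.

Definition is_lie_ideal (U : {vspace g}) : Prop :=
  forall x y, y \in U -> lie x y \in U.

Definition is_lie_subalgebra (U : {vspace g}) : Prop :=
  forall x y, x \in U -> y \in U -> lie x y \in U.

Record lie_ideal := LieIdeal {
  ideal_space :> {vspace g};
  idealP : is_lie_ideal ideal_space
}.

Definition lie_prod (U W : {vspace g}) : {vspace g} :=
  <<[seq lie x y | x <- vbasis U, y <- vbasis W]>>%VS.

Definition derived_series (U : {vspace g}) (k : nat) : {vspace g} :=
  iter k (fun W => lie_prod W W) U.

Definition lie_solvable (U : {vspace g}) : Prop :=
  exists k, derived_series U k = 0%VS.

Lemma vsup_is_ideal (P : set {vspace g}) :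
  (forall U, P U -> is_lie_ideal U) -> is_lie_ideal (vsup P).
Proof.
move=> idP x; have [ub lub] := vsupP P.
pose adx := linfun (HB.pack_for {linear g -> g} (lie x)
  (GRing.isLinear.Build _ _ _ _ (lie x) (lie_is_linearr x))).
suff sub : (vsup P <= adx @^-1: vsup P)%VS.
  by move=> y /(subvP sub); rewrite -memv_preim lfunE.
apply: lub => W PW; apply/subvP => y Wy; rewrite -memv_preim lfunE /=.
exact: (subvP (ub W PW)) (idP W PW x y Wy).
Qed.

Definition radical : lie_ideal :=
  @LieIdeal (vsup [set U | is_lie_ideal U /\ lie_solvable U])
            (vsup_is_ideal (fun U (HU : _ /\ _) => proj1 HU)).

Definition simple_ideal (U : {vspace g}) : Prop :=
  [/\ is_lie_ideal U,
      lie_prod U U != 0%VS &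
      forall W : {vspace g}, (W <= U)%VS -> (lie_prod U W <= W)%VS ->
        W = 0%VS \/ W = U].

Definition ad (x : g) : 'End(g) := linfun (lie x).

End LieAlgebras.
Arguments lie_ideal {R} g.
Arguments radical {R} g.

Section Quotient.
Context {R : fieldType} {g : lieAlgType R} (I : lie_ideal g).

(* The quotient g / I is carried by the chosen complement I^C of I, with
   [quot_map] the projection along I. *)
Let Q : vectType R := subvs_of (I^C)%VS.
Let p : 'Hom(g, Q) := (linfun (vsproj (I^C)%VS) \o daddv_pi (I^C)%VS I)%VF.

Let capCI : (I^C :&: I)%VS = 0%VS. Proof. by rewrite capvC capv_compl. Qed.

Let pE x : vsval (p x) = daddv_pi (I^C)%VS I x.
Proof. by rewrite comp_lfunE lfunE /= vsprojK // memv_pi. Qed.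

Let pB x : x - vsval (p x) \in (I : {vspace g}).
Proof.
have fullI : x \in (I^C + I)%VS by rewrite addvC addv_complf memvf.
have := daddv_pi_add capCI fullI; rewrite -pE => {1}<-.
by rewrite addrC addKr memv_pi.
Qed.

Let p_eq0 x : (p x == 0) = (x \in (I : {vspace g})).
Proof.
apply/eqP/idP => [x0|Ix]; first by have := pB x; rewrite x0 subr0.
apply: val_inj; apply/eqP; rewrite -memv0 -capCI memv_cap subvsP /=.
by have := rpredB Ix (pB x); rewrite opprB addrCA subrr addr0.
Qed.

Let quot_lie (a b : Q) : Q := p (lie (vsval a) (vsval b)).

Let lieDl (x y z : g) : lie (x + y) z = lie x z + lie y z.
Proof. by have := lie_is_linearl z 1 x y; rewrite !scale1r. Qed.
Let lieDr (x y z : g) : lie x (y + z) = lie x y + lie x z.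
Proof. by have := lie_is_linearr x 1 y z; rewrite !scale1r. Qed.

Let quot_lier (x y : g) : p (lie x (vsval (p y))) = p (lie x y).
Proof.
rewrite -[in RHS](subrK (vsval (p y)) y) lieDr linearD /=.
suff /eqP -> : p (lie x (y - vsval (p y))) == 0 by rewrite add0r.
by rewrite p_eq0; exact: idealP (pB y).
Qed.

Let quot_lie_linearl b : linear (quot_lie^~ b).
Proof. by move=> c x y; rewrite /quot_lie linearP lie_is_linearl linearP. Qed.

Let quot_lie_linearr a : linear (quot_lie a).
Proof. by move=> c x y; rewrite /quot_lie linearP lie_is_linearr linearP. Qed.

Let quot_liexx a : quot_lie a a = 0.
Proof. by rewrite /quot_lie liexx linear0. Qed.

Let quot_lie_jacobi a b c :
  quot_lie a (quot_lie b c) + quot_lie b (quot_lie c a)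
    + quot_lie c (quot_lie a b) = 0.
Proof. by rewrite /quot_lie !quot_lier -!linearD lie_jacobi linear0. Qed.

Definition lie_quot : lieAlgType R :=
  HB.pack (subvs_of (I^C)%VS)
    (Vector_isLieAlg.Build R (subvs_of (I^C)%VS)
       quot_lie_linearl quot_lie_linearr quot_liexx quot_lie_jacobi).

Definition quot_map : 'Hom(g, lie_quot) := p.

Lemma quot_map_eq0 x : (quot_map x == 0) = (x \in (I : {vspace g})).
Proof. exact: p_eq0. Qed.

Lemma quot_map_surj (a : lie_quot) : exists x, quot_map x = a.
Proof.
exists (vsval (a : subvs_of (I^C)%VS)); apply: val_inj.
by rewrite /quot_map [LHS]pE daddv_pi_id // subvsP.
Qed.

Lemma quot_map_lie x y : quot_map (lie x y) = lie (quot_map x) (quot_map y).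
Proof.
have lieN (u v : g) : lie u v = - lie v u.
  have := liexx (u + v); rewrite lieDl !lieDr !liexx addr0 add0r.
  by move/eqP; rewrite addr_eq0 => /eqP.
have e : p (lie (vsval (p x)) (vsval (p y))) = p (lie x y).
  rewrite (quot_lier (vsval (p x)) y) [in LHS]lieN linearN /=.
  by rewrite (quot_lier y x) -linearN -lieN.
exact: esym e.
Qed.

Lemma quot_preim_ideal (U : {vspace lie_quot}) :
  is_lie_ideal U -> is_lie_ideal (quot_map @^-1: U)%VS.
Proof. by move=> iU x y; rewrite -!memv_preim quot_map_lie; exact: iU. Qed.

End Quotient.

Section NonCompactPart.
Context {R : realType}.

Definition killing_form {g : lieAlgType R} (U : {vspace g})
    (x y : subvs_of U) : R :=
  let ad_U (z : subvs_of U) : 'End(subvs_of U) :=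
    linfun (fun w => vsproj U (lie (vsval z) (vsval w))) in
  let e := vbasis {: subvs_of U} in
  \tr (passmx.mxof e e (ad_U x \o ad_U y)%VF).

Definition compact_simple {g : lieAlgType R} (U : {vspace g}) : Prop :=
  simple_ideal U /\ forall x : subvs_of U, x != 0 -> killing_form x x < 0.

Definition noncompact_simple {g : lieAlgType R} (U : {vspace g}) : Prop :=
  simple_ideal U /\ ~ compact_simple U.

Definition compact_ideals (s : lieAlgType R) : {vspace s} :=
  vsup [set U | compact_simple U].

Lemma noncompact_ideals_subproof (s : lieAlgType R) :
  is_lie_ideal (vsup [set U : {vspace s} | noncompact_simple U]).
Proof. by apply: vsup_is_ideal => U [[]]. Qed.

Definition noncompact_ideals (s : lieAlgType R) : lie_ideal s :=
  LieIdeal (@noncompact_ideals_subproof s).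

Context (g : lieAlgType R).

Definition semisimple_quot : lieAlgType R := lie_quot (radical g).

Definition noncompact_part : lie_ideal g :=
  LieIdeal (quot_preim_ideal
    (@idealP _ _ (noncompact_ideals semisimple_quot))).

Definition is_levi_factor (l : {vspace g}) : Prop :=
  [/\ is_lie_subalgebra l,
      (l :&: lker (quot_map (radical g)))%VS = 0%VS &
      (quot_map (radical g) @: l)%VS = fullv].

(* The copy of s_c inside the Levi factor l. *)
Definition levi_compact (l : {vspace g}) : {vspace g} :=
  (l :&: quot_map (radical g) @^-1: compact_ideals semisimple_quot)%VS.

End NonCompactPart.
Arguments noncompact_part {R} g.
Arguments levi_compact {R g} l.

(* The topology of a finite-dimensional real vector space, read off in
   coordinates. *)
Section FiniteDimensionalTopology.
Context {R : realType} {V : vectType R}.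

Definition coords (v : V) : 'rV[R]_(\dim {:V}) := passmx.rVof (vbasis {:V}) v.

Definition vbounded (A : set V) : Prop := bounded_set (coords @` A).
Definition vclosed (A : set V) : Prop := closed (coords @` A).
Definition vcompact (A : set V) : Prop := compact (coords @` A).

(* E is the exponential of the endomorphism A: the partial sums of
   \sum_k A^k v / k! converge to E v for every v. *)
Definition is_exp (A E : 'End(V)) : Prop :=
  forall v, series (fun k => (k`!%:R : R)^-1 *: coords (iter k A v)) @ \oo
              --> coords (E v).

End FiniteDimensionalTopology.

Section Smooth.
Context {R : realType} {V W : normedModType R}.

(* A is meant to be open. *)
Fixpoint Ck_on (k : nat) (A : set V) (f : V -> W) : Prop :=
  if k is k'.+1 then
    (forall x, A x -> differentiable f x) /\
    (forall v, Ck_on k' A (fun x => 'D_v f x))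
  else forall x, A x -> {for x, continuous f}.

Definition smooth_on (A : set V) (f : V -> W) : Prop := forall k, Ck_on k A f.

End Smooth.

Record chart (R : realType) (n : nat) (G : topologicalType) := Chart {
  chart_dom : set G;
  chart_fun : G -> 'rV[R]_n;
  chart_inv : 'rV[R]_n -> G;
  chart_dom_open : open chart_dom;
  chart_img_open : open (chart_fun @` chart_dom);
  chart_funK : forall p, chart_dom p -> chart_inv (chart_fun p) = p;
  chart_fun_cts : {within chart_dom, continuous chart_fun};
  chart_inv_cts : {within chart_fun @` chart_dom, continuous chart_inv}
}.
Arguments chart R n G : clear implicits.

Definition chart_img (R : realType) (n : nat) (G : topologicalType)
  (c : chart R n G) : set 'rV[R]_n := chart_fun c @` chart_dom c.

HB.structure Definition TopologicalAndGroup :=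
  { G of Topological G & Group G }.

HB.mixin Record TopologicalAndGroup_isLieGroup (R : realType) (n : nat) (G : Type)
    of TopologicalAndGroup G := {
  atlas : set (chart R n G);
  lie_hausdorff : hausdorff_space G;
  lie_second_countable : @second_countable G;
  atlas_cover : forall p : G, exists2 c, atlas c & chart_dom c p;
  atlas_smooth : forall a b, atlas a -> atlas b ->
    smooth_on (chart_fun a @` (chart_dom a `&` chart_dom b))
              (chart_fun b \o chart_inv a);
  lie_mul_continuous : continuous (fun p : G * G => (p.1 * p.2)%g);
  lie_inv_continuous : continuous (fun p : G => (p^-1)%g);
  lie_mul_smooth : forall a b c, atlas a -> atlas b -> atlas c ->
    smooth_on [set u : 'rV[R]_n * 'rV[R]_n |
                [/\ chart_img a u.1, chart_img b u.2 &
                    chart_dom c (chart_inv a u.1 * chart_inv b u.2)%g]]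
              (fun u => chart_fun c (chart_inv a u.1 * chart_inv b u.2)%g);
  lie_inv_smooth : forall a b, atlas a -> atlas b ->
    smooth_on [set u : 'rV[R]_n | chart_img a u /\
                                  chart_dom b ((chart_inv a u)^-1)%g]
              (fun u => chart_fun b ((chart_inv a u)^-1)%g)
}.

#[short(type="lieGroupType")]
HB.structure Definition LieGroup (R : realType) (n : nat) :=
  { G of TopologicalAndGroup_isLieGroup R n G & TopologicalAndGroup G }.

Section LieGroups.
Context {R : realType} {n : nat} (G : lieGroupType R n).

(* Ad(p), the differential at 1 of q |-> p q p^-1, on the tangent space T_1 G
   written in the chart c. *)
Definition chart_Ad (c : chart R n G) (p : G) : 'rV[R]_n -> 'rV[R]_n :=
  'd (fun u : 'rV[R]_n => chart_fun c (p * chart_inv c u * p^-1)%g)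
     (chart_fun c 1%g).

(* An identification of g with the Lie algebra of G, the bracket of T_1 G being
   [X, Y] = ad(X) Y with ad the differential of Ad at 1. *)
Record lie_algebra_of (g : lieAlgType R) := LieAlgebraOf {
  tan_chart : chart R n G;
  tan_map : 'Hom(g, 'rV[R]_n);
  tan_chart_atlas : atlas tan_chart;
  tan_chart_one : chart_dom tan_chart 1%g;
  tan_map_inj : lker tan_map = 0%VS;
  tan_map_surj : limg tan_map = fullv;
  tan_map_lie : forall x y : g, tan_map (lie x y) =
    'D_(tan_map x) (fun u => chart_Ad tan_chart (chart_inv tan_chart u)
                                      (tan_map y))
                   (chart_fun tan_chart 1%g)
}.

Context {g : lieAlgType R} (L : lie_algebra_of g).

Definition Ad (p : G) : 'End(g) :=
  linfun (fun x => (tan_map L)^-1%VF (chart_Ad (tan_chart L) p (tan_map L x))).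

Definition coadjoint_orbit_at (f : 'Hom(g, R^o)) : set 'Hom(g, R^o) :=
  [set (f \o Ad p^-1%g)%VF | p in [set: G]].

Definition coadjoint_orbit (O : set 'Hom(g, R^o)) : Prop :=
  exists f, O = coadjoint_orbit_at f.

(* lam \o Ad p^-1 makes sense on the ideal I because Ad preserves ideals. *)
Definition group_fixed (I : lie_ideal g) (lam : 'Hom(subvs_of I, R^o)) : Prop :=
  forall (p : G) (x : subvs_of I),
    lam (vsproj I (Ad p^-1%g (vsval x))) = lam x.

End LieGroups.

Section AlgebraOrbits.
Context {R : realType} (q : lieAlgType R).

(* The adjoint group Int(q), generated by the e^(ad x). *)
Inductive inner_aut : 'End(q) -> Prop :=
| inner_aut1 : inner_aut \1%VF
| inner_autM x e a : is_exp (ad x) e -> inner_aut a -> inner_aut (e \o a)%VF.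

Definition inner_orbit_at (f : 'Hom(q, R^o)) : set 'Hom(q, R^o) :=
  [set (f \o a^-1)%VF | a in inner_aut].

(* Coadjoint orbits of a Lie algebra do not depend on the connected group chosen:
   for every connected Lie group H with Lie algebra q one has Ad(H) = Int(q).
   The first clause keeps the definition from being conditional on the existence
   of such an H. *)
Definition algebra_coadjoint_orbit (O : set 'Hom(q, R^o)) : Prop :=
  exists f, O = inner_orbit_at f /\
    forall (n : nat) (H : lieGroupType R n) (L : lie_algebra_of H q),
      connected [set: H] -> O = coadjoint_orbit_at L f.

End AlgebraOrbits.

(* Extension of a functional on U by 0 along S, for a direct sum U + S. *)
Definition extend0 (R : realType) (g : vectType R) (U S : {vspace g})
    (lam : 'Hom(subvs_of U, R^o)) : 'Hom(g, R^o) :=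
  (lam \o linfun (vsproj U) \o daddv_pi U S)%VF.
Arguments extend0 {R g U} S lam.

Definition pullback (R : realType) (g : lieAlgType R) (I : lie_ideal g)
    (A : set 'Hom(lie_quot I, R^o)) : set 'Hom(g, R^o) :=
  [set (h \o quot_map I)%VF | h in A].

(* Main.v *)
(** Let [J] be the largest ideal on which every [f \o Ad p] vanishes. Since the
    orbit of [f] is bounded, [Ad] acts on [k = g / J] by a bounded group of
    matrices, so [k] has an invariant inner product and its solvable ideals are
    central. If a non-compact simple ideal of [g / rad g] acted nontrivially on
    [k], its Killing form would be a trace form of skew matrices, hence negative
    definite; so [g_n, g] lies in [J], and in [ker f]. The extension by [0] of
    [f] restricted to [g_n] then kills [g, g] and is fixed by [G], and the
    remaining part of [f] factors through [q = g / g_n], whose Killing form is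
    negative definite. Derivations of [q] being inner, both [u |-> e^(ad u)] and
    [u |-> Ad (exp u)] reach all automorphisms of [q] near [1], so [Ad G] induces
    exactly [Int q] on [q]. This group preserves the Killing form and contains
    all automorphisms close to [1], so it is bounded and closed. *)

Require Import Defs.
From HB Require Import structures.
From mathcomp Require Import all_boot all_order all_algebra.
From mathcomp Require Import all_classical all_reals all_analysis.
From mathcomp Require Import ring lra complex.

Set Implicit Arguments.
Unset Strict Implicit.
Unset Printing Implicit Defensive.

Import Order.TTheory GRing.Theory Num.Theory.
Import numFieldNormedType.Exports.

Local Open Scope classical_set_scope.
Local Open Scope ring_scope.

(** * Norms of matrices and invariant inner products *)

(** A bounded orbit controls only the functions [f \o Ad p], not [Ad] itself; dividing by [J] turns
    finitely many of these functions into coordinates, and only then are matrix entries bounded. A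
    Lie group is given as an atlas with smooth operations, so a chart at 1 takes the place of the
    exponential map of [G], and everything infinitesimal about [Ad] is drawn from one differential
    equation, [chart_Ad_derivative]. Connectedness enters through the fact that a subgroup which is
    a neighbourhood of 1 is the whole group: it extends statements about [Ad] near 1 to all of [G].
    That the radical of a quotient vanishes says nothing directly about its Killing form; Cartan's
    criterion, proved over the complex numbers, provides the orthogonal splitting of [g / rad g]
    into ideals. The local surjectivity theorem [hom_local_surj] is stated for an abstract family
    [F] because it serves twice, for the exponentials of [ad u] and for the chart of the group. The
    clause of [algebra_coadjoint_orbit] about every connected group [H] is the same argument with
    the identity as quotient map. *)

Section LinearFunctions.
Context {R : pzRingType} {U V : lmodType R} (f : U -> V).
Hypothesis lf : linear f.

Let F : {linear U -> V} := HB.pack f (GRing.isLinear.Build R U V *:%R f lf).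

Lemma linfD x y : f (x + y) = f x + f y. Proof. exact: (linearD F). Qed.
Lemma linfB x y : f (x - y) = f x - f y. Proof. exact: (linearB F). Qed.
Lemma linfN x : f (- x) = - f x. Proof. exact: (linearN F). Qed.
Lemma linf0 : f 0 = 0. Proof. exact: (linear0 F). Qed.
Lemma linfZ a x : f (a *: x) = a *: f x.
Proof. by have := lf a x 0; rewrite linf0 !addr0. Qed.
Lemma linf_sum I r (P : pred I) E :
  f (\sum_(i <- r | P i) E i) = \sum_(i <- r | P i) f (E i).
Proof. exact: (linear_sum F). Qed.

End LinearFunctions.

Lemma linfunE {R : fieldType} {U V : vectType R} (f : U -> V) (lf : linear f) :
  linfun f =1 f.
Proof.
pose F : {linear U -> V} := HB.pack f (GRing.isLinear.Build R U V *:%R f lf).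
exact: (lfunE F).
Qed.

(** Absorbs an operator bound [C] into a tolerance; dividing by [C + 1] remains legitimate when [C]
    is 0. *)
Lemma ler_pdivD1 {R : realFieldType} (C e x : R) : 0 <= C -> 0 <= e -> 0 <= x ->
  C * (e / (C + 1) * x) <= e * x.
Proof.
move=> C0 e0 x0; have C10 : 0 < C + 1 by rewrite ltr_wpDl.
have -> : C * (e / (C + 1) * x) = C / (C + 1) * (e * x) by field; rewrite gt_eqF.
by rewrite ler_piMl ?mulr_ge0 // ler_pdivrMr // mul1r lerDl.
Qed.

Section MatrixNorm.
Context {R : realType}.

Lemma mx_entry_le {m n} (A : 'M[R]_(m, n)) i j : `|A i j| <= `|A|.
Proof.
by rewrite [leRHS]/Num.Def.normr /= mx_normrE; apply/bigmax_geP; right => /=; exists (i, j).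
Qed.

Lemma mx_norm_le {m n} (A : 'M[R]_(m, n)) c :
  0 <= c -> (forall i j, `|A i j| <= c) -> `|A| <= c.
Proof.
move=> c0 Ac; rewrite [leLHS]/Num.Def.normr /= mx_normrE.
by apply/bigmax_leP; split => // -[i j] _; exact: Ac.
Qed.

Lemma mulmx_norm {m n p} (A : 'M[R]_(m, n)) (B : 'M[R]_(n, p)) :
  `|A *m B| <= n%:R * `|A| * `|B|.
Proof.
apply: mx_norm_le => [|i j]; first by rewrite !mulr_ge0.
rewrite mxE (le_trans (ler_norm_sum _ _ _))// -mulrA mulr_natl.
rewrite -[X in _ *+ X]card_ord -sumr_const ler_sum // => k _.
by rewrite normrM ler_pM // mx_entry_le.
Qed.

Lemma trmx_norm {m n} (A : 'M[R]_(m, n)) : `|A^T| = `|A|.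
Proof.
apply/eqP; rewrite eq_le; apply/andP; split; apply: mx_norm_le => // i j.
  by rewrite mxE mx_entry_le.
by have := mx_entry_le A^T j i; rewrite mxE.
Qed.

Lemma mx_linear_bounded {m n} {W : normedModType R}
    (f : 'M[R]_(m, n) -> W) : linear f ->
  exists2 C, 0 <= C & forall X, `|f X| <= C * `|X|.
Proof.
move=> lf; pose F : {linear 'M[R]_(m, n) -> W} :=
  HB.pack f (GRing.isLinear.Build R 'M[R]_(m, n) W *:%R f lf).
exists (\sum_i \sum_j `|f (delta_mx i j)|).
  by rewrite sumr_ge0 // => i _; rewrite sumr_ge0.
move=> X; rewrite {1}(matrix_sum_delta X) -[f _]/(F _) linear_sum.
rewrite (le_trans (ler_norm_sum _ _ _)) // mulr_suml ler_sum // => i _.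
rewrite linear_sum (le_trans (ler_norm_sum _ _ _)) // mulr_suml ler_sum // => j _.
by rewrite linearZ /= normrZ mulrC ler_wpM2l // mx_entry_le.
Qed.

Lemma mx_linear_continuous {m n} {W : normedModType R}
    (f : 'M[R]_(m, n) -> W) : linear f -> continuous f.
Proof.
move=> lf; have [C C0 fC] := mx_linear_bounded lf.
pose F : {linear 'M[R]_(m, n) -> W} :=
  HB.pack f (GRing.isLinear.Build R 'M[R]_(m, n) W *:%R f lf).
apply: (@bounded_linear_continuous _ _ _ F); apply/bounded_funP => r.
by exists (C * r) => x xr; rewrite (le_trans (fC x)) // ler_wpM2l.
Qed.

Lemma mx_bilinear_bounded {m n p q} {W : normedModType R}
    (f : 'M[R]_(m, n) -> 'M[R]_(p, q) -> W) :
  (forall v, linear (f^~ v)) -> (forall u, linear (f u)) ->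
  exists2 C, 0 <= C & forall u v, `|f u v| <= C * `|u| * `|v|.
Proof.
move=> fl fr.
pose c (ij : 'I_m * 'I_n) := cid2 (mx_linear_bounded (fr (delta_mx ij.1 ij.2))).
pose C ij := s2val (c ij).
have HC ij : 0 <= C ij /\ forall v, `|f (delta_mx ij.1 ij.2) v| <= C ij * `|v|.
  by split; [exact: s2valP (c ij)|exact: s2valP' (c ij)].
exists (\sum_i \sum_j C (i, j)).
  by apply: sumr_ge0 => i _; apply: sumr_ge0 => j _; have [] := HC (i, j).
move=> u v; rewrite {1}(matrix_sum_delta u) (linf_sum (fl v)).
rewrite (le_trans (ler_norm_sum _ _ _)) // !mulr_suml ler_sum // => i _.
rewrite (linf_sum (fl v)) (le_trans (ler_norm_sum _ _ _)) // !mulr_suml ler_sum // => j _.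
rewrite (linfZ (fl v)) normrZ [C _ * _]mulrC -mulrA ler_pM ?mx_entry_le //.
by have [_] := HC (i, j); exact.
Qed.

Lemma rV_linear_eq0 {n} {W : lmodType R} (f : 'rV[R]_n -> W) : linear f ->
  (forall i, f (delta_mx 0 i) = 0) -> forall u, f u = 0.
Proof.
move=> lf f0 u; rewrite (row_sum_delta u) (linf_sum lf) big1 // => i _.
by rewrite (linfZ lf) f0 scaler0.
Qed.

(** The squared Frobenius norm. The ambient norm of a matrix is the maximum of its entries, which is
    not strictly convex and has no trace formula. *)
Definition fro {m n} (A : 'M[R]_(m, n)) : R := \sum_i \sum_j A i j ^+ 2.

Lemma fro_ge0 {m n} (A : 'M[R]_(m, n)) : 0 <= fro A.
Proof. by apply: sumr_ge0 => i _; apply: sumr_ge0 => j _; exact: sqr_ge0. Qed.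

Lemma fro_eq0 {m n} (A : 'M[R]_(m, n)) : fro A = 0 -> A = 0.
Proof.
move=> A0; apply/matrixP => i j; rewrite mxE; apply/eqP; rewrite -sqrf_eq0.
apply/eqP/(psumr_eq0P (P := predT) (F := fun j => A i j ^+ 2)) => // [k _|].
  exact: sqr_ge0.
apply: (psumr_eq0P (P := predT) (F := fun i => \sum_j A i j ^+ 2)) => // k _.
by apply: sumr_ge0 => l _; exact: sqr_ge0.
Qed.

Lemma fro_trE {m n} (A : 'M[R]_(m, n)) : fro A = \tr (A *m A^T).
Proof.
apply: eq_bigr => i _; rewrite mxE; apply: eq_bigr => j _.
by rewrite mxE expr2.
Qed.

Lemma fro_rowE {n} (x : 'rV[R]_n) : fro x = (x *m x^T) 0 0.
Proof. by rewrite fro_trE /mxtrace big_ord1. Qed.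

Lemma norm_le_fro {m n} (A : 'M[R]_(m, n)) : `|A| ^+ 2 <= fro A.
Proof.
rewrite -[fro A]sqr_sqrtr ?fro_ge0 // ler_sqr ?nnegrE ?sqrtr_ge0 //.
apply: mx_norm_le => [|i j]; first exact: sqrtr_ge0.
rewrite -sqrtr_sqr ler_sqrt ?fro_ge0 //.
rewrite /fro (bigD1 i) //= (bigD1 j) //= -addrA lerDl addr_ge0 //.
  by apply: sumr_ge0 => k _; exact: sqr_ge0.
by apply: sumr_ge0 => k _; apply: sumr_ge0 => l _; exact: sqr_ge0.
Qed.

Lemma fro_le_norm {m n} (A : 'M[R]_(m, n)) : fro A <= (m * n)%:R * `|A| ^+ 2.
Proof.
rewrite natrM -mulrA mulr_natl -[X in _ *+ X]card_ord -sumr_const.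
apply: ler_sum => i _; rewrite mulr_natl -[X in _ *+ X]card_ord -sumr_const.
apply: ler_sum => j _; rewrite -real_normK ?num_real //.
by rewrite ler_sqr ?nnegrE // mx_entry_le.
Qed.

Lemma fro_mulmx {m n p} (A : 'M[R]_(m, n)) (B : 'M[R]_(n, p)) :
  fro (A *m B) <= (m * p)%:R * (n%:R * `|B|) ^+ 2 * fro A.
Proof.
apply: le_trans (fro_le_norm _) _; rewrite -mulrA ler_wpM2l //.
apply: (@le_trans _ _ ((n%:R * `|B|) ^+ 2 * `|A| ^+ 2)).
  rewrite -exprMn ler_sqr ?nnegrE ?mulr_ge0 //.
  by rewrite mulrAC mulmx_norm.
by rewrite ler_wpM2l ?sqr_ge0 // norm_le_fro.
Qed.

Lemma fro_trmx {m n} (A : 'M[R]_(m, n)) : fro A^T = fro A.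
Proof.
rewrite /fro exchange_big; apply: eq_bigr => i _; apply: eq_bigr => j _.
by rewrite mxE.
Qed.

(** The parallelogram law; the gain [fro (A - B) / 4] is the uniform convexity behind
    [invariant_form]. *)
Lemma fro_mid {m n} (A B : 'M[R]_(m, n)) :
  fro (2^-1 *: (A + B)) = (fro A + fro B) / 2 - fro (A - B) / 4.
Proof.
rewrite /fro -big_split /= !mulr_suml -sumrB; apply: eq_bigr => i _.
rewrite -big_split /= !mulr_suml -sumrB; apply: eq_bigr => j _.
by rewrite !mxE; field.
Qed.

Lemma fro_continuous {m n} : continuous (@fro m n).
Proof.
apply: (@continuous_big _ _ (fun x y => x + y) 0) => [|i _]; first exact: add_continuous.
apply: (@continuous_big _ _ (fun x y => x + y) 0) => [|j _]; first exact: add_continuous.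
have -> : (fun A : 'M[R]_(m, n) => A i j ^+ 2) = (fun A => A i j * A i j).
  by apply/funext => A; rewrite expr2.
move=> A; apply: (continuous_comp (f := fun A : 'M[R]_(m, n) => A i j) (g := fun x : R => x * x)).
  exact: coord_continuous.
by apply: cvgM; exact: cvg_id.
Qed.

End MatrixNorm.

Lemma fro_mulmx_le {R : realType} {m n p} (C : R) (A : 'M[R]_(m, n))
  (B : 'M[R]_(n, p)) : `|B| <= C ->
  fro (A *m B) <= (m * p)%:R * (n%:R * C) ^+ 2 * fro A.
Proof.
move=> BC; apply: le_trans (fro_mulmx _ _) _.
rewrite ler_wpM2r ?fro_ge0 // ler_wpM2l // ler_sqr ?nnegrE ?mulr_ge0 //.
  by rewrite ler_wpM2l.
exact: le_trans BC.
Qed.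

Section InvariantForm.
Context {R : realType} {n : nat} (Gam : set 'M[R]_n).
Hypothesis Gam1 : Gam 1%:M.
Hypothesis GamM : forall a b, Gam a -> Gam b -> Gam (a *m b).
Hypothesis GamV : forall a, Gam a -> exists2 b, Gam b & a *m b = 1%:M.
Hypothesis GamB : exists C, forall a, Gam a -> `|a| <= C.

Let act (a S : 'M[R]_n) := a *m S *m a^T.

Let actM a b S : act a (act b S) = act (a *m b) S.
Proof. by rewrite /act trmx_mul !mulmxA. Qed.
Let actD a S S' : act a (S + S') = act a S + act a S'.
Proof. by rewrite /act mulmxDr mulmxDl. Qed.
Let actB a S S' : act a (S - S') = act a S - act a S'.
Proof. by rewrite /act mulmxBr mulmxBl. Qed.
Let actZ a k S : act a (k *: S) = k *: act a S.
Proof. by rewrite /act -scalemxAr -scalemxAl. Qed.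

Let act_cts a : continuous (act a).
Proof.
by apply: mx_linear_continuous => k x y; rewrite actD actZ.
Qed.

(** Since [x = x *m a *m b] with [b] in [Gam], the bound on [Gam] also limits how far [a] can shrink
    [x]. The summand 1 in the constant keeps it positive. *)
Let fro_bound : exists2 K, 0 < K & forall a (x : 'rV_n),
  Gam a -> fro x <= K * fro (x *m a).
Proof.
have [C GC] := GamB.
exists (1 + (1 * n)%:R * (n%:R * C) ^+ 2).
  by rewrite ltr_pwDl // mulr_ge0 // sqr_ge0.
move=> a x Ga; have [b Gb ab1] := GamV Ga.
rewrite -[x in leLHS]mulmx1 -ab1 mulmxA (le_trans (fro_mulmx_le _ (GC _ Gb))) //.
by rewrite ler_wpM2r ?fro_ge0 // lerDr.
Qed.

Let fro_act_bound : exists2 K, 0 < K & forall a S,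
  Gam a -> fro S <= K * fro (act a S).
Proof.
have [C GC] := GamB; pose k := (n * n)%:R * (n%:R * C) ^+ 2.
have k0 : 0 <= k by rewrite mulr_ge0 // sqr_ge0.
exists (1 + k * k); first by rewrite ltr_pwDl // mulr_ge0.
move=> a S Ga; have [b Gb ab1] := GamV Ga.
have ba1 := mulmx1C ab1.
have -> : fro S = fro (b *m (act a S) *m b^T).
  by rewrite -/(act b _) actM ba1 /act mul1mx trmx1 mulmx1.
have /fro_mulmx_le le1 : `|b^T| <= C by rewrite trmx_norm GC.
apply: le_trans (le1 _ _) _; rewrite -/k.
rewrite -fro_trmx trmx_mul; apply: le_trans (ler_wpM2l k0 (le1 _ _)) _.
by rewrite fro_trmx -/k mulrA ler_wpM2r ?fro_ge0 // lerDr.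
Qed.

(* The squared Frobenius norm is uniformly convex, so a symmetric form that
   minimises the supremum of [fro (a S a^T)] over [a] in [Gam], within a convex
   invariant set of positive definite forms, is unique and hence invariant. *)
Lemma invariant_form : exists S : 'M[R]_n,
  [/\ S^T = S, forall x : 'rV_n, x != 0 -> 0 < (x *m S *m x^T) 0 0 &
      forall a, Gam a -> a *m S *m a^T = S].
Proof.
have [K K0 HK] := fro_bound; have [K' K'0 HK'] := fro_act_bound.
(* Asking for the lower bound along the whole orbit makes the cone stable under [Gam], and a bound
   with a fixed [K], unlike strict positivity, survives limits. *)
pose cone S := S^T = S /\
  forall a (x : 'rV_n), Gam a -> fro x <= K * (x *m act a S *m x^T) 0 0.
pose bnd b S := forall a, Gam a -> fro (act a S) <= b.
have cone1 : cone 1%:M.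
  split=> [|a x Ga]; first exact: trmx1.
  by rewrite /act mulmx1 mulmxA -mulmxA -trmx_mul -fro_rowE HK.
pose B : set R := [set b | exists2 S, cone S & bnd b S].
have [C GC] := GamB.
have C0 : 0 <= C by apply: le_trans (GC _ Gam1).
have B0 : B !=set0.
  pose M := (n * n)%:R * (n%:R * C) ^+ 2 * ((n * n)%:R * (n%:R * C) ^+ 2 * fro (1%:M : 'M[R]_n)).
  exists M, 1%:M => // a Ga; rewrite /act mulmx1.
  apply: le_trans (fro_mulmx_le (C := C) _ _) _.
    by rewrite trmx_norm GC.
  rewrite ler_wpM2l ?mulr_ge0 ?sqr_ge0 //.
  rewrite -{1}[a]mul1mx; apply: fro_mulmx_le; exact: GC.
have lbB : has_lbound B.
  by exists 0 => b [S _ bS]; apply: le_trans (bS _ Gam1); exact: fro_ge0.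
pose b0 := inf B.
have Sk k : exists S, cone S /\ bnd (b0 + k.+1%:R^-1) S.
  have [b [S cS bS] lt_b] : exists2 b, B b & b < b0 + k.+1%:R^-1.
    by apply: inf_adherent => //; rewrite invr_gt0.
  by exists S; split => // a Ga; apply: le_trans (bS _ Ga) (ltW lt_b).
(* The midpoint of [S] and [S'] is again in the cone, and by the parallelogram law it improves the
   bound [b] by [fro (S - S') / (4 * K')]; it cannot get below the infimum [b0]. *)
have mid S S' b : cone S -> cone S' -> bnd b S -> bnd b S' ->
    fro (S - S') <= 4 * K' * (b - b0).
  move=> [sS cS] [sS' cS'] bS bS'.
  have : B (b - fro (S - S') / (4 * K')).
    exists (2^-1 *: (S + S')).
      split=> [|a x Ga]; first by rewrite linearZ linearD /= sS sS'.
      rewrite actZ actD -scalemxAr -scalemxAl mulmxDr mulmxDl mxE [X in 2^-1 * X]mxE.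
      have := cS a x Ga; have := cS' a x Ga; lra.
    move=> a Ga; rewrite actZ actD fro_mid.
    have := bS a Ga; have := bS' a Ga; have := HK' a (S - S') Ga; rewrite actB.
    move=> h1 h2 h3.
    have : fro (S - S') / (4 * K') <= fro (act a S - act a S') / 4.
      by rewrite ler_pdivrMr ?mulr_gt0 //; lra.
    lra.
  move=> /(ge_inf lbB); rewrite -/b0 lerBrDl -lerBrDr ler_pdivrMr ?mulr_gt0 //.
  by rewrite mulrC.
have [S_ HS] := choice Sk.
(* By [mid], forms whose bounds are close to [b0] are close to each other, so the minimising
   sequence is Cauchy. *)
have cvgS : cvgn S_.
  apply/cauchy_cvgP/cauchy_exP => e e0.
  have e1 : 0 < e ^+ 2 / (4 * K') by rewrite divr_gt0 ?exprn_gt0 ?mulr_gt0.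
  have [N _ HN] := near_infty_natSinv_lt (PosNum e1).
  exists (S_ N); rewrite -ball_normE nbhs_filterE /= ; near_simpl; near=> k => /=.
  have lek : k.+1%:R^-1 <= N.+1%:R^-1 :> R.
    by rewrite lef_pV2 ?posrE // ler_nat ltnS; near: k; exact: nbhs_infty_ge.
  have [cN bN] := HS N; have [ck bk] := HS k.
  have bk' : bnd (b0 + N.+1%:R^-1) (S_ k).
    by move=> a Ga; rewrite (le_trans (bk a Ga)) // lerD2l.
  have := mid _ _ _ cN ck bN bk'; rewrite addrAC subrr add0r => frl.
  rewrite -ltr_sqr ?nnegrE ?(ltW e0) //; apply: le_lt_trans (norm_le_fro _) _.
  apply: le_lt_trans frl _; have := HN N (leqnn N); rewrite /=.
  by rewrite ltr_pdivlMr ?mulr_gt0 // mulrC.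
pose S := limn S_.
have limS (phi : 'M[R]_n -> R) b (e : nat -> R) : continuous phi ->
    e @ \oo --> b -> (forall k, phi (S_ k) <= e k) -> phi S <= b.
  move=> cphi ce le_e; apply: (@ler_cvg_to _ \oo _ _ (phi \o S_) e) => //.
    by apply: cvg_comp; [exact: cvgS|exact: cphi].
  by apply: nearW.
have ent_cts i j : continuous (fun T : 'M[R]_n => T i j) by exact: coord_continuous.
have coneS : cone S.
  split.
    apply/matrixP => i j; rewrite mxE.
    have sub_le i' j' : S i' j' <= S j' i'.
      rewrite -subr_le0; apply: (limS (fun T : 'M[R]_n => T i' j' - T j' i') 0 (fun=> 0)).
      - by move=> T; exact: (continuousB (ent_cts i' j' T) (ent_cts j' i' T)).
      - exact: cvg_cst.
      - by move=> k; rewrite subr_le0; have [[sk _] _] := HS k; rewrite -[in leLHS]sk mxE.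
    by apply/eqP; rewrite eq_le !sub_le.
  move=> a x Ga; rewrite -lerN2.
  have -> (T : 'M[R]_n) : - (K * (x *m act a T *m x^T) 0 0) =
      (- K *: (x *m act a T *m x^T)) 0 0 by rewrite [RHS]mxE mulNr.
  apply: (limS (fun T => (- K *: (x *m act a T *m x^T)) 0 0) _ (fun=> - fro x)).
  - move=> T; apply: (continuous_comp (f := act a)
      (g := fun T => (- K *: (x *m T *m x^T)) 0 0)); first exact: act_cts.
    apply: (continuous_comp (f := fun T => - K *: (x *m T *m x^T))
      (g := fun T : 'M[R]_1 => T 0 0)); last exact: coord_continuous.
    apply: mx_linear_continuous => k T' T''.
    by rewrite mulmxDr mulmxDl -scalemxAr -scalemxAl scalerDr !scalerA mulrC.
  - exact: cvg_cst.
  - by move=> k; rewrite [leLHS]mxE mulNr lerN2; have [[_ ck] _] := HS k; exact: ck.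
have bndS : bnd b0 S.
  move=> a Ga; apply: (limS (fun T => fro (act a T)) b0 (fun k => b0 + k.+1%:R^-1)).
  - by move=> T; apply: continuous_comp; [exact: act_cts|exact: fro_continuous].
  - rewrite -[b0 in X in _ --> X]addr0; apply: cvgD; first exact: cvg_cst.
    exact: cvg_harmonic.
  - by move=> k; have [_] := HS k; exact.
exists S; case: (coneS) => sS cS; split=> // [x x0|a Ga].
  have := cS _ x Gam1; rewrite /act mul1mx trmx1 mulmx1.
  have : 0 < fro x by rewrite lt_neqAle fro_ge0 andbT eq_sym; apply: contraNneq x0 => /fro_eq0 ->.
  by move=> f0 /(lt_le_trans f0); rewrite pmulr_rgt0.
(* [S] and [act a S] both attain [b0], so [mid] with [b = b0] identifies them. *)
suff : fro (act a S - S) = 0 by move=> /fro_eq0/eqP; rewrite subr_eq0 => /eqP.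
apply/eqP; rewrite eq_le fro_ge0 andbT.
have : fro (act a S - S) <= 4 * K' * (b0 - b0).
  apply: mid => //; last by move=> b Gb; rewrite actM bndS //; exact: GamM.
  split=> [|b x Gb]; first by rewrite /act !trmx_mul trmxK sS mulmxA.
  by rewrite actM cS //; exact: GamM.
by rewrite subrr mulr0.
Unshelve. all: by end_near.
Qed.
End InvariantForm.

Section PositiveDefinite.
Context {R : realType}.

(** Induction on the size: the shear [E] clears the off-diagonal blocks and leaves [a] and the Schur
    complement [t *m b + C]. The latter is positive because it is [S] evaluated on the vectors
    [row_mx 0 y *m E]. *)
Lemma posdef_orthonormal {n} (S : 'M[R]_n) : S^T = S ->
  (forall x : 'rV_n, x != 0 -> 0 < (x *m S *m x^T) 0 0) ->
  exists2 P : 'M[R]_n, P \in unitmx & P *m S *m P^T = 1%:M.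
Proof.
elim: n S => [|n IHn] S sS pS.
  by exists 1%:M; [exact: unitmx1|apply/matrixP => -[]].
rewrite -[n.+1]/(1 + n)%N in S sS pS *.
pose a := S 0 0; pose b := ursubmx S; pose C := drsubmx S.
have SE : S = block_mx a%:M b b^T C.
  rewrite -[S in LHS]submxK -[dlsubmx S]trmxK trmx_dlsub sS; congr block_mx.
  by rewrite [ulsubmx S]mx11_scalar !mxE; congr ((S _ _)%:M); apply/val_inj.
have a0 : 0 < a.
  have := pS (delta_mx 0 0); rewrite -rowE trmx_delta -colE !mxE; apply.
  by apply/eqP => /matrixP/(_ 0 0); rewrite !mxE !eqxx => /eqP; rewrite oner_eq0.
pose t : 'cV[R]_n := - (a^-1 *: b^T).
pose E : 'M[R]_(1 + n) := block_mx 1%:M 0 t 1%:M.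
have ESE : E *m S *m E^T = block_mx a%:M 0 0 (t *m b + C).
  rewrite SE /E tr_block_mx !mulmx_block !trmx0 !trmx1 !mul1mx !mul0mx !mulmx1 !mulmx0.
  rewrite !addr0 mul_mx_scalar.
  have -> : a *: t + b^T = 0.
    by rewrite scalerN scalerA divff ?gt_eqF // scale1r addrC subrr.
  rewrite mul0mx add0r; congr block_mx.
  by rewrite mul_scalar_mx linearN linearZ /= trmxK scalerN scalerA divff ?gt_eqF // scale1r addrC subrr.
have uE : E \in unitmx by rewrite unitmxE det_lblock !det1 mulr1 unitr1.
have [||Q uQ QC] := IHn (t *m b + C).
- have : (E *m S *m E^T)^T = E *m S *m E^T by rewrite !trmx_mul trmxK sS mulmxA.
  by rewrite ESE tr_block_mx => /eq_block_mx[].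
- move=> y y0; have := pS (row_mx 0 y *m E).
  have -> : (row_mx 0 y *m E *m S *m (row_mx 0 y *m E)^T) = y *m (t *m b + C) *m y^T.
    transitivity (row_mx 0 y *m (E *m S *m E^T) *m (row_mx 0 y)^T).
      by rewrite trmx_mul !mulmxA.
    by rewrite ESE mul_row_block tr_row_mx mul_row_col !mul0mx !add0r mulmx0 mul0mx add0r.
  apply; apply: contraNneq y0 => /(congr1 (mulmx^~ (invmx E))).
  by rewrite mulmxK // mul0mx -row_mx0 => /eq_row_mx[_ ->].
pose D : 'M[R]_(1 + n) := block_mx (Num.sqrt a)^-1%:M 0 0 Q.
exists (D *m E).
  rewrite unitmx_mul uE andbT unitmxE det_lblock unitrM; move: uQ; rewrite unitmxE => ->; rewrite andbT.
  by rewrite det_scalar1 unitfE invr_eq0 sqrtr_eq0 -ltNge.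
have -> : D *m E *m S *m (D *m E)^T = D *m (E *m S *m E^T) *m D^T.
  by rewrite trmx_mul !mulmxA.
rewrite ESE /D tr_block_mx !mulmx_block !trmx0 !mul0mx !mulmx0 !addr0 !add0r !mul0mx ?mulmx0 QC.
have sa : Num.sqrt a != 0 by rewrite sqrtr_eq0 -ltNge.
rewrite tr_scalar_mx -!scalar_mxM.
have -> : (Num.sqrt a)^-1 * a * (Num.sqrt a)^-1 = 1.
  by rewrite -{2}(sqr_sqrtr (ltW a0)) expr2 mulKf // divff.
by rewrite -scalar_mx_block.
Qed.

(** In a frame orthonormal for [S] the matrix becomes skew-symmetric, and the trace of the square of
    such a matrix is minus its squared Frobenius norm. *)
Lemma skew_trace_sqr {n} (S A : 'M[R]_n) : S^T = S ->
  (forall x : 'rV_n, x != 0 -> 0 < (x *m S *m x^T) 0 0) ->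
  A *m S = - (S *m A^T) ->
  \tr (A *m A) <= 0 /\ (\tr (A *m A) = 0 -> A = 0).
Proof.
move=> sS pS AS; have [P uP PS] := posdef_orthonormal sS pS.
have SE : S = invmx P *m (invmx P)^T.
  rewrite -[invmx P in X in X *m _]mulmx1 -PS trmx_inv !mulmxA mulVmx // mul1mx.
  by rewrite mulmxK // unitmx_tr.
pose B := P *m A *m invmx P.
have BT : B^T = - B.
  have : P *m (A *m S) *m P^T = - (P *m (S *m A^T) *m P^T).
    by rewrite AS mulmxN mulNmx.
  rewrite SE !mulmxA mulmxV // mul1mx -!mulmxA -trmx_mul mulmxV // trmx1 mulmx1 mulmxA.
  by move=> BE; rewrite [in RHS]/B BE opprK /B !trmx_mul.
have AE : \tr (A *m A) = - fro B.
  rewrite fro_trE BT mulmxN [\tr (- _)]raddfN /= opprK /B -!mulmxA [RHS]mxtrace_mulC.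
  by rewrite -!mulmxA mulVmx // mulmx1 mulKmx.
rewrite AE; split; first by rewrite oppr_le0 fro_ge0.
move=> /eqP; rewrite oppr_eq0 => /eqP/fro_eq0 B0.
have <- : invmx P *m B *m P = A by rewrite /B !mulmxA mulVmx // mul1mx mulmxKV.
by rewrite B0 mulmx0 mul0mx.
Qed.

(** In an orthonormal frame an isometry is an orthogonal matrix, whose squared Frobenius norm is
    [n]; the other factors of the constant come from changing the frame. *)
Lemma isometry_bounded {n} (S : 'M[R]_n) : S^T = S ->
  (forall x : 'rV_n, x != 0 -> 0 < (x *m S *m x^T) 0 0) ->
  exists C, forall A : 'M[R]_n, A *m S *m A^T = S -> `|A| <= C.
Proof.
move=> sS pS; have [P uP PS] := posdef_orthonormal sS pS.
have SE : S = invmx P *m (invmx P)^T.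
  rewrite -[invmx P in X in X *m _]mulmx1 -PS trmx_inv !mulmxA mulVmx // mul1mx.
  by rewrite mulmxK // unitmx_tr.
exists (n%:R * (n%:R * `|invmx P| * Num.sqrt n%:R) * `|P|) => A AS.
pose B := P *m A *m invmx P.
have AE : A = invmx P *m B *m P by rewrite /B !mulmxA mulVmx // mul1mx -mulmxA mulVmx // mulmx1.
have BB : B *m B^T = 1%:M.
  by rewrite -PS -[in RHS]AS SE /B !trmx_mul !mulmxA.
rewrite AE; apply: le_trans (mulmx_norm _ _) _.
rewrite ler_wpM2r // ler_wpM2l //; apply: le_trans (mulmx_norm _ _) _.
rewrite ler_wpM2l ?mulr_ge0 // -(ler_sqr (x := `|B|)) ?nnegrE ?sqrtr_ge0 //.
by rewrite sqr_sqrtr // (le_trans (norm_le_fro _)) // fro_trE BB mxtrace1.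
Qed.

End PositiveDefinite.

(** * The matrix exponential *)

HB.instance Definition _ (R : realType) (m n : nat) :=
  Uniform_isComplete.Build 'M[R]_(m, n) (@cauchy_cvg 'M[R]_(m, n)).

Section CauchyProduct.
Context {R : realType}.

(** Bookkeeping for Cauchy products: the last sum is what a product of partial sums has in excess of
    the partial Cauchy sum. *)
Lemma sum_square_triangle {V : nmodType} n (G : nat -> nat -> V) :
  \sum_(i < n) \sum_(j < n) G i j =
  \sum_(k < n) \sum_(i < k.+1) G i (k - i)%N +
  \sum_(i < n) \sum_(j < n | (n <= i + j)%N) G i j.
Proof.
have -> : \sum_(k < n) \sum_(i < k.+1) G i (k - i)%N =
    \sum_(i < n) \sum_(j < n | (i + j < n)%N) G i j.
  transitivity (\sum_(k < n) \sum_(i < n | (i <= k)%N) G i (k - i)%N).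
    apply: eq_bigr => k _.
    by rewrite (big_ord_widen n (fun i => G i (k - i)%N)) //; exact: ltn_ord.
  rewrite (exchange_big_dep predT) //=; apply: eq_bigr => i _.
  rewrite -(big_geq_mkord _ _ predT (fun k => G i (k - i)%N)).
  rewrite -{1}[nat_of_ord i]add0n big_addn.
  rewrite (eq_big_nat _ _ (F2 := G i)); last by move=> k _; rewrite addnK.
  rewrite (big_nat_widen _ _ n) ?leq_subr // big_mkord.
  by apply: eq_bigl => j; rewrite ltn_subRL.
rewrite -big_split; apply: eq_bigr => i _ /=.
rewrite (bigID (fun j : 'I_n => (i + j < n)%N)) /=; congr (_ + _).
by apply: eq_bigl => j; rewrite -leqNgt.
Qed.

Section Bilinear.
Context {U V W : normedModType R} (f : U -> V -> W).
Hypothesis fl : forall v, linear (f^~ v).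
Hypothesis fr : forall u, linear (f u).

(** By the Leibniz rule both sides obey the recursion [DW (z k) = k.+1%:R *: z k.+1] with the same
    initial term, and [k.+1] is invertible. *)
Lemma exp_coeff_bilinear (DU : U -> U) (DV : V -> V) (DW : W -> W) (x : nat -> U)
    (y : nat -> V) (z : nat -> W) :
  linear DW ->
  (forall i j, DW (f (x i) (y j)) = f (DU (x i)) (y j) + f (x i) (DV (y j))) ->
  (forall k, DU (x k) = k.+1%:R *: x k.+1) ->
  (forall k, DV (y k) = k.+1%:R *: y k.+1) ->
  (forall k, DW (z k) = k.+1%:R *: z k.+1) ->
  z 0%N = f (x 0%N) (y 0%N) ->
  forall k, z k = \sum_(i < k.+1) f (x i) (y (k - i)%N).
Proof.
move=> lDW leib DUx DVy DWz z0; elim=> [|k IHk]; first by rewrite big_ord1.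
have k0 : k.+1%:R != 0 :> R by rewrite pnatr_eq0.
apply: (scalerI k0); rewrite -DWz IHk (linf_sum lDW).
transitivity (\sum_(i < k.+2) (i%:R *: f (x i) (y (k.+1 - i)%N)) +
              \sum_(i < k.+2) ((k.+1 - i)%:R *: f (x i) (y (k.+1 - i)%N))).
  rewrite [X in _ = X + _]big_ord_recl /= scale0r add0r.
  rewrite [X in _ = _ + X]big_ord_recr /= subnn scale0r addr0 -big_split /=.
  apply: eq_bigr => i _; rewrite leib DUx DVy (linfZ (fl _)) (linfZ (fr _)).
  by rewrite /bump /= add1n subSS subSn // -ltnS.
rewrite -big_split /= scaler_sumr; apply: eq_bigr => i _.
by rewrite -scalerDl -natrD subnKC // -ltnS.
Qed.

Context (C : R).
Hypothesis C0 : 0 <= C.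
Hypothesis fC : forall u v, `|f u v| <= C * `|u| * `|v|.

Lemma bilinear_cvg {T} {F : set_system T} {FF : Filter F} (x : T -> U) (y : T -> V) lx ly :
  x @ F --> lx -> y @ F --> ly -> (fun n => f (x n) (y n)) @ F --> f lx ly.
Proof.
move=> cx cy; apply/subr_cvg0/norm_cvg0P.
have c0 : (fun n => C * `|x n - lx| * `|y n| + C * `|lx| * `|y n - ly|) @ F --> 0.
  have -> : 0 = C * `|0 : U| * `|ly| + C * `|lx| * `|0 : V| :> R.
    by rewrite !normr0 !(mulr0, mul0r) addr0.
  have cx' : (fun n => x n - lx) @ F --> (0 : U) by apply/subr_cvg0.
  have cy' : (fun n => y n - ly) @ F --> (0 : V) by apply/subr_cvg0.
  apply: cvgD; apply: cvgM; try exact: cvg_cst; try exact: cvg_norm.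
  by apply: cvgM; [exact: cvg_cst|exact: cvg_norm].
apply: (squeeze_cvgr _ (cvg_cst 0) c0); apply: nearW => n; rewrite normr_ge0 /=.
have -> : f (x n) (y n) - f lx ly = f (x n - lx) (y n) + f lx (y n - ly).
  by rewrite (linfB (fl _)) (linfB (fr _)) addrA subrK.
by rewrite (le_trans (ler_normD _ _)) // lerD.
Qed.

(** The truncation error is dominated by that of the scalar exponential series of [a] and [b], which
    tends to [expR a * expR b - expR (a + b) = 0]. *)
Lemma cauchy_product (x : nat -> U) (y : nat -> V) (lx : U) (ly : V) (a b c d : R) :
  0 <= a -> 0 <= b -> 0 <= c -> 0 <= d ->
  (forall k, `|x k| <= c * exp_coeff a k) -> (forall k, `|y k| <= d * exp_coeff b k) ->
  series x @ \oo --> lx -> series y @ \oo --> ly ->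
  series (fun k => \sum_(i < k.+1) f (x i) (y (k - i)%N)) @ \oo --> f lx ly.
Proof.
move=> a0 b0 c0 d0 xa yb cx cy; set z := fun k => _.
pose K := C * (c * d).
have K0 : 0 <= K by rewrite !mulr_ge0.
have ec0 t k : 0 <= t -> 0 <= exp_coeff t k :> R.
  by move=> t0; rewrite /exp_coeff /= divr_ge0 ?exprn_ge0.
pose r n := K * (series (exp_coeff a) n * series (exp_coeff b) n -
                 series (exp_coeff (a + b)) n).
have cr : r @ \oo --> 0.
  have -> : 0 = K * (expR a * expR b - expR (a + b)) by rewrite expRD subrr mulr0.
  apply: cvgM; first exact: cvg_cst.
  by apply: cvgB; [apply: cvgM|]; exact: is_cvg_series_exp_coeff.
have expD k : exp_coeff (a + b) k = \sum_(i < k.+1) exp_coeff a i * exp_coeff b (k - i)%N.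
  rewrite /exp_coeff /= addrC exprDn mulr_suml; apply: eq_bigr => i _.
  have ik : (i <= k)%N by rewrite -ltnS.
  rewrite -[X in X / _]mulr_natr -(bin_fact ik) !natrM; field.
  by rewrite !pnatr_eq0 -!lt0n !fact_gt0 bin_gt0 ik.
have dist n : `|f (series x n) (series y n) - series z n| <= r n.
  rewrite /series /= !big_mkord (linf_sum (fl _)).
  under eq_bigr do rewrite (linf_sum (fr _)).
  rewrite (sum_square_triangle n (fun i j => f (x i) (y j))) addrC addKr /r /series /= !big_mkord.
  have -> : (\sum_(i < n) exp_coeff a i) * (\sum_(i < n) exp_coeff b i) -
      \sum_(i < n) exp_coeff (a + b) i =
      \sum_(i < n) \sum_(j < n | (n <= i + j)%N) exp_coeff a i * exp_coeff b j.
    under [X in _ - X]eq_bigr do rewrite expD.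
    rewrite mulr_suml; under [X in X - _]eq_bigr do rewrite mulr_sumr.
    by rewrite (sum_square_triangle n (fun i j => exp_coeff a i * exp_coeff b j)) addrC addKr.
  rewrite (le_trans (ler_norm_sum _ _ _)) // mulr_sumr ler_sum // => i _.
  rewrite (le_trans (ler_norm_sum _ _ _)) // mulr_sumr ler_sum // => j _.
  rewrite (le_trans (fC _ _)) // /K -[C * _ * _]mulrA -[leRHS]mulrA ler_wpM2l //.
  by rewrite [leRHS]mulrACA ler_pM.
have -> : series z = (fun n => f (series x n) (series y n) -
    (f (series x n) (series y n) - series z n)).
  by apply/funext => n; rewrite subKr.
rewrite -[f lx ly]subr0; apply: cvgB; first exact: bilinear_cvg.
apply/norm_cvg0P; apply: (squeeze_cvgr _ (cvg_cst 0) cr).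
by apply: nearW => n; rewrite normr_ge0 dist.
Qed.
End Bilinear.
End CauchyProduct.

Section MatrixExp.
Context {R : realType} {m : nat}.
Implicit Types X Y : 'M[R]_m.

Lemma norm_mx1_le1 : `|1%:M : 'M[R]_m| <= 1.
Proof.
by apply: mx_norm_le => // i j; rewrite mxE; case: (i == j); rewrite ?normr1 ?normr0.
Qed.

Lemma norm_expX X k : `|X ^+ k| <= (m%:R * `|X|) ^+ k.
Proof.
elim: k => [|k IHk]; first by rewrite expr0; exact: norm_mx1_le1.
rewrite exprS (le_trans (mulmx_norm _ _)) // exprS ler_wpM2l // mulr_ge0 //.
Qed.

Lemma norm_expXS X k : m%:R * `|X ^+ k.+1| <= (m%:R * `|X|) ^+ k.+1.
Proof.
elim: k => [|k IHk]; first by rewrite !expr1.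
rewrite exprS [leRHS]exprS -[X * _]/(X *m _).
rewrite (le_trans (ler_wpM2l _ (mulmx_norm _ _))) //.
by rewrite [leLHS]mulrCA ler_pM // ?mulr_ge0.
Qed.

Definition exp_term X k := (k`!%:R : R)^-1 *: X ^+ k.

Lemma norm_exp_term X k : `|exp_term X k| <= exp_coeff (m%:R * `|X|) k.
Proof.
by rewrite normrZ ger0_norm ?invr_ge0 // mulrC ler_wpM2r ?invr_ge0 // norm_expX.
Qed.

Definition expm X : 'M[R]_m := limn (series (exp_term X)).

Lemma expm_cvg X : series (exp_term X) @ \oo --> expm X.
Proof.
suff : cvgn (series (exp_term X)) by [].
apply: (@normed_cvg R 'M[R]_m); apply: (series_le_cvg _ _ (norm_exp_term X)) => //.
  by move=> k; rewrite /exp_coeff /= divr_ge0 // exprn_ge0 // mulr_ge0.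
exact: is_cvg_series_exp_coeff.
Qed.

Lemma exp_term0 X : exp_term X 0 = 1%:M.
Proof. by rewrite /exp_term fact0 invr1 scale1r expr0. Qed.

Lemma exp_termS X k : exp_term X k *m X = k.+1%:R *: exp_term X k.+1.
Proof.
rewrite /exp_term -scalemxAl scalerA factS natrM invfM mulrA divff ?pnatr_eq0 // mul1r.
by rewrite exprSr.
Qed.

Lemma expm0 : expm 0 = 1%:M.
Proof.
have /cvg_unique : series (exp_term 0) @ \oo --> expm 0 by exact: expm_cvg.
apply => //; apply: cvg_near_cst; near=> n.
have n0 : (0 < n)%N by near: n; exact: nbhs_infty_gt.
rewrite /series /= -(prednK n0) big_nat_recl //= exp_term0 big1 ?addr0 // => k _.
by rewrite /exp_term expr0n scaler0.
Unshelve. all: by end_near.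
Qed.

(** Strict differentiability at 0 with derivative the identity. An estimate between two arbitrary
    nearby points is needed, as it feeds the contraction in [hom_local_surj]. *)
Lemma expm_strict e : 0 < e -> exists2 d, 0 < d & forall X Y, `|X| < d -> `|Y| < d ->
  `|expm X - expm Y - (X - Y)| <= e * `|X - Y|.
Proof.
move=> e0; pose r : R := Num.min 1 (e / expR 1).
have r0 : 0 < r by rewrite /r lt_min ltr01 divr_gt0 // expR_gt0.
have r1 : r <= 1 by rewrite /r ge_min lexx.
have re : r * expR 1 <= e by rewrite -ler_pdivlMr ?expR_gt0 // /r ge_min lexx orbT.
exists (r / m.+1%:R); first by rewrite divr_gt0.
move=> X Y Xd Yd.
have snorm Z : `|Z| < r / m.+1%:R -> m%:R * `|Z| <= r.
  rewrite ltr_pdivlMr // => /ltW; apply: le_trans; rewrite mulrC ler_wpM2l //.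
  by rewrite ler_nat.
have {Xd}Xr := snorm _ _ Xd; have {Yd}Yr := snorm _ _ Yd.
have pow k : `|X ^+ k.+1 - Y ^+ k.+1| <= k.+1%:R * r ^+ k * `|X - Y|.
  elim: k => [|k IHk]; first by rewrite !expr1 expr0 !mul1r.
  have -> : X ^+ k.+2 - Y ^+ k.+2 = X *m (X ^+ k.+1 - Y ^+ k.+1) + (X - Y) *m Y ^+ k.+1.
    by rewrite mulmxBr mulmxBl !exprS addrA subrK.
  have -> : k.+2%:R * r ^+ k.+1 * `|X - Y| =
      r * (k.+1%:R * r ^+ k * `|X - Y|) + `|X - Y| * r ^+ k.+1.
    by rewrite -[k.+2]addn1 natrD exprS; ring.
  rewrite (le_trans (ler_normD _ _)) // lerD //.
    by rewrite (le_trans (mulmx_norm _ _)) // ler_pM // mulr_ge0.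
  rewrite (le_trans (mulmx_norm _ _)) // [m%:R * _]mulrC -mulrA ler_wpM2l //.
  by rewrite (le_trans (norm_expXS _ _)) // lerXn2r // nnegrE ?mulr_ge0 // ltW.
have powd k : `|X ^+ k.+2 - Y ^+ k.+2| <= k.+2%:R * r * `|X - Y|.
  rewrite (le_trans (pow _)) // ler_wpM2r // ler_wpM2l // exprS.
  by rewrite ler_piMr ?exprn_ile1 // ltW.
have split Z n : series (exp_term Z) n.+2 = 1%:M + Z + \sum_(k < n) exp_term Z k.+2.
  rewrite /series /= big_mkord !big_ord_recl exp_term0 addrA.
  have -> : exp_term Z (lift ord0 ord0) = Z by rewrite /exp_term /= expr1 invr1 scale1r.
  by [].
have part n : `|series (exp_term X) n.+2 - series (exp_term Y) n.+2 - (X - Y)| <= e * `|X - Y|.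
  have -> : series (exp_term X) n.+2 - series (exp_term Y) n.+2 - (X - Y) =
      \sum_(k < n) (exp_term X k.+2 - exp_term Y k.+2).
    rewrite !split sumrB; move: 1%:M (\sum_(_ < _) _) (\sum_(_ < _) _) => Z A B.
    by apply/matrixP => i j; rewrite !mxE; ring.
  apply: le_trans (_ : r * expR 1 * `|X - Y| <= _); last by rewrite ler_wpM2r.
  apply: le_trans (_ : r * series (exp_coeff 1) n.+1 * `|X - Y| <= _); last first.
    rewrite ler_wpM2r // ler_wpM2l ?(ltW r0) //.
    apply: nondecreasing_cvgn_le; last exact: is_cvg_series_exp_coeff.
    by apply: nondecreasing_series => k _ _; rewrite /exp_coeff /= divr_ge0 ?exprn_ge0.
  rewrite /series /= big_mkord big_ord_recl /= mulrDr mulrDl -[leLHS]add0r lerD //.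
    by rewrite !mulr_ge0 ?(ltW r0) // /exp_coeff /= divr_ge0.
  rewrite (le_trans (ler_norm_sum _ _ _)) // mulr_sumr mulr_suml ler_sum // => k _.
  rewrite /exp_term -scalerBr normrZ ger0_norm ?invr_ge0 //.
  rewrite (le_trans (ler_wpM2l _ (powd _))) ?invr_ge0 // /exp_coeff /= expr1n /bump /= add1n.
  rewrite le_eqVlt; apply/orP; left; apply/eqP; rewrite [k.+2`!]factS natrM; field.
  by rewrite pnatr_eq0 -lt0n fact_gt0 /= -(natrD _ 2 k) pnatr_eq0.
have cvgXY : (fun n => `|series (exp_term X) n - series (exp_term Y) n - (X - Y)|) @ \oo -->
    `|expm X - expm Y - (X - Y)|.
  apply: cvg_norm; apply: cvgB; last exact: cvg_cst.
  by apply: cvgB; exact: expm_cvg.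
apply: (cvgr_to_le cvgXY); near=> n.
have n2 : (2 <= n)%N by near: n; exact: nbhs_infty_ge.
by rewrite -(subnK n2) addn2 part.
Unshelve. all: by end_near.
Qed.
End MatrixExp.

(** Asking for the Leibniz identity only along powers of [X] and [Y] covers both commuting
    exponents, with [f] the matrix product, and exponentials of derivations, with [f] a bracket. *)
Lemma expm_bilinear {R : realType} {m n p q s t} (f : 'M[R]_(n, m) -> 'M[R]_(p, q) -> 'M[R]_(s, t))
    X Y Z u v :
  (forall v, linear (f^~ v)) -> (forall u, linear (f u)) ->
  (forall i j, f (u *m X ^+ i) (v *m Y ^+ j) *m Z =
    f (u *m X ^+ i *m X) (v *m Y ^+ j) + f (u *m X ^+ i) (v *m Y ^+ j *m Y)) ->
  f u v *m expm Z = f (u *m expm X) (v *m expm Y).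
Proof.
move=> fl fr leib; have [C C0 fC] := mx_bilinear_bounded fl fr.
have mulc a b (w : 'M[R]_(a, b)) W :
    series (fun k => w *m exp_term W k) @ \oo --> w *m expm W.
  have -> : series (fun k => w *m exp_term W k) = (mulmx w) \o series (exp_term W).
    by apply/funext => k /=; rewrite /series /= mulmx_sumr.
  apply: continuous_cvg; last exact: expm_cvg.
  by apply: mx_linear_continuous => k A B; rewrite mulmxDr -scalemxAr.
have mulb a b (w : 'M[R]_(a, b)) W k :
    `|w *m exp_term W k| <= b%:R * `|w| * exp_coeff (b%:R * `|W|) k.
  by rewrite (le_trans (mulmx_norm _ _)) // ler_wpM2l ?mulr_ge0 // norm_exp_term.
have := @cauchy_product _ _ _ _ f fl fr C C0 fC (fun k => u *m exp_term X k)
  (fun k => v *m exp_term Y k) _ _ (m%:R * `|X|) (q%:R * `|Y|) (m%:R * `|u|) (q%:R * `|v|)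
  ltac:(by rewrite mulr_ge0) ltac:(by rewrite mulr_ge0) ltac:(by rewrite mulr_ge0)
  ltac:(by rewrite mulr_ge0) (mulb _ _ u X) (mulb _ _ v Y) (mulc _ _ u X) (mulc _ _ v Y).
have -> : (fun k => \sum_(i < k.+1) f (u *m exp_term X i) (v *m exp_term Y (k - i)%N)) =
    (fun k => f u v *m exp_term Z k).
  apply/funext => k; apply/esym.
  apply: (@exp_coeff_bilinear _ _ _ _ f fl fr (mulmx^~ X) (mulmx^~ Y) (mulmx^~ Z)
    (fun k => u *m exp_term X k) (fun k => v *m exp_term Y k) (fun k => f u v *m exp_term Z k)) => //.
  - by move=> a A B; rewrite mulmxDl -scalemxAl.
  - move=> i j; rewrite /exp_term -!scalemxAr -!scalemxAl !(linfZ (fl _)) !(linfZ (fr _)).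
    rewrite -!scalemxAl leib !scalerDr.
    by congr (_ + _); rewrite !scalerA.
  - by move=> j; rewrite -mulmxA exp_termS -scalemxAr.
  - by move=> j; rewrite -mulmxA exp_termS -scalemxAr.
  - by move=> j; rewrite -mulmxA exp_termS -scalemxAr.
  - by rewrite !exp_term0 !mulmx1.
by move=> h; exact: (cvg_unique _ (mulc _ _ (f u v) Z) h).
Qed.

Lemma expmD_comm {R : realType} {m} (X Y : 'M[R]_m) : X *m Y = Y *m X ->
  expm (X + Y) = expm X *m expm Y.
Proof.
move=> XY; rewrite -[expm X]mul1mx -[expm Y]mul1mx -[LHS]mul1mx -[1%:M in LHS]mulmx1.
apply: expm_bilinear => [v a A B|u a A B|i j].
- by rewrite mulmxDl -scalemxAl.
- by rewrite mulmxDr -scalemxAr.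
rewrite !mul1mx mulmxDr -!mulmxA; congr (_ + _); congr (_ *m _).
by apply/esym; exact: (commrX j (XY : GRing.comm X Y)).
Qed.

(** * Automorphisms near the identity *)

Section BracketMaps.
Context {R : realType} {m : nat} (br : 'rV[R]_m -> 'rV[R]_m -> 'rV[R]_m).
Hypothesis brl : forall v, linear (br^~ v).
Hypothesis brr : forall u, linear (br u).

Definition br_hom (a : 'M[R]_m) := forall u v, br (u *m a) (v *m a) = br u v *m a.
Definition br_der (D : 'M[R]_m) :=
  forall u v, br u v *m D = br (u *m D) v + br u (v *m D).

Lemma br_homM a b : br_hom a -> br_hom b -> br_hom (a *m b).
Proof. by move=> ha hb u v; rewrite !mulmxA hb ha. Qed.

Lemma br_homV a b : b *m a = 1%:M -> br_hom a -> br_hom b.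
Proof.
move=> ba ha u v; have ab := mulmx1C ba.
by rewrite -[LHS]mulmx1 -ab mulmxA -ha -!mulmxA ba !mulmx1.
Qed.

Lemma expm_br_hom D : br_der D -> br_hom (expm D).
Proof.
move=> hD u v; apply/esym.
by apply: (expm_bilinear brl brr) => i j; rewrite hD.
Qed.

(** For an automorphism [1%:M + N], the failure of [N] to be a derivation equals
    [br (u *m N) (v *m N)], hence is quadratic in [N]. This defect depends linearly on [N];
    subtracting a preimage of it under a fixed linear pseudo-inverse leaves a derivation. *)
Lemma near_identity_br_hom : exists2 C, 0 <= C & forall N, br_hom (1%:M + N) ->
  exists2 D, br_der D & `|N - D| <= C * `|N| ^+ 2.
Proof.
pose e i : 'rV[R]_m := delta_mx 0 i.
pose d N u v := br u v *m N - br (u *m N) v - br u (v *m N).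
pose del N : 'M[R]_(m, m * m) :=
  \matrix_i mxvec (\matrix_j d N (e i) (e j)).
have d_lin u v : linear (fun N => d N u v).
  move=> k A B; rewrite /d !mulmxDr -!scalemxAr (brl v k) (brr u k).
  move: (br u v *m A) (br u v *m B) (br (u *m A) v) (br (u *m B) v) (br u (v *m A)) (br u (v *m B)) => *.
  by apply/matrixP => ? ?; rewrite !mxE; ring.
have del_lin : linear del.
  move=> k A B; apply/row_matrixP => i; rewrite linearP /= !rowK -linearP; congr mxvec.
  by apply/row_matrixP => j; rewrite linearP /= !rowK d_lin.
pose F := linfun del.
have FE N : F N = del N by rewrite (linfunE del_lin).
have del0 D : del D = 0 -> br_der D.
  move=> D0 u v; apply/eqP; rewrite -subr_eq0 opprD addrA; apply/eqP.
  have d0 i j : d D (e i) (e j) = 0.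
    have := congr1 (row i) D0; rewrite row0 rowK => /eqP; rewrite mxvec_eq0.
    by move=> /eqP/(congr1 (row j)); rewrite rowK row0.
  have lv : linear (fun v => d D u v).
    move=> k x y; rewrite /d mulmxDl -scalemxAl (brr u k) (brr (u *m D) k) (brr u k).
    rewrite mulmxDl -scalemxAl; move: (br u x *m D) (br u y *m D) (br (u *m D) x) (br (u *m D) y) (br u (x *m D)) (br u (y *m D)) => *.
    by apply/matrixP => ? ?; rewrite !mxE; ring.
  apply: (rV_linear_eq0 lv) => j.
  have lu : linear (fun u => d D u (e j)).
    move=> k x y; rewrite /d mulmxDl -scalemxAl (brl (e j) k) (brl (e j) k) (brl _ k).
    rewrite mulmxDl -scalemxAl; move: (br x (e j) *m D) (br y (e j) *m D) (br (x *m D) (e j)) (br (y *m D) (e j)) (br x (e j *m D)) (br y (e j *m D)) => *.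
    by apply/matrixP => ? ?; rewrite !mxE; ring.
  by apply: (rV_linear_eq0 lu) => i; exact: d0.
have [C1 C10 brC] := mx_bilinear_bounded brl brr.
have Klin : linear (F^-1)%VF by exact: linearP.
have [C2 C20 KC] := mx_linear_bounded Klin.
exists (C2 * (C1 * m%:R ^+ 2)); first by rewrite !mulr_ge0 ?exprn_ge0.
move=> N hN; exists (N - (F^-1)%VF (F N)).
  apply: del0; rewrite -FE linearB /= limg_lfunVK ?memv_img ?memvf // subrr //.
rewrite opprB addrCA subrr addr0 (le_trans (KC _)) // -mulrA ler_wpM2l //.
rewrite FE; apply: mx_norm_le => [|i k]; first by rewrite !mulr_ge0 ?sqr_ge0.
have [j l] := mxvec_indexP k.
have -> : del N i (mxvec_index j l) = d N (e i) (e j) 0 l.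
  by rewrite mxE mxvecE mxE.
apply: le_trans (mx_entry_le _ _ _) _.
have -> : d N (e i) (e j) = br (e i *m N) (e j *m N).
  have := hN (e i) (e j); rewrite !mulmxDr !mulmx1 (linfD (brl _)) !(linfD (brr _)).
  rewrite /d -!addrA => /addrI <-.
  move: (br (e i) (e j *m N)) (br (e i *m N) (e j)) (br (e i *m N) (e j *m N)) => *.
  by apply/matrixP => ? ?; rewrite !mxE; ring.
apply: le_trans (brC _ _) _; rewrite -!mulrA ler_wpM2l //.
have en k' : `|e k' *m N| <= m%:R * `|N|.
  rewrite (le_trans (mulmx_norm _ _)) // -mulrA ler_wpM2l // ler_piMl //.
  by apply: mx_norm_le => // a b; rewrite mxE; case: (_ && _); rewrite ?normr1 ?normr0.
have -> : m%:R * (m%:R * `|N| ^+ 2) = (m%:R * `|N|) * (m%:R * `|N|) by ring.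
by rewrite ler_pM.
Qed.

(** Strict differentiability: for linear [L], the difference [F - L] is Lipschitz near [u0] with a
    constant as small as desired. *)
Definition strict_diff {n} (F : 'rV[R]_n -> 'M[R]_m) u0 (L : 'rV[R]_n -> 'M[R]_m) :=
  forall e, 0 < e -> exists2 d, 0 < d & forall u v, `|u - u0| < d -> `|v - u0| < d ->
    `|F u - F v - L (u - v)| <= e * `|u - v|.

(* The contraction principle yields [u] such that [F u] and [phi] have the same
   component along the derivations; then [N = phi (F u)^-1 - 1] is a derivation
   up to an error of order [|N|^2] and has almost no such component, so [N = 0]. *)
Lemma hom_local_surj {n} (F : 'rV[R]_n -> 'M[R]_m) u0 (L : 'Hom('rV[R]_n, 'M[R]_m)) :
  strict_diff F u0 L -> F u0 = 1%:M ->
  (exists2 d, 0 < d & forall u, `|u - u0| < d -> br_hom (F u) /\ F u \in unitmx) ->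
  (forall D, br_der D -> D \in limg L) ->
  exists2 e, 0 < e & forall phi, br_hom phi -> `|phi - 1%:M| < e ->
    exists u, phi = F u.
Proof.
move=> sF F0 [d1 d10 hF] derL; have [C C0 nearC] := near_identity_br_hom.
(* [K] is a linear section of [L] over its image and [P] a projection onto that image, which
   contains all derivations by [derL]. *)
pose K := (L^-1)%VF; have [CK CK0 KC] := mx_linear_bounded (linearP K).
pose P := (L \o K)%VF; have [CP CP0 PC] := mx_linear_bounded (linearP P).
have PL D : D \in limg L -> P D = D by move=> DL; rewrite comp_lfunE limg_lfunVK.
have PP D : P (P D) = P D by apply: PL; rewrite comp_lfunE memv_img ?memvf.
(* Chosen so that the map [T] below has Lipschitz constant at most 1/2. *)
pose e0 : R := (2 * (CP * CK + 1))^-1.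
have e00 : 0 < e0 by rewrite invr_gt0 mulr_gt0 // ltr_wpDl // mulr_ge0.
have e0P : CP * e0 * CK <= 2^-1.
  have -> : CP * e0 * CK = 2^-1 * ((CP * CK) / (CP * CK + 1)).
    rewrite /e0; field; rewrite lt0r_neq0 //; last by rewrite ltr_wpDl // mulr_ge0.
  rewrite ler_piMr // ler_pdivrMr ?ltr_wpDl ?mulr_ge0 // mul1r lerDl //.
have [d0 d00 sFd] := sF e0 e00.
pose B : R := CP + e0 * CK.
(* [M] dominates every constant of the final estimate, so that the norms of [F u - 1%:M] and
   [phi - 1%:M], kept below [(8 * M)^-1], stay below 1/8 when multiplied by any of them. *)
pose M : R := CP * m%:R + (CP + 1) * C + m%:R + 1.
have B0 : 0 <= B by rewrite addr_ge0 // mulr_ge0 // ltW.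
have M1 : 1 <= M by rewrite /M lerDr !addr_ge0 ?mulr_ge0 ?addr_ge0.
have M0 : 0 < M by exact: lt_le_trans M1.
have [r [r0 rd0 rd1 rB]] : exists r : R, [/\ 0 < r, CK * r < d0, CK * r < d1 & B * r <= (8 * M)^-1].
  pose b := Num.min d0 (Num.min d1 (8 * M)^-1).
  have b0 : 0 < b by rewrite !lt_min d00 d10 invr_gt0 mulr_gt0.
  have k0 : 0 < CK + B + 1 by rewrite ltr_wpDl // addr_ge0.
  have lt_b : CK * (b / (CK + B + 1)) < b.
    rewrite mulrCA gtr_pMr // ltr_pdivrMr // mul1r; lra.
  exists (b / (CK + B + 1)); split.
  - exact: divr_gt0.
  - by rewrite (lt_le_trans lt_b) // ge_min lexx.
  - by rewrite (lt_le_trans lt_b) // !ge_min lexx orbT.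
  - apply: (@le_trans _ _ b); last by rewrite !ge_min lexx !orbT.
    rewrite mulrCA ger_pMr // ler_pdivrMr // mul1r; lra.
exists (Num.min (r / (2 * (CP + 1))) (8 * M)^-1).
  by rewrite lt_min divr_gt0 ?mulr_gt0 ?ltr_wpDl //= invr_gt0 mulr_gt0.
move=> phi hphi; rewrite lt_min => /andP[phir phiM].
(* A fixed point satisfies [P (phi - F (u0 + K D)) = 0]. Up to a projection, [D - F (u0 + K D)] is
   [F] with its linear part removed, whence the contraction. *)
pose T D := P (D - F (u0 + K D) + phi).
have KD D : `|D| <= r -> `|u0 + K D - u0| < d0 /\ `|u0 + K D - u0| < d1.
  move=> Dr; rewrite addrAC subrr add0r.
  have KDr : `|K D| <= CK * r by rewrite (le_trans (KC _)) // ler_wpM2l.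
  by split; exact: le_lt_trans KDr _.
have Tlip D D' : `|D| <= r -> `|D'| <= r -> `|T D - T D'| <= 2^-1 * `|D - D'|.
  move=> Dr Dr'; have [k1 _] := KD _ Dr; have [k2 _] := KD _ Dr'.
  have -> : T D - T D' = - P (F (u0 + K D) - F (u0 + K D') - L ((u0 + K D) - (u0 + K D'))).
    have -> : u0 + K D - (u0 + K D') = K (D - D').
      by rewrite opprD addrACA subrr add0r linearB.
    rewrite -linearB -linearN /=; rewrite -[L (K _)](comp_lfunE L K) -/P.
    rewrite opprB [RHS]linearD /= PP -linearD; congr (P _).
    by move: (F _) (F _) => A1 A2; apply/matrixP => i j; rewrite !mxE; ring.
  rewrite normrN (le_trans (PC _)) //.
  rewrite (le_trans (ler_wpM2l CP0 (sFd _ _ k1 k2))) //.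
  have -> : u0 + K D - (u0 + K D') = K (D - D').
    by rewrite opprD addrACA subrr add0r linearB.
  rewrite mulrA (le_trans (ler_wpM2l _ (KC _))) ?mulr_ge0 ?(ltW e00) // mulrA.
  by rewrite ler_wpM2r.
have T0r : `|T 0| <= r / 2.
  rewrite /T linear0 addr0 F0 sub0r addrC (le_trans (PC _)) //.
  apply: le_trans (_ : CP * (r / (2 * (CP + 1))) <= _).
    by rewrite ler_wpM2l // ltW.
  have CP1 : 0 < CP + 1 by rewrite ltr_wpDl.
  have -> : CP * (r / (2 * (CP + 1))) = (r / 2) * (CP / (CP + 1)).
    by field; rewrite gt_eqF.
  rewrite ger_pMr ?divr_gt0 // ler_pdivrMr // mul1r; lra.
pose U := [set D : 'M[R]_m | `|D| <= r].
have TU : set_fun U U T.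
  move=> D; rewrite /U /= => Dr; have := Tlip D 0 Dr; rewrite normr0 subr0 => /(_ (ltW r0)).
  move=> h; rewrite -[T D](subrK (T 0)) (le_trans (ler_normD _ _)) //.
  have : 2^-1 * `|D| <= r / 2 by rewrite mulrC ler_wpM2r.
  move: h T0r; lra.
have [Dst Ust fixD] : exists2 D, U D & D = T D.
  apply: (@banach_fixed_point R _ U (mkfun TU)).
  - exists (2^-1)%:nng; split => /=; first lra.
    by move=> [D D'] /= [UD UD']; exact: Tlip.
  - apply: (@closed_comp _ _ (fun D : 'M[R]_m => `|D|) [set x | x <= r]).
      by move=> ? _; exact: norm_continuous.
    exact: closed_le.
  - by exists 0; rewrite /U /= normr0 ltW.
pose u := u0 + K Dst; exists u.
have [ku0 ku1] := KD _ Ust; have [hpsi upsi] := hF _ ku1; rewrite -/u in ku0 ku1 hpsi upsi.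
have Pphi : P (phi - F u) = 0.
  have PD : P Dst = Dst by rewrite fixD PP.
  have : P Dst = P (Dst + (phi - F u)) by rewrite PD {1}fixD /T addrAC addrA.
  by rewrite linearD /= -{1}[P Dst]addr0 => /addrI.
have psi1 : `|F u - 1%:M| <= (8 * M)^-1.
  have h0 : `|u0 - u0| < d0 by rewrite subrr normr0.
  have h := sFd u u0 ku0 h0; have uE : u - u0 = K Dst by rewrite /u addrAC subrr add0r.
  rewrite uE F0 -[L (K _)](comp_lfunE L K) -/P in h.
  rewrite -[F _ - _](subrK (P Dst)) (le_trans (ler_normD _ _)) //.
  apply: le_trans rB; rewrite /B [X in _ <= X]mulrDl addrC lerD //.
    by rewrite (le_trans (PC _)) // ler_wpM2l.
  rewrite (le_trans h) // -mulrA ler_wpM2l ?(ltW e00) // (le_trans (KC _)) // ler_wpM2l //.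
pose N := phi *m invmx (F u) - 1%:M.
have Npsi : N *m F u = phi - F u by rewrite mulmxBl mulmxKV // mul1mx.
have hN : br_hom (1%:M + N).
  rewrite /N addrCA subrr addr0; apply: br_homM => //.
  by apply: (br_homV (a := F u)) => //; rewrite mulVmx.
have NE : N = phi - F u - N *m (F u - 1%:M) by rewrite mulmxBr mulmx1 Npsi subKr.
have t0 : `|F u - 1%:M| * M <= 8^-1.
  by move: psi1; rewrite invfM -ler_pdivlMr ?invr_gt0 // invrK.
have s0 : `|phi - 1%:M| * M <= 8^-1.
  by move: (ltW phiM); rewrite invfM -ler_pdivlMr ?invr_gt0 // invrK.
have CPm : 0 <= CP * m%:R by exact: mulr_ge0.
have CPC : 0 <= (CP + 1) * C by rewrite mulr_ge0 // addr_ge0.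
have mM : m%:R <= M by rewrite /M; move: (ler0n R m); lra.
have CPmM : CP * m%:R <= M by rewrite /M; move: (ler0n R m); lra.
have CPCM : (CP + 1) * C <= M by rewrite /M; move: (ler0n R m); lra.
pose x := `|N|; pose t := `|F u - 1%:M|; pose s := `|phi - 1%:M|.
have x0 : 0 <= x by exact: normr_ge0.
have t00 : 0 <= t by exact: normr_ge0.
have s00 : 0 <= s by exact: normr_ge0.
rewrite -/t in t0; rewrite -/s in s0.
have mt (c : R) : 0 <= c -> c <= M -> c * t <= 8^-1.
  by move=> c0 cM; rewrite (le_trans _ t0) // mulrC ler_wpM2l.
(* An a priori bound on [N]: it makes the quadratic error [C * x ^+ 2] a small multiple of [x]. *)
have Nsmall : x * M <= 2^-1.
  have h : x <= s + t + x * 8^-1.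
    rewrite {1}/x NE (le_trans (ler_normB _ _)) // lerD //.
      have -> : phi - F u = (phi - 1%:M) - (F u - 1%:M) by rewrite opprB addrA subrK.
      exact: ler_normB.
    rewrite (le_trans (mulmx_norm _ _)) // -/x -/t [m%:R * x]mulrC -mulrA ler_wpM2l //.
    exact: mt.
  have : x * M <= (s + t) * M + x * 8^-1 * M by rewrite -mulrDl ler_wpM2r // ltW.
  move: s0 t0; rewrite mulrDl; set sM := s * M; set tM := t * M.
  have -> : x * 8^-1 * M = x * M * 8^-1 by ring.
  set xM := x * M; lra.
have [D hD ND] := nearC N hN.
have PD := PL _ (derL _ hD).
have PNpsi : P N = - P (N *m (F u - 1%:M)).
  by rewrite {1}NE linearB /= Pphi sub0r.
have key : x <= 5 / 8 * x.
  have h1 : `|D| <= CP * (m%:R * x * t) + CP * (C * x ^+ 2).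
    have -> : D = P N - P (N - D) by rewrite [X in _ - X]linearB /= subKr PD.
    rewrite (le_trans (ler_normB _ _)) // lerD //.
      rewrite PNpsi normrN (le_trans (PC _)) // ler_wpM2l //.
      exact: mulmx_norm.
    by rewrite (le_trans (PC _)) // ler_wpM2l.
  have h2 : x <= `|D| + C * x ^+ 2.
    by rewrite {1}/x -[N](subrK D) addrC (le_trans (ler_normD _ _)) // lerD.
  have h3 : x <= x * (CP * m%:R * t) + x * (x * ((CP + 1) * C)).
    rewrite (le_trans h2) // (le_trans (lerD h1 (lexx _))) // le_eqVlt; apply/orP; left.
    by apply/eqP; ring.
  rewrite (le_trans h3) // -mulrDr mulrC ler_wpM2r //.
  have := mt _ CPm CPmM; have : x * ((CP + 1) * C) <= 2^-1.
    by rewrite (le_trans _ Nsmall) // ler_wpM2l.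
  lra.
have : N = 0 by apply/eqP; rewrite -normr_le0 -/x; lra.
move/eqP; rewrite subr_eq0 => /eqP /(congr1 (mulmx^~ (F u))).
by rewrite mulmxKV // mul1mx.
Qed.

End BracketMaps.

(** * Cartan's criterion *)

Section GeneralizedEigenvectors.
Context {F : fieldType} {V : lmodType F} (T : V -> V) (P : V -> Prop).
Hypothesis lT : linear T.
Hypothesis PD : forall a u v, P u -> P v -> P (a *: u + v).
Hypothesis PT : forall u, P u -> P (T u).

Definition shift_op mu w := T w - mu *: w.

Definition gen_eigen mu w := exists k, iter k (shift_op mu) w = 0.

(** The summands are required to lie in [P] because the trace condition of Cartan's criterion is
    available on [P] alone. *)
Inductive gen_eigen_span : V -> Prop :=
| gen_eigen_span0 : gen_eigen_span 0
| gen_eigen_spanD mu w u :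
    P w -> gen_eigen mu w -> gen_eigen_span u -> gen_eigen_span (w + u).

Let lS mu : linear (shift_op mu).
Proof.
move=> a u v; rewrite /shift_op (lT a) scalerBr !scalerDr !scalerA (mulrC mu).
by rewrite opprD addrACA.
Qed.

Let lI mu k : linear (iter k (shift_op mu)).
Proof. by elim: k => // k IHk a u v /=; rewrite IHk lS. Qed.

Let PZ a u : P u -> P (a *: u).
Proof.
move=> Pu; have P0 : P 0 by rewrite -(addNr u) -scaleN1r; exact: PD.
by rewrite -[a *: u]addr0; exact: PD.
Qed.

Let PDD u v : P u -> P v -> P (u + v).
Proof. by move=> Pu Pv; rewrite -[u]scale1r; exact: PD. Qed.

Let PS mu u : P u -> P (shift_op mu u).
Proof. by move=> Pu; apply: PDD; [exact: PT|rewrite -scaleNr; exact: PZ]. Qed.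

Lemma gen_eigenD mu u v : gen_eigen mu u -> gen_eigen mu v -> gen_eigen mu (u + v).
Proof.
move=> [i iu] [j jv]; exists (i + j)%N.
rewrite (linfD (lI _ _)) {1}addnC !iterD iu jv !(linf0 (lI _ _)) addr0 //.
Qed.

(** On generalised eigenvectors for [nu], the operator [T - mu] is the nonzero scalar [nu - mu] plus
    a nilpotent operator; a preimage is built by induction on the nilpotency exponent. *)
Lemma gen_eigen_solve mu nu w : mu != nu -> P w -> gen_eigen nu w ->
  exists w', [/\ P w', gen_eigen nu w' & shift_op mu w' = w].
Proof.
move=> munu Pw [k kw]; suff [w' [Pw' kw' Sw']] :
    exists w', [/\ P w', iter k (shift_op nu) w' = 0 & shift_op mu w' = w].
  by exists w'; split => //; exists k.
elim: k w Pw kw => [|k IHk] w Pw kw.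
  by move: kw Pw => /= -> Pw; exists 0; split=> //; exact: (linf0 (lS _)).
have [|w2 [Pw2 kw2 Sw2]] := IHk (shift_op nu w) (PS _ Pw); first by rewrite -iterSr.
pose c := (nu - mu)^-1.
have cE : c * (nu - mu) = 1 by rewrite mulVf // subr_eq0 eq_sym.
exists (c *: (w - w2)); split.
- by apply: PZ; apply: PDD => //; rewrite -scaleN1r; exact: PZ.
- rewrite (linfZ (lI nu k.+1)) (linfB (lI nu k.+1)) kw /= kw2.
  by rewrite (linf0 (lS _)) subr0 scaler0.
- rewrite (linfZ (lS _)) (linfB (lS _)) Sw2 /shift_op opprB addrC addrA subrK.
  by rewrite -scalerBl scalerA cE scale1r.
Qed.

(** Components of [shift_op mu u] with eigenvalue other than [mu] can be divided by [T - mu], and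
    make up [z]; the rest, [u - z], is annihilated by a power of [T - mu]. *)
Lemma gen_eigen_span_shift mu u : P 0 -> P u -> gen_eigen_span (shift_op mu u) ->
  gen_eigen_span u.
Proof.
move=> P0 Pu.
suff H y : gen_eigen_span y -> exists z w,
    [/\ gen_eigen_span z, P z, P w, gen_eigen mu w & y = shift_op mu z + w].
  move=> /H[z [w [gz Pz Pw [k kw] uzw]]]; rewrite -[u](subrK z).
  apply: (@gen_eigen_spanD mu) => //.
    by apply: PDD => //; rewrite -scaleN1r; exact: PZ.
  by exists k.+1; rewrite iterSr (linfB (lS _)) uzw addrC addKr.
elim=> [|nu w v Pw gw gv [z' [w' [gz Pz Pw' gw' ->]]]].
  exists 0, 0; split => //; first exact: gen_eigen_span0.
    by exists 0%N.
  by rewrite (linf0 (lS _)) addr0.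
have [nm|nm] := eqVneq mu nu.
  exists z', (w + w'); split => //; first exact: PDD.
    by apply: gen_eigenD => //; rewrite nm.
  by rewrite addrCA.
have [w2 [Pw2 gw2 Sw2]] := gen_eigen_solve nm Pw gw.
exists (w2 + z'), w'; split => //; [exact: gen_eigen_spanD Pw2 gw2 gz|exact: PDD|].
by rewrite (linfD (lS _)) Sw2 addrA.
Qed.

Lemma gen_eigen_spanP s u : P 0 -> P u ->
  foldl (fun w mu => shift_op mu w) u s = 0 -> gen_eigen_span u.
Proof.
move=> P0; elim: s u => [|mu s IHs] u Pu /= h.
  by rewrite h; exact: gen_eigen_span0.
by apply: (@gen_eigen_span_shift mu) => //; apply: IHs => //; exact: PS.
Qed.

Lemma gen_eigen_span_linear_eq0 {W : lmodType F} (f : V -> W) : linear f ->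
  (forall mu w, P w -> gen_eigen mu w -> f w = 0) ->
  forall u, gen_eigen_span u -> f u = 0.
Proof.
move=> lf f0 u; elim=> [|mu w v Pw gw gv IH]; first exact: linf0.
by rewrite (linfD lf) IH (f0 mu) // addr0.
Qed.

End GeneralizedEigenvectors.

Lemma rV_annihilated {F : closedFieldType} {n} (A : 'M[F]_n) (u : 'rV[F]_n) :
  exists s, foldl (fun w mu => w *m A - mu *: w) u s = 0.
Proof.
case: n A u => [|n] A u; first by exists [::]; apply/matrixP => ? [].
have [s sE] := closed_field_poly_normal (char_poly A).
move: sE; rewrite (monicP (char_poly_monic A)) scale1r => sE; exists s.
have -> : foldl (fun w mu => w *m A - mu *: w) u s = u *m horner_mx A (\prod_(z <- s) ('X - z%:P)).
  elim: s u {sE} => [|z s IHs] u /=; first by rewrite big_nil rmorph1 mulmx1.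
  rewrite IHs big_cons rmorphM /= -mulmxE mulmxA rmorphB /= horner_mx_X horner_mx_C.
  by rewrite mulmxBr mul_mx_scalar.
by rewrite -sE Cayley_Hamilton mulmx0.
Qed.

Lemma mx_annihilated {F : closedFieldType} {n} (T : 'M[F]_n -> 'M[F]_n) (U : 'M[F]_n) :
  linear T -> exists s, foldl (fun w mu => T w - mu *: w) U s = 0.
Proof.
move=> lT; pose T' : {linear 'M[F]_n -> 'M[F]_n} :=
  HB.pack T (GRing.isLinear.Build F 'M[F]_n 'M[F]_n *:%R T lT).
have [s sE] := rV_annihilated (lin_mx T') (mxvec U); exists s.
apply/eqP; rewrite -mxvec_eq0 -sE; apply/eqP.
elim: s U {sE} => //= z s IHs U; rewrite IHs; congr (foldl _ _ _).
by rewrite linearB linearZ /=; congr (_ - _); exact: esym (mul_vec_lin T' U).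
Qed.

(** Chinese remainders for the pairwise coprime powers of ['X - z%:P], adding one root at a time by
    a Bezout identity. *)
Lemma poly_interpolation {F : fieldType} (s : seq F) (c : F -> F) N : uniq s ->
  exists p, forall z, z \in s -> ('X - z%:P) ^+ N %| p - (c z)%:P.
Proof.
elim: s => [|z s IHs] /=; first by exists 0.
move=> /andP[zs /IHs[p' Hp]].
pose q := \prod_(w <- s) ('X - w%:P) ^+ N.
have : coprimep q (('X - z%:P) ^+ N).
  apply: coprimep_expr; rewrite coprimep_XsubC /q.
  rewrite rootE horner_prod prodf_seq_neq0; apply/allP => w ws /=.
  rewrite horner_exp hornerXsubC expf_eq0 subr_eq0 negb_and.
  by apply/orP; right; apply: contraNneq zs => ->.
move=> /Bezout_eq1_coprimepP[[u v] /= uv].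
exists (p' + u * q * ((c z)%:P - p')) => w; rewrite inE => /orP[/eqP ->|ws].
  have -> : p' + u * q * ((c z)%:P - p') - (c z)%:P = ((c z)%:P - p') * (- v) * ('X - z%:P) ^+ N.
    have -> : u * q = 1 - v * ('X - z%:P) ^+ N by rewrite -uv addrK.
    by ring.
  exact: dvdp_mull.
rewrite addrAC dvdp_add ?Hp // mulrAC dvdp_mull // /q (big_rem w) //=.
exact: dvdp_mulr.
Qed.

Lemma trig_mulmx {R : pzRingType} {n} (A B : 'M[R]_n) : is_trig_mx A -> is_trig_mx B ->
  is_trig_mx (A *m B) /\ forall i, (A *m B) i i = A i i * B i i.
Proof.
move=> /is_trig_mxP tA /is_trig_mxP tB; split=> [|i].
  apply/is_trig_mxP => i j ij; rewrite mxE big1 // => k _.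
  have [ik|ki] := ltnP i k; first by rewrite tA // mul0r.
  by rewrite tB ?mulr0 // (leq_ltn_trans ki).
rewrite mxE (bigD1 i) //= big1 ?addr0 // => k ki.
have [ik|{}ik] := ltnP i k; first by rewrite tA // mul0r.
by rewrite tB ?mulr0 // ltn_neqAle ik andbT.
Qed.

Lemma trig_horner {R : comNzRingType} {n} (p : {poly R}) (A : 'M[R]_n.+1) : is_trig_mx A ->
  is_trig_mx (horner_mx A p) /\ forall i, (horner_mx A p) i i = p.[A i i].
Proof.
move=> tA; elim/poly_ind: p => [|p c [tp pE]].
  rewrite rmorph0; split=> [|i]; last by rewrite mxE horner0.
  by apply/is_trig_mxP => i j _; rewrite mxE.
have [tpA pAE] := trig_mulmx tp tA.
rewrite rmorphD rmorphM /= horner_mx_X horner_mx_C; split=> [|i].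
  apply/is_trig_mxP => i j ij; rewrite mxE [X in X + _](is_trig_mxP tpA) // mxE.
  by rewrite -val_eqE ltn_eqF // mulr0n addr0.
by rewrite mxE pAE pE mxE eqxx mulr1n hornerMXaddC.
Qed.

Section TraceForm.
Context {C : numClosedFieldType} {n : nat} (X : 'M[C]_n.+1).
Local Notation d := n.+1.

Let mulX (v : 'rV[C]_d) := v *m X.
Let del (U : 'M[C]_d) := U *m X - X *m U.

Let lmulX : linear mulX.
Proof. by move=> a u v; rewrite /mulX mulmxDl -scalemxAl. Qed.
Let ldel : linear del.
Proof.
by move=> a U V; rewrite /del mulmxDl mulmxDr -scalemxAl -scalemxAr opprD addrACA scalerBr.
Qed.

(** A Leibniz rule writes the shift of [v *m U] as a shift of [U] plus a shift of [v]; after [i + j]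
    steps each term has a vanishing factor. *)
Let gen_eigen_mul v U la mu : gen_eigen mulX la v -> gen_eigen del mu U ->
  gen_eigen mulX (la + mu) (v *m U).
Proof.
move=> [i iv] [j jU]; exists (i + j)%N; move: {2}(i + j)%N (erefl (i + j)%N) => k.
elim: k i j v U iv jU => [|k IHk] i j v U iv jU ijk.
  have i0 : i = 0%N by apply/eqP; rewrite -leqn0 -ijk leq_addr.
  by move: iv; rewrite ijk i0 /= => ->; rewrite mul0mx.
have lI la' m : linear (iter m (shift_op mulX la')).
  elim: m => // m IHm a u w /=; rewrite IHm /shift_op lmulX scalerBr !scalerDr !scalerA.
  by rewrite (mulrC la') opprD addrACA.
rewrite ijk iterSr.
have -> : shift_op mulX (la + mu) (v *m U) =
    v *m shift_op del mu U + shift_op mulX la v *m U.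
  rewrite /shift_op /mulX /del !mulmxBl !mulmxBr !mulmxA -scalemxAl -scalemxAr scalerDl.
  move: (v *m U *m X) (v *m X *m U) (v *m U) => *.
  by apply/matrixP => ? ?; rewrite !mxE; ring.
rewrite (linfD (lI _ _)).
case: i iv ijk => [|i] iv ijk.
  rewrite /= in iv; rewrite iv mul0mx /shift_op /mulX !mul0mx scaler0 subr0 mul0mx.
  by rewrite !(linf0 (lI _ _)) addr0.
case: j jU ijk => [|j] jU ijk.
  rewrite /= in jU; rewrite jU /shift_op /del !mulmx0 mul0mx scaler0 !subr0 !mulmx0.
  by rewrite !(linf0 (lI _ _)) addr0.
have e1 : (i.+1 + j = k)%N by move: ijk; rewrite addnS => -[].
have e2 : (i + j.+1 = k)%N by move: ijk; rewrite addSn => -[].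
have := IHk i.+1 j v (shift_op del mu U) iv _ e1; rewrite -iterSr => /(_ jU).
rewrite {1}e1 => ->.
have := IHk i j.+1 (shift_op mulX la v) U _ jU e2; rewrite -iterSr => /(_ iv).
by rewrite {1}e2 => ->; rewrite addr0.
Qed.

Let iter_hornerE la k v :
  iter k (shift_op mulX la) v = v *m horner_mx X (('X - la%:P) ^+ k).
Proof.
elim: k => [|k IHk] /=; first by rewrite expr0 rmorph1 mulmx1.
rewrite IHk exprSr rmorphM /= -mulmxE mulmxA rmorphB /= horner_mx_X horner_mx_C.
by rewrite mulmxBr mul_mx_scalar.
Qed.

(** A Bezout identity with the characteristic polynomial lowers the exponent to the multiplicity of
    [la], hence to at most [d], the exponent used in the interpolation that defines [S]. *)
Let gen_eigen_bound la v : gen_eigen mulX la v ->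
  (~~ root (char_poly X) la -> v = 0) /\ v *m horner_mx X (('X - la%:P) ^+ d) = 0.
Proof.
move=> [k]; rewrite iter_hornerE => kv.
have [a [q qla cE]] := multiplicity_XsubC (char_poly X) la.
have cX0 : char_poly X != 0 by rewrite monic_neq0 ?char_poly_monic.
have {}qla : ~~ root q la by move: qla; rewrite cX0.
have : coprimep (('X - la%:P) ^+ k) q.
  by rewrite coprimep_expl // coprimep_sym coprimep_XsubC.
move=> /Bezout_eq1_coprimepP[[u w] /= uw].
have va : v *m horner_mx X (('X - la%:P) ^+ a) = 0.
  have -> : ('X - la%:P) ^+ a =
      ('X - la%:P) ^+ k * (u * ('X - la%:P) ^+ a) + char_poly X * w.
    by rewrite -[LHS]mul1r -uw cE; ring.
  rewrite rmorphD rmorphM /= [horner_mx X (char_poly X * w)]rmorphM /= Cayley_Hamilton.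
  by rewrite mul0r addr0 -mulmxE mulmxA kv mul0mx.
have ad : (a <= d)%N.
  have : (size (('X - la%:P) ^+ a) <= size (char_poly X))%N.
    by rewrite dvdp_leq // cE dvdp_mulIr.
  by rewrite size_exp_XsubC size_char_poly.
split=> [nr|].
  have a0 : a = 0%N.
    case: a cE va ad {uw} => // a cE _ _; case/negP: nr.
    by rewrite cE rootM root_exp_XsubC eqxx orbT.
  by move: va; rewrite a0 expr0 rmorph1 mulmx1.
have -> : ('X - la%:P) ^+ d = ('X - la%:P) ^+ a * ('X - la%:P) ^+ (d - a).
  by rewrite -exprD subnKC.
by rewrite rmorphM /= -mulmxE mulmxA va mul0mx.
Qed.

(* [S] is the complex conjugate of the semisimple part of [X], a polynomial in
   [X]. It acts by a scalar on the generalised eigenvectors of [ad X] in [P], so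
   that [tr (S X) = 0]; but [tr (S X)] is the sum of the squared moduli of the
   eigenvalues of [X]. *)
Lemma trace_form_nilpotent (P : 'M[C]_d -> Prop) m (U V : 'I_m -> 'M[C]_d) :
  (forall a A B, P A -> P B -> P (a *: A + B)) -> P 0 ->
  (forall A, P A -> P (A *m X - X *m A)) ->
  (forall A B, P A -> P B -> \tr (A *m B) = 0) ->
  (forall i, P (U i)) -> (forall i, P (V i)) ->
  X = \sum_i (U i *m V i - V i *m U i) -> X ^+ d = 0.
Proof.
move=> PD P0 PX Ptr PU PV XE.
have [rs rsE] := closed_field_poly_normal (char_poly X).
move: rsE; rewrite (monicP (char_poly_monic X)) scale1r => rsE.
have [p Hp] := poly_interpolation (fun z : C => z^*) d (undup_uniq rs).
pose S := horner_mx X p.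
have rootrs z : root (char_poly X) z = (z \in undup rs).
  by rewrite rsE root_prod_XsubC mem_undup.
(* Modulo [('X - la%:P) ^+ d], which annihilates [v], the polynomial [p] is the constant [la^*]. *)
have Sv la v : gen_eigen mulX la v -> v *m S = la^* *: v.
  move=> gv; have [nr vd] := gen_eigen_bound gv.
  have [/nr ->|] := boolP (~~ root (char_poly X) la); first by rewrite mul0mx scaler0.
  move=> /negbNE; rewrite rootrs => /Hp /dvdpP[q qE].
  have -> : S = horner_mx X (q * ('X - la%:P) ^+ d) + (la^*)%:M.
    by rewrite -qE rmorphB /= horner_mx_C subrK.
  rewrite mulmxDr mul_mx_scalar mulrC rmorphM /= -mulmxE mulmxA vd mul0mx add0r //.
have allv v : gen_eigen_span mulX (fun=> True) v.
  have [s sE] := rV_annihilated X v.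
  exact: (gen_eigen_spanP (P := fun=> True) lmulX (fun _ _ _ _ _ => I) (fun _ _ => I) I I sE).
have SU mu A : gen_eigen del mu A -> A *m S - S *m A = mu^* *: A.
  move=> gA; apply/row_matrixP => i; rewrite !rowE.
  move: (delta_mx 0 i) => v; apply/eqP; rewrite -subr_eq0; apply/eqP.
  have lf : linear (fun v : 'rV_d => v *m (A *m S - S *m A) - v *m (mu^* *: A)).
    by move=> a x y; rewrite -!mulmxBr mulmxDl -scalemxAl.
  apply: (gen_eigen_span_linear_eq0 lf _ (allv v)) => la w _ gw.
  rewrite mulmxBr !mulmxA (Sv (la + mu)) ?(Sv la) //; last exact: gen_eigen_mul.
  rewrite -scalemxAl -scalemxAr -scalerBl rmorphD addrAC subrr add0r subrr //.
(* On a generalised eigenvector [A] of [del], the commutator with [S] is a multiple of [A], so the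
   trace is a multiple of [\tr (A *m B)], which vanishes on [P]. *)
have trS A B : P A -> P B -> \tr ((A *m S - S *m A) *m B) = 0.
  move=> PA PB.
  have lf : linear (fun A => \tr ((A *m S - S *m A) *m B) : C^o).
    move=> a A1 A2; have -> : (a *: A1 + A2) *m S - S *m (a *: A1 + A2) =
        a *: (A1 *m S - S *m A1) + (A2 *m S - S *m A2).
      by rewrite mulmxDl mulmxDr -scalemxAl -scalemxAr opprD addrACA -scalerBr.
    move: (A1 *m S - _) (A2 *m S - _) => Y Z.
    by rewrite mulmxDl -scalemxAl linearD linearZ.
  have [s sE] := mx_annihilated A ldel.
  have gA : gen_eigen_span del P A by exact: (gen_eigen_spanP ldel PD PX P0 PA sE).
  apply: (gen_eigen_span_linear_eq0 lf _ gA) => mu A' PA' gA'.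
  by rewrite (SU _ _ gA') -scalemxAl linearZ /= Ptr // mulr0.
have trSX : \tr (S *m X) = 0.
  rewrite XE mulmx_sumr linear_sum big1 // => i _ /=.
  have := trS _ _ (PU i) (PV i); rewrite mulmxBl mulmxBr !linearB /= => /eqP.
  rewrite subr_eq0 => /eqP h.
  by rewrite ?mulmxBr ?linearB /= !mulmxA -h -!mulmxA [X in X - _]mxtrace_mulC !mulmxA subrr.
have [Q uQ tQ] := @Schur C d X isT; move: tQ; rewrite /similar_to conjumx ?unitarymx_unit //.
move: uQ => /unitarymx_unit uQ; set T := Q *m X *m invmx Q => tT.
have cXT : char_poly X = char_poly T.
  have TE : char_poly_mx T = map_mx polyC Q *m char_poly_mx X *m map_mx polyC (invmx Q).
    rewrite /char_poly_mx mulmxBr mulmxBl mul_mx_scalar -scalemxAl -!map_mxM.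
    by rewrite mulmxV // map_mx1 scalemx1.
  rewrite /char_poly TE !det_mulmx mulrAC -det_mulmx -map_mxM mulmxV //.
  by rewrite map_mx1 det1 mul1r.
have cT := char_poly_trig tT.
have pT i : p.[T i i] = (T i i)^*.
  have : root (char_poly X) (T i i).
    by rewrite cXT cT rootE horner_prod; rewrite (bigD1 i) //= hornerXsubC subrr mul0r.
  rewrite rootrs => /Hp /dvdpP[q /(congr1 (fun q => q.[T i i]))].
  rewrite hornerD hornerN hornerC hornerM horner_exp hornerXsubC subrr expr0n mulr0.
  by move/eqP; rewrite subr_eq0 => /eqP.
have [hT hTd] := trig_horner p tT.
have : \tr (horner_mx T p *m T) = 0.
  rewrite /T horner_mx_uconj // !mulmxA mulmxKV // -!mulmxA mxtrace_mulC.
  by rewrite -!mulmxA mulVmx // mulmx1 trSX.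
have [_ tTT] := trig_mulmx hT tT.
rewrite /mxtrace; under eq_bigr do rewrite tTT hTd pT mulrC -normCK.
move=> /psumr_eq0P h; have Tii i : T i i = 0.
  have /eqP := h (fun i _ => exprn_ge0 2 (normr_ge0 (T i i))) i isT.
  by rewrite expf_eq0 /= normr_eq0 => /eqP.
have : char_poly X = 'X^d.
  rewrite cXT cT; under eq_bigr do rewrite Tii subr0.
  by rewrite prodr_const card_ord.
by move=> cE; have := Cayley_Hamilton X; rewrite cE rmorphXn /= horner_mx_X.
Qed.

End TraceForm.

(** Eigenvalues require a closed field: [A] is replaced with its complex span inside complex
    matrices, where the bilinear trace form still vanishes, and nilpotency descends along the
    embedding. *)
Lemma real_trace_form_nilpotentS {R : rcfType} {n} (A : 'M[R]_n.+1 -> Prop) m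
    (U V : 'I_m -> 'M[R]_n.+1) (X : 'M[R]_n.+1) :
  (forall a M N, A M -> A N -> A (a *: M + N)) -> A 0 ->
  (forall M N, A M -> A N -> A (M *m N - N *m M)) ->
  (forall M N, A M -> A N -> \tr (M *m N) = 0) ->
  (forall i, A (U i)) -> (forall i, A (V i)) ->
  X = \sum_i (U i *m V i - V i *m U i) -> X ^+ n.+1 = 0.
Proof.
move=> AD A0 AB Atr AU AV XE.
have AN M : A M -> A (- M) by move=> AM; rewrite -[- M]addr0 -scaleN1r; exact: AD.
have AX : A X.
  rewrite XE; elim/big_ind: _ => // [M N AM AN'|i _]; last exact: AB.
  by rewrite -[M]scale1r; exact: AD.
pose f (M : 'M[R]_n.+1) : 'M[R[i]]_n.+1 := map_mx (real_complex R) M.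
pose P (M : 'M[R[i]]_n.+1) := exists M1 M2, [/\ A M1, A M2 & M = f M1 + 'i%C *: f M2].
have Pf M : A M -> P (f M).
  by move=> AM; exists M, 0; split => //; rewrite /f map_mx0 scaler0 addr0.
have fB M N : f (M *m N - N *m M) = f M *m f N - f N *m f M.
  by rewrite /f map_mxB !map_mxM.
have : f X ^+ n.+1 = 0.
  apply: (@trace_form_nilpotent _ _ _ P m (f \o U) (f \o V)).
  - move=> [a b] _ _ [M1 [M2 [AM1 AM2 ->]]] [N1 [N2 [AN1 AN2 ->]]].
    exists (a *: M1 + ((- b) *: M2 + N1)), (a *: M2 + (b *: M1 + N2)).
    split; [exact: AD _ _ _ AM1 (AD _ _ _ AM2 AN1)|exact: AD _ _ _ AM2 (AD _ _ _ AM1 AN2)|].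
    by apply/matrixP => i j; rewrite !mxE; simpc; congr (_ +i* _)%C; ring.
  - by rewrite -[0](map_mx0 (real_complex R)); exact: Pf.
  - move=> _ [M1 [M2 [AM1 AM2 ->]]].
    exists (M1 *m X - X *m M1), (M2 *m X - X *m M2); split; try exact: AB.
    rewrite !fB mulmxDl mulmxDr -scalemxAl -scalemxAr scalerBr.
    by rewrite opprD addrACA.
  - move=> _ _ [M1 [M2 [AM1 AM2 ->]]] [N1 [N2 [AN1 AN2 ->]]].
    have tf M N : A M -> A N -> \tr (f M *m f N) = 0.
      by move=> AM AN'; rewrite -map_mxM trace_map_mx Atr // rmorph0.
    rewrite mulmxDl !mulmxDr -!scalemxAl -!scalemxAr !linearD /= !linearZ /= !tf //.
    by rewrite !mulr0 !addr0.
  - by move=> i; exact: Pf.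
  - by move=> i; exact: Pf.
  - rewrite XE /f raddf_sum; apply: eq_bigr => i _; exact: fB.
rewrite -[_ ^+ _](rmorphXn (map_mx (real_complex R))) => /eqP; rewrite map_mx_eq0 => /eqP.
by [].
Qed.

Lemma real_trace_form_nilpotent {R : rcfType} {n} (A : 'M[R]_n -> Prop) m
    (U V : 'I_m -> 'M[R]_n) (X : 'M[R]_n) :
  (forall a M N, A M -> A N -> A (a *: M + N)) -> A 0 ->
  (forall M N, A M -> A N -> A (M *m N - N *m M)) ->
  (forall M N, A M -> A N -> \tr (M *m N) = 0) ->
  (forall i, A (U i)) -> (forall i, A (V i)) ->
  X = \sum_i (U i *m V i - V i *m U i) -> X ^+ n = 0.
Proof.
case: n A U V X => [|n] A U V X; first by move=> *; exact: flatmx0.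
exact: real_trace_form_nilpotentS.
Qed.

(** * Lie algebras without abelian ideals *)

Section LieAlgebraBasics.
Context {K : fieldType} {g : lieAlgType K}.
Implicit Types (x y z : g) (U V W : {vspace g}).

Lemma lieDl x y z : lie (x + y) z = lie x z + lie y z.
Proof. exact: (linfD (lie_is_linearl z)). Qed.
Lemma lieDr x y z : lie x (y + z) = lie x y + lie x z.
Proof. exact: (linfD (lie_is_linearr x)). Qed.
Lemma lieZl a x z : lie (a *: x) z = a *: lie x z.
Proof. exact: (linfZ (lie_is_linearl z)). Qed.
Lemma lieZr a x z : lie x (a *: z) = a *: lie x z.
Proof. exact: (linfZ (lie_is_linearr x)). Qed.
Lemma lie0l x : lie 0 x = 0. Proof. exact: (linf0 (lie_is_linearl x)). Qed.
Lemma lie0r x : lie x 0 = 0. Proof. exact: (linf0 (lie_is_linearr x)). Qed.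
Lemma lieNr x y : lie x (- y) = - lie x y.
Proof. exact: (linfN (lie_is_linearr x)). Qed.
Lemma lieNl x y : lie (- x) y = - lie x y.
Proof. exact: (linfN (lie_is_linearl y)). Qed.
Lemma lieBr x y z : lie x (y - z) = lie x y - lie x z.
Proof. by rewrite lieDr lieNr. Qed.

Lemma lieC x y : lie x y = - lie y x.
Proof.
have := liexx (x + y); rewrite lieDl !lieDr !liexx addr0 add0r => /eqP.
by rewrite addr_eq0 => /eqP.
Qed.

Lemma lie_leibniz x y z : lie x (lie y z) = lie (lie x y) z + lie y (lie x z).
Proof.
have := lie_jacobi x y z; rewrite (lieC z x) lieNr (lieC z (lie x y)) => /eqP.
by rewrite subr_eq0 subr_eq => /eqP ->.
Qed.

Lemma adE x y : ad x y = lie x y.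
Proof. exact: (linfunE (lie_is_linearr x)). Qed.

Lemma ad_is_linear : linear (@ad _ g).
Proof. by move=> a x y; apply/lfunP => z; rewrite lfunE /= lfunE /= !adE lieDl lieZl. Qed.

Lemma ad_lie x y : ad (lie x y) = ((ad x \o ad y) - (ad y \o ad x))%VF.
Proof.
apply/lfunP => z; rewrite add_lfunE opp_lfunE !comp_lfunE !adE.
by rewrite (lie_leibniz x y z) addrK.
Qed.

Lemma ideal_lieP U x y : is_lie_ideal U -> x \in U -> lie x y \in U.
Proof. by move=> iU Ux; rewrite lieC memvN iU. Qed.

Lemma memv_lie_prod U W x y : x \in U -> y \in W -> lie x y \in lie_prod U W.
Proof.
move=> Ux Wy; rewrite (coord_vbasis Ux) (coord_vbasis Wy).
rewrite (linf_sum (lie_is_linearl _)); apply: memv_suml => i _.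
rewrite (linf_sum (lie_is_linearr _)); apply: memv_suml => j _.
rewrite lieZl lieZr !memvZ // memv_span //.
by apply: allpairs_f; apply: mem_nth; rewrite size_tuple.
Qed.

Lemma lie_prod_subP U W V :
  reflect (forall x y, x \in U -> y \in W -> lie x y \in V) (lie_prod U W <= V)%VS.
Proof.
apply: (iffP idP) => [h x y Ux Wy|h]; first exact: subvP h _ (memv_lie_prod Ux Wy).
apply/span_subvP => _ /allpairsP[[x y] [/= Ux Wy ->]].
by apply: h; exact: vbasis_mem.
Qed.

Lemma lie_prodS U U' W W' : (U <= U')%VS -> (W <= W')%VS ->
  (lie_prod U W <= lie_prod U' W')%VS.
Proof.
move=> sU sW; apply/lie_prod_subP => x y Ux Wy.
by apply: memv_lie_prod; [exact: subvP sU _ Ux|exact: subvP sW _ Wy].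
Qed.

Lemma lie_prod_ideal U W : is_lie_ideal U -> is_lie_ideal W -> is_lie_ideal (lie_prod U W).
Proof.
move=> iU iW x; suff : (lie_prod U W <= ad x @^-1: lie_prod U W)%VS.
  by move=> h y /(subvP h); rewrite -memv_preim adE.
apply/lie_prod_subP => u w Uu Ww; rewrite -memv_preim adE lie_leibniz.
by rewrite memvD // memv_lie_prod ?iU ?iW.
Qed.

Lemma capv_ideal U W : is_lie_ideal U -> is_lie_ideal W -> is_lie_ideal (U :&: W)%VS.
Proof. by move=> iU iW x y /memv_capP[Uy Wy]; rewrite memv_cap iU ?iW. Qed.

Lemma addv_ideal U W : is_lie_ideal U -> is_lie_ideal W -> is_lie_ideal (U + W)%VS.
Proof.
move=> iU iW x _ /memv_addP[u Uu [w Ww ->]]; rewrite lieDr.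
by rewrite memv_add ?iU ?iW.
Qed.

Lemma ideal0 : is_lie_ideal (0 : {vspace g})%VS.
Proof. by move=> x y; rewrite memv0 => /eqP ->; rewrite lie0r mem0v. Qed.

Lemma idealf : is_lie_ideal (fullv : {vspace g}).
Proof. by move=> x y _; rewrite memvf. Qed.

End LieAlgebraBasics.

(* Every linear condition cuts out a subspace: one of maximal dimension among
   the subspaces satisfying it. *)
Lemma vspace_comprehension {K : fieldType} {V : vectType K} (P : V -> Prop) :
  P 0 -> (forall a u v, P u -> P v -> P (a *: u + v)) ->
  exists U : {vspace V}, forall v, v \in U <-> P v.
Proof.
move=> P0 PD; pose Q n := `[< exists2 U : {vspace V}, (forall v, v \in U -> P v) & \dim U = n >].
have exQ : exists n, Q n.
  exists 0%N; apply/asboolP; exists 0%VS; last exact: dimv0.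
  by move=> v; rewrite memv0 => /eqP ->.
have ubQ n : Q n -> (n <= \dim {:V})%N.
  by move=> /asboolP[U _ <-]; rewrite dimvS // subvf.
case: (ex_maxnP exQ ubQ) => n /asboolP[U UP dU] maxn.
exists U => v; split=> [|Pv]; first exact: UP.
have : (U + <[v]> <= U)%VS.
  have sU : (U <= U + <[v]>)%VS by exact: addvSl.
  have /maxn : Q (\dim (U + <[v]>)%VS).
    apply/asboolP; exists (U + <[v]>)%VS => // _ /memv_addP[u Uu [w /vlineP[k ->] ->]].
    by rewrite addrC; apply: PD => //; exact: UP.
  by rewrite -dU => dle; have /eqP <- : (U == U + <[v]>)%VS by rewrite eqEdim sU dle.
by move=> /subvP; apply; rewrite memvE addvSr.
Qed.

(** * Coordinates, traces and the Killing form *)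

Section Coordinates.
Context {R : realType}.
Implicit Types U V W : vectType R.

Lemma coords_linear {V} : linear (@coords R V).
Proof. exact: passmx.rVof_linear. Qed.

Lemma coords_inj {V} : injective (@coords R V).
Proof. exact: can_inj (passmx.rVofK (vbasisP {:V})). Qed.

Definition of_coords {V} (r : 'rV[R]_(\dim {:V})) : V := passmx.vecof (vbasis {:V}) r.

Lemma of_coordsK {V} : cancel (@of_coords V) coords.
Proof. exact: passmx.vecofK (vbasisP {:V}). Qed.

Lemma coordsK {V} : cancel (@coords R V) of_coords.
Proof. exact: passmx.rVofK (vbasisP {:V}). Qed.

End Coordinates.

Section Trace.
Context {K : fieldType}.
Implicit Types U V W : vectType K.

Definition hmx {V W} (A : 'Hom(V, W)) := passmx.mxof (vbasis {:V}) (vbasis {:W}) A.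

Lemma hmx_linear {V W} : linear (@hmx V W).
Proof. exact: passmx.mxof_linear. Qed.

Lemma hmx_comp {U V W} (A : 'Hom(V, W)) (B : 'Hom(U, V)) :
  hmx (A \o B)%VF = hmx B *m hmx A.
Proof. exact: passmx.mxof_comp (vbasisP {:V}) _ _. Qed.

Lemma hmx1 {V} : hmx (\1 : 'End(V))%VF = 1%:M.
Proof. exact: passmx.mxof1 (basis_free (vbasisP {:V})). Qed.

Lemma rVof_hmx {V W} (A : 'Hom(V, W)) v :
  passmx.rVof (vbasis {:W}) (A v) = passmx.rVof (vbasis {:V}) v *m hmx A.
Proof. by rewrite /hmx passmx.mul_mxof (passmx.rVofK (vbasisP _)). Qed.

Lemma hmx_inj {V W} : injective (@hmx V W).
Proof. exact: can_inj (passmx.mxofK (vbasisP {:V}) (vbasisP {:W})). Qed.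

Lemma hmx_surj {V W} M : exists A : 'Hom(V, W), hmx A = M.
Proof.
by exists (passmx.hommx (vbasis {:V}) (vbasis {:W}) M); exact: passmx.hommxK (vbasisP _) (vbasisP _) _.
Qed.

Definition ltr {V} (A : 'End(V)) : K := \tr (hmx A).

Lemma ltr_comp {V W} (A : 'Hom(V, W)) (B : 'Hom(W, V)) : ltr (A \o B) = ltr (B \o A).
Proof. by rewrite /ltr !hmx_comp mxtrace_mulC. Qed.

Lemma ltr_linear {V} : linear (@ltr V : _ -> K^o).
Proof. by move=> a A B; rewrite /ltr hmx_linear linearP. Qed.

(* [A] descends to [B] along the surjection [p], whose kernel it annihilates. *)
Lemma ltr_factor {V W : vectType K} (p : 'Hom(V, W)) (A : 'End(V)) (B : 'End(W)) :
  limg p = fullv -> (p \o A)%VF = (B \o p)%VF -> (forall v, p v = 0 -> A v = 0) ->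
  ltr A = ltr B.
Proof.
move=> ps pA kA; pose A' := (A \o p^-1)%VF.
have pK w : p ((p^-1)%VF w) = w by rewrite limg_lfunVK // ps memvf.
have AE : A = (A' \o p)%VF.
  apply/lfunP => v; rewrite !comp_lfunE; apply/eqP; rewrite -subr_eq0 -linearB.
  by apply/eqP; apply: kA; rewrite linearB /= pK subrr.
have BE : B = (p \o A')%VF.
  by apply/lfunP => w; rewrite /A' comp_lfunA pA !comp_lfunE pK.
by rewrite {1}AE BE ltr_comp.
Qed.

End Trace.

Section KillingForm.
Context {K : fieldType} {g : lieAlgType K}.
Implicit Types (x y z : g) (U V W : {vspace g}).

Definition kil x y : K := ltr (ad x \o ad y)%VF.

Lemma kilC x y : kil x y = kil y x.
Proof. exact: ltr_comp. Qed.

Lemma kil_linearr x : linear (kil x : g -> K^o).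
Proof.
move=> a y z; rewrite /kil ad_is_linear comp_lfunDr -comp_lfunZr.
exact: ltr_linear.
Qed.

Lemma kil_linearl y : linear (kil^~ y : g -> K^o).
Proof. by move=> a x z; rewrite ![kil _ y]kilC kil_linearr. Qed.

Lemma kil_lie x y z : kil (lie x y) z = kil x (lie y z).
Proof.
rewrite /kil !ad_lie comp_lfunDl comp_lfunNl comp_lfunDr comp_lfunNr !(linfB ltr_linear); congr (_ - _).
  by rewrite comp_lfunA.
by rewrite -comp_lfunA [LHS]ltr_comp -comp_lfunA.
Qed.

(** The orthogonal complement for the Killing form, as the kernel of a map into [\dim U]
    coordinates, so that rank-nullity yields [dim_perp]. *)
Definition perp U : {vspace g} :=
  lker (linfun (fun y => \row_(i < \dim U) kil (vbasis U)`_i y)).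

Let perp_linear U : linear (fun y => \row_(i < \dim U) kil (vbasis U)`_i y).
Proof.
by move=> a x y; apply/rowP => i; rewrite !mxE; exact: kil_linearr.
Qed.

Lemma perpP U y : reflect (forall x, x \in U -> kil x y = 0) (y \in perp U).
Proof.
rewrite memv_ker (linfunE (perp_linear U)); apply: (iffP eqP) => [/rowP h x Ux|h].
  rewrite (coord_vbasis Ux) (linf_sum (kil_linearl y)) big1 // => i _.
  by rewrite (linfZ (kil_linearl y)); have := h i; rewrite !mxE => ->; rewrite scaler0.
by apply/rowP => i; rewrite !mxE h // vbasis_mem // mem_nth // size_tuple.
Qed.

Lemma dim_perp U : (\dim {:g} <= \dim U + \dim (perp U))%N.
Proof.
rewrite -(limg_ker_dim (linfun (fun y => \row_(i < \dim U) kil (vbasis U)`_i y)) fullv).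
rewrite capfv addnC leq_add2r.
have := dimvS (subvf (linfun (fun y => \row_(i < \dim U) kil (vbasis U)`_i y) @: fullv)%VS).
by move=> /leq_trans; apply; rewrite dimvf /dim /= mul1n.
Qed.

Lemma perp_ideal U : is_lie_ideal U -> is_lie_ideal (perp U).
Proof.
by move=> iU x y /perpP Uy; apply/perpP => z Uz; rewrite -kil_lie Uy // ideal_lieP.
Qed.

End KillingForm.

(** * Engel's theorem and simple ideals *)

Section Engel.
Context {K : fieldType} {g : lieAlgType K}.

(** Engel's theorem for the action of [L] on [U] modulo [W]. The relative form is what the induction
    consumes: a smaller subalgebra [M] is let act once on [L] modulo [M] and once on [U] modulo
    [W]. *)
Lemma engel (L U W : {vspace g}) : is_lie_subalgebra L ->
  (forall x, x \in L -> exists k, forall y, iter k (lie x) y = 0) ->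
  ~~ (U <= W)%VS -> 
  (forall x u, x \in L -> u \in U -> lie x u \in U) ->
  (forall x w, x \in L -> w \in W -> lie x w \in W) ->
  exists v, [/\ v \in U, v \notin W & forall x, x \in L -> lie x v \in W].
Proof.
move: {2}(\dim L) (leqnn (\dim L)) => d; elim: d L U W => [|d IHd] L U W.
  rewrite leqn0 dimv_eq0 => /eqP -> _ _ /subvPn[v Uv Wv] _ _; exists v; split => // x.
  by rewrite memv0 => /eqP ->; rewrite lie0l mem0v.
move=> dL sL nL UW LU LW.
have [L0|L0] := eqVneq L 0%VS.
  by apply: IHd => //; rewrite L0 dimv0.
(* [M] is a maximal proper subalgebra; induction gives [y] in [L] outside [M] normalising [M], and
   maximality gives [L = M + <[y]>]. *)
pose Q n := `[< exists2 M : {vspace g}, [/\ is_lie_subalgebra M, (M <= L)%VS & M != L] & \dim M = n >].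
have exQ : exists n, Q n.
  exists 0%N; apply/asboolP; exists 0%VS; last exact: dimv0.
  split; [|exact: sub0v|by rewrite eq_sym].
  by move=> x y; rewrite memv0 => /eqP -> _; rewrite lie0l mem0v.
have ubQ n : Q n -> (n <= \dim L)%N by move=> /asboolP[M [_ sM _] <-]; exact: dimvS.
case: (ex_maxnP exQ ubQ) => n /asboolP[M [aM sM nML] dM] maxn.
have ltML : (\dim M < \dim L)%N.
  by rewrite ltn_neqAle dimvS // andbT; apply: contra nML => /eqP e; rewrite eqEdim sM e /=.
have dMd : (\dim M <= d)%N by rewrite -ltnS (leq_trans ltML).
have nM x : x \in M -> exists k, forall y, iter k (lie x) y = 0.
  by move=> /(subvP sM); exact: nL.
have nLM : ~~ (L <= M)%VS by apply: contra nML => h; rewrite eqEsubv sM.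
have [y [Ly My yM]] : exists v, [/\ v \in L, v \notin M & forall x, x \in M -> lie x v \in M].
  apply: IHd => // x u Mx Lu.
  by apply: sL => //; exact: subvP sM _ Mx.
have LE : (M + <[y]>)%VS = L.
  apply/eqP; apply/negPn/negP => nMy.
  have sMy : (M + <[y]> <= L)%VS by rewrite subv_add sM -memvE.
  have /maxn : Q (\dim (M + <[y]>)%VS).
    apply/asboolP; exists (M + <[y]>)%VS => //; split => //.
    move=> _ _ /memv_addP[m Mm [_ /vlineP[a ->] ->]] /memv_addP[m' Mm' [_ /vlineP[b ->] ->]].
    rewrite !lieDl !lieDr lieZl !lieZr lieZl liexx !scaler0 addr0.
    apply: (subvP (addvSl M <[y]>)); rewrite (lieC y m').
    by rewrite !memvD ?memvZ ?memvN ?yM ?aM.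
  rewrite -dM => dle; case/negP: My; rewrite memvE.
  have /eqP -> : (M == M + <[y]>)%VS by rewrite eqEdim addvSl dle.
  exact: addvSr.
have [v0 [Uv0 Wv0 v0W]] : exists v, [/\ v \in U, v \notin W & forall x, x \in M -> lie x v \in W].
  by apply: IHd => // x u /(subvP sM) Lx; [exact: LU|exact: LW].
have [k kv] := nL y Ly.
have exj : exists j, iter j (lie y) v0 \in W by exists k; rewrite kv mem0v.
(* The last iterate of [lie y] on [v0] outside [W] is the vector sought: [y] sends it into [W] by
   minimality, and [M] does because [y] normalises [M]. *)
case: (ex_minnP exj) => -[|j] jW minj; first by move: jW; rewrite /= (negbTE Wv0).
have Qi i : iter i (lie y) v0 \in U /\ forall x, x \in M -> lie x (iter i (lie y) v0) \in W.
  elim: i => [|i [IHU IHW]] //=; split=> [|x Mx]; first exact: LU.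
  rewrite lie_leibniz memvD //; last by apply: LW => //; exact: IHW.
  by apply: IHW; exact: yM.
have [Uj jM] := Qi j; exists (iter j (lie y) v0); split => //.
  by apply/negP => /minj; rewrite ltnn.
move=> x; rewrite -LE => /memv_addP[m Mm [_ /vlineP[a ->] ->]].
by rewrite lieDl lieZl; apply: memvD; [exact: jM|exact: memvZ].
Qed.

End Engel.

Section Semisimple.
Context {R : rcfType} {g : lieAlgType R}.
Implicit Types (I J W : {vspace g}).

(** Minimality among the ideals of [g], whereas [simple_ideal] tests all subspaces stable under [I]
    alone. *)
Definition minimal_ideal I := [/\ is_lie_ideal I, I != 0%VS &
  forall W, is_lie_ideal W -> (W <= I)%VS -> W = 0%VS \/ W = I].

Lemma exists_minimal_ideal I : is_lie_ideal I -> I != 0%VS ->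
  exists2 J, minimal_ideal J & (J <= I)%VS.
Proof.
move=> iI I0; pose Q n := `[< exists2 J, [/\ is_lie_ideal J, J != 0%VS & (J <= I)%VS] & \dim J = n >].
have exQ : exists n, Q n by exists (\dim I); apply/asboolP; exists I => //.
case: (ex_minnP exQ) => n /asboolP[J [iJ J0 sJ] dJ] minn; exists J => //; split => // W iW sW.
have [->|W0] := eqVneq W 0%VS; [by left|right; apply/eqP; rewrite eqEdim sW dJ].
by apply: minn; apply/asboolP; exists W => //; split => //; exact: subv_trans sW sJ.
Qed.

Hypothesis ss : forall I, is_lie_ideal I -> lie_prod I I = 0%VS -> I = 0%VS.

Let adm (x : g) := hmx (ad x).

Let adm_lie x y : adm (lie x y) = adm y *m adm x - adm x *m adm y.
Proof. by rewrite /adm ad_lie (linfB hmx_linear) !hmx_comp. Qed.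

Let adm_linear : linear adm.
Proof. by move=> a x y; rewrite /adm ad_is_linear hmx_linear. Qed.

(** If the Killing form vanished on [I], which equals its own derived algebra, Cartan's criterion
    would make every [x] in [I] ad-nilpotent. Engel then gives a nonzero element in the centre of
    [I], an abelian ideal of [g]. *)
Lemma kil_minimal_ideal I : minimal_ideal I ->
  ~ (forall x y, x \in I -> y \in I -> kil x y = 0).
Proof.
move=> [iI I0 minI] kil0.
have pI : lie_prod I I = I.
  case: (minI (lie_prod I I)) => //; first exact: lie_prod_ideal.
    by apply/lie_prod_subP => x y _; exact: iI.
  by move/(ss iI)/eqP; rewrite (negbTE I0).
have nil x : x \in I -> exists k, forall y, iter k (lie x) y = 0.
  move=> Ix; pose A M := exists2 z, z \in I & M = adm z.
  suff xn : adm x ^+ \dim {:g} = 0.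
    exists (\dim {:g}) => y; apply/eqP.
    rewrite -(passmx.rVof_eq0 (vbasisP {:g})); apply/eqP.
    have -> k : passmx.rVof (vbasis {:g}) (iter k (lie x) y) =
        passmx.rVof (vbasis {:g}) y *m adm x ^+ k.
      elim: k => [|k IHk]; first by rewrite expr0 mulmx1.
      rewrite exprSr mulmxA -IHk /= -adE.
      exact: rVof_hmx.
    by rewrite xn mulmx0.
  have : x \in lie_prod I I by rewrite pI.
  rewrite /lie_prod; set s := [seq _ | _ <- _, _ <- _] => /(@coord_span _ _ _ (in_tuple s)) xE.
  have sI i : exists uv : g * g, [/\ uv.1 \in I, uv.2 \in I & s`_i = lie uv.1 uv.2].
    have [si|si] := ltnP i (size s).
      have /allpairsP[uv [u1 v1 ->]] := mem_nth 0 si.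
      by exists uv; split => //; exact: vbasis_mem.
    by exists (0, 0); rewrite mem0v nth_default //= lie0l.
  have [uv Huv] := choice sI.
  pose c i := coord (in_tuple s) i x.
  (* The two factors of each bracket are exchanged because [hmx] acts on row vectors and reverses
     composition. *)
  apply: (@real_trace_form_nilpotent R _ A (size s) (fun i => c i *: adm (uv i).2)
    (fun i => adm (uv i).1)).
  - by move=> a _ _ [z1 I1 ->] [z2 I2 ->]; exists (a *: z1 + z2); rewrite ?memvD ?memvZ // adm_linear.
  - by exists 0; [exact: mem0v|rewrite (linf0 adm_linear)].
  - by move=> _ _ [z1 I1 ->] [z2 I2 ->]; exists (lie z2 z1); [exact: iI|rewrite adm_lie].
  - by move=> _ _ [z1 I1 ->] [z2 I2 ->]; rewrite -hmx_comp; exact: kil0.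
  - move=> i; exists (c i *: (uv i).2); last by rewrite (linfZ adm_linear).
    by rewrite memvZ //; have [] := Huv i.
  - by move=> i; exists (uv i).1 => //; have [] := Huv i.
  - rewrite [in LHS]xE (linf_sum adm_linear); apply: eq_bigr => i _.
    have [_ _ ->] := Huv i; rewrite (linfZ adm_linear) adm_lie scalerBr.
    by rewrite -scalemxAl -scalemxAr.
have I_sub : is_lie_subalgebra I by move=> x y _; exact: iI.
have I_not0 : ~~ (I <= 0)%VS by rewrite subv0.
have [x u _||v [Iv v0 vI]] := engel I_sub nil I_not0; first exact: iI.
  by move=> x w _; rewrite !memv0 => /eqP ->; rewrite lie0r.
have [Z HZ] : exists Z : {vspace g}, forall z, z \in Z <->
    z \in I /\ forall x, x \in I -> lie x z = 0.
  apply: vspace_comprehension => [|a u w [Iu uI] [Iw wI]].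
    by split=> [|x _]; rewrite ?mem0v ?lie0r.
  split=> [|x Ix]; first by rewrite memvD ?memvZ.
  by rewrite lieDr lieZr uI // wI // scaler0 addr0.
have Z0 : Z = 0%VS.
  apply: ss => [x z /HZ[Iz zI]|].
    apply/HZ; split=> [|y Iy]; first exact: iI.
    by rewrite lie_leibniz (zI y Iy) lie0r addr0 zI // ideal_lieP.
  apply/eqP; rewrite -subv0; apply/lie_prod_subP => x y /HZ[Ix _] /HZ[_ yI].
  by rewrite yI // mem0v.
case/negP: v0; rewrite -Z0; apply/HZ; split => // x Ix.
by apply/eqP; rewrite -memv0; exact: vI.
Qed.

(** A minimal ideal inside the intersection would carry the zero form. *)
Lemma ideal_cap_perp I : is_lie_ideal I -> (I :&: perp I)%VS = 0%VS.
Proof.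
move=> iI; apply/eqP/negPn/negP => n0.
have [J mJ] := exists_minimal_ideal (capv_ideal iI (perp_ideal iI)) n0.
rewrite subv_cap => /andP[JI JpI]; apply: (kil_minimal_ideal mJ) => x y Jx Jy.
by apply: (perpP _ _ (subvP JpI _ Jy)); exact: subvP JI _ Jx.
Qed.

Lemma ideal_add_perp I : is_lie_ideal I -> (I + perp I)%VS = fullv.
Proof.
move=> iI; apply/eqP; rewrite eqEdim subvf /= dimv_disjoint_sum ?ideal_cap_perp //.
exact: dim_perp.
Qed.

Lemma lie_ideal_perp I x y : is_lie_ideal I -> x \in I -> y \in perp I -> lie x y = 0.
Proof.
move=> iI Ix Iy; apply/eqP; rewrite -memv0 -(ideal_cap_perp iI) memv_cap ideal_lieP //=.
exact: perp_ideal.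
Qed.

(** [perp I] commutes with [I] and complements it, so a subspace of [I] stable under [I] is an ideal
    of [g]. *)
Lemma minimal_ideal_simple I : minimal_ideal I -> simple_ideal I.
Proof.
move=> [iI I0 minI]; split => //; first by apply: contra_neq I0; exact: ss.
move=> W sW WW; apply: minI => // x w Ww.
have /memv_addP[u Iu [v pv ->]] : x \in (I + perp I)%VS by rewrite ideal_add_perp // memvf.
rewrite lieDl (lieC v) (lie_ideal_perp iI _ pv) ?oppr0 ?addr0; last exact: subvP sW _ Ww.
by apply: (subvP WW); exact: memv_lie_prod.
Qed.

Lemma exists_simple_ideal I : is_lie_ideal I -> I != 0%VS ->
  exists2 J, simple_ideal J & (J <= I)%VS.
Proof.
move=> iI /(exists_minimal_ideal iI)[J mJ sJ]; exists J => //.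
exact: minimal_ideal_simple.
Qed.

End Semisimple.

Lemma simple_ideal_minimal {K : fieldType} {g : lieAlgType K} (I W : {vspace g}) :
  simple_ideal I -> is_lie_ideal W -> (W <= I)%VS -> W = 0%VS \/ W = I.
Proof.
move=> [iI _ minI] iW sW; apply: minI => //.
by apply/lie_prod_subP => x y _; exact: iW.
Qed.

Lemma simple_ideal_neq0 {K : fieldType} {g : lieAlgType K} (I : {vspace g}) :
  simple_ideal I -> I != 0%VS.
Proof.
move=> [_ + _]; apply: contra_neq => ->; apply/eqP; rewrite -subv0.
by apply/lie_prod_subP => x y; rewrite memv0 => /eqP -> _; rewrite lie0l mem0v.
Qed.

(** * Differentials in the charts of a Lie group *)

Section Calculus.
Context {R : realType} {V W : normedModType R}.
Implicit Types (f : V -> W) (x : V).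

Lemma near_is_diff f f' x (df : V -> W) :
  (\forall y \near x, f y = f' y) -> is_diff x f df -> is_diff x f' df.
Proof.
move=> ff' [dfx <-]; have [cdf /eqaddoP fo] := (diff_locallyP _ _).1 dfx.
have f'o : f' \o shift x = cst (f' x) + 'd f x +o_ 0 id.
  apply/eqaddoP => e e0; have := fo e e0.
  have f'x : f x = f' x by exact: nbhs_singleton ff'.
  have ff'0 : \forall h \near (0 : V), f (h + x) = f' (h + x).
    by have := ff'; rewrite (near_shift 0 x) /= subr0.
  apply: filterS2 ff'0 => h fh; rewrite /= !fctE.
  by rewrite fh f'x.
have d' := diff_unique cdf f'o.
split; last exact: d'.
by apply/diff_locallyP; rewrite d'.
Qed.

Lemma is_diff_derive f x df v : is_diff x f df -> 'D_v f x = df v.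
Proof. by move=> [dfx <-]; exact: deriveE. Qed.

End Calculus.

Lemma is_diff_slicel {R : realType} {U V W : normedModType R} (f : U * V -> W) u v df :
  is_diff (u, v) f df -> is_diff u (fun a => f (a, v)) (fun a => df (a, 0)).
Proof.
move=> dfx; have dp : is_diff u (fun a : U => (a, v)) (fun a => (a, 0 : V)).
  exact: (is_diff_pair (f := id) (g := cst v)).
exact: (is_diff_comp dp).
Qed.

Lemma is_diff_slicer {R : realType} {U V W : normedModType R} (f : U * V -> W) u v df :
  is_diff (u, v) f df -> is_diff v (fun b => f (u, b)) (fun b => df (0, b)).
Proof.
move=> dfx; have dp : is_diff v (fun b : V => (u, b)) (fun b => (0 : U, b)).
  exact: (is_diff_pair (f := cst u) (g := id)).
exact: (is_diff_comp dp).
Qed.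

Lemma differentiable_graph {R : realType} {U V W : normedModType R} (f : U * V -> W) (g : U -> V) x :
  differentiable f (x, g x) -> differentiable g x -> differentiable (fun a => f (a, g a)) x.
Proof.
move=> df dg; have dp : is_diff x (fun a => (a, g a)) (fun a => (a, 'd g x a)).
  exact: (is_diff_pair (f := id) (g := g)).
by have [] := is_diff_comp dp (differentiableP (df : differentiable f ((fun a => (a, g a)) x))).
Qed.

(** A differential evaluated at a vector that moves with the base point becomes a finite sum of
    derivatives in fixed directions, the only ones about which [smooth_on] speaks. *)
Lemma pdiffl_sum {R : realType} {n} {V W : normedModType R} (D : {linear ('rV[R]_n * V)%type -> W})
    (z a : 'rV[R]_n) (b : 'I_n -> W) A :
  a = z -> (forall i, b i = D (delta_mx 0 i, 0)) -> A = D (z, 0) ->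
  \sum_(i < n) a 0 i *: b i = A.
Proof.
move=> -> bE ->; have lD : linear (fun w => D (w, 0)).
  move=> k x y; rewrite -linearP; congr (D _).
  by rewrite [RHS]surjective_pairing /= scaler0 addr0.
rewrite [in RHS](row_sum_delta z) (linf_sum lD).
by apply: eq_bigr => i _; rewrite (linfZ lD) bE.
Qed.

Lemma differentiable_rV {R : realType} {V : normedModType R} {n} (f : V -> 'rV[R]_n) x :
  (forall j, differentiable (fun y => f y 0 j : R) x) -> differentiable f x.
Proof.
move=> df; have -> : f = \sum_(j < n) (fun y => f y 0 j *: (delta_mx 0 j : 'rV[R]_n)).
  by apply/funext => y; rewrite fct_sumE; exact: row_sum_delta.
by apply: differentiable_sum => j; exact: differentiableZl.
Qed.

Section ConnectedGroup.
Context {R : realType} {n : nat} {G : lieGroupType R n}.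

Lemma lie_mull_continuous (p : G) : continuous (fun q : G => (p * q)%g).
Proof.
move=> q; apply: (continuous_comp (f := fun q : G => (p, q)) (g := fun r : G * G => (r.1 * r.2)%g)).
  by apply: cvg_pair; [exact: cvg_cst|exact: cvg_id].
exact: lie_mul_continuous.
Qed.

Lemma lie_mulr_continuous (p : G) : continuous (fun q : G => (q * p)%g).
Proof.
move=> q; apply: (continuous_comp (f := fun q : G => (q, p)) (g := fun r : G * G => (r.1 * r.2)%g)).
  by apply: cvg_pair; [exact: cvg_id|exact: cvg_cst].
exact: lie_mul_continuous.
Qed.

(** Translates of a neighbourhood of 1 show that both [S] and its complement are open. *)
Lemma connected_subgroup (S : set G) : connected [set: G] ->
  (forall p q, S p -> S q -> S (p * q)%g) -> (forall p, S p -> S (p^-1)%g) ->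
  nbhs (1%g : G) S -> S = [set: G].
Proof.
move=> cG SM SV S1.
have S_nbhs p : nbhs p [set q | S (p^-1 * q)%g].
  by have := @lie_mull_continuous (p^-1)%g p; apply; rewrite /= mulVg.
apply: cG.
- by exists 1%g; exact: nbhs_singleton S1.
- exists S; last by rewrite setTI.
  rewrite openE => p Sp; rewrite /interior; near=> q.
  have -> : q = (p * (p^-1 * q))%g by rewrite mulVKg.
  by apply: SM => //; near: q; exact: S_nbhs.
- exists S; last by rewrite setTI.
  rewrite -openC openE => p nSp; rewrite /interior; near=> q => Sq; apply: nSp.
  have -> : p = (q * (p^-1 * q)^-1)%g by rewrite invgM invgK mulVKg.
  by apply: SM => //; apply: SV; near: q; exact: S_nbhs.
Unshelve. all: by end_near. Qed.

End ConnectedGroup.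

Section Charts.
Context {R : realType} {n : nat} {G : lieGroupType R n}.
Implicit Types (c : chart R n G) (p : G) (u : 'rV[R]_n).

Lemma chart_invK c u : chart_img c u -> chart_fun c (chart_inv c u) = u /\
  chart_dom c (chart_inv c u).
Proof. by move=> [p cp <-]; rewrite chart_funK. Qed.

Lemma chart_img_fun c p : chart_dom c p -> chart_img c (chart_fun c p).
Proof. by move=> cp; exists p. Qed.

Lemma chart_inv_continuous c u : chart_img c u -> {for u, continuous (chart_inv c)}.
Proof.
move=> cu; have := @chart_inv_cts _ _ _ c.
rewrite continuous_open_subspace; last exact: chart_img_open.
by apply; rewrite inE.
Qed.

Lemma chart_fun_continuous c p : chart_dom c p -> {for p, continuous (chart_fun c)}.
Proof.
move=> cp; have := @chart_fun_cts _ _ _ c.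
rewrite continuous_open_subspace; last exact: chart_dom_open.
by apply; rewrite inE.
Qed.

Lemma chart_dom_nbhs c p : chart_dom c p -> nbhs p (chart_dom c).
Proof. by move=> cp; apply: open_nbhs_nbhs; split => //; exact: chart_dom_open. Qed.

Lemma chart_img_nbhs c u : chart_img c u -> nbhs u (chart_img c).
Proof. by move=> cp; apply: open_nbhs_nbhs; split => //; exact: chart_img_open. Qed.

Definition mulc (a b c : chart R n G) (u : 'rV[R]_n * 'rV[R]_n) :=
  chart_fun c (chart_inv a u.1 * chart_inv b u.2)%g.

Definition mulc_dom (a b c : chart R n G) (u : 'rV[R]_n * 'rV[R]_n) :=
  [/\ chart_img a u.1, chart_img b u.2 & chart_dom c (chart_inv a u.1 * chart_inv b u.2)%g].

Lemma mulc_differentiable a b c (u : 'rV[R]_n * 'rV[R]_n) : atlas a -> atlas b -> atlas c ->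
  mulc_dom a b c u -> differentiable (mulc a b c) u.
Proof. by move=> aa ab ac cu; have [h _] := lie_mul_smooth _ _ _ aa ab ac 1%N; exact: h. Qed.

Lemma mulc_deriv_differentiable a b c v (u : 'rV[R]_n * 'rV[R]_n) : atlas a -> atlas b -> atlas c ->
  mulc_dom a b c u -> differentiable ('D_v (mulc a b c)) u.
Proof. by move=> aa ab ac cu; have [_ /(_ v)[h _]] := lie_mul_smooth _ _ _ aa ab ac 2%N; exact: h. Qed.

Lemma conj_chart_near c p : atlas c -> chart_dom c 1%g ->
  \forall v \near chart_fun c 1%g, chart_dom c (p * chart_inv c v * p^-1)%g.
Proof.
move=> ac c1.
have : {for chart_fun c 1%g, continuous (fun v => p * chart_inv c v * p^-1)%g}.
  apply: (continuous_comp (f := chart_inv c) (g := fun q => (p * q * p^-1)%g)).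
    by apply: chart_inv_continuous; exact: chart_img_fun.
  apply: (continuous_comp (f := fun q => (p * q)%g) (g := fun q => (q * p^-1)%g)).
    exact: lie_mull_continuous.
  exact: lie_mulr_continuous.
by apply; rewrite chart_funK // mulg1 mulgV; exact: chart_dom_nbhs.
Qed.

(** Neither [p] nor [p^-1] need lie in the domain of [c], so conjugation passes through auxiliary
    charts [a] at [p] and [b] at [p^-1]. *)
Lemma conj_chart_differentiable c p : atlas c -> chart_dom c 1%g ->
  differentiable (fun v => chart_fun c (p * chart_inv c v * p^-1)%g) (chart_fun c 1%g).
Proof.
move=> ac c1; set u0 := chart_fun c 1%g.
have iu0 : chart_img c u0 by exact: chart_img_fun.
have cu0 : chart_inv c u0 = 1%g by exact: chart_funK.
have [a aa ap] := atlas_cover p.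
have [b ab bp] := atlas_cover (p^-1)%g.
pose f v := mulc a c a (chart_fun a p, v).
pose h w := mulc a b c (w, chart_fun b (p^-1)%g).
have f0 : f u0 = chart_fun a p by rewrite /f /mulc /= chart_funK // cu0 mulg1.
have df : differentiable f u0.
  have /differentiableP/is_diff_slicer[] // : differentiable (mulc a c a) (chart_fun a p, u0).
  apply: mulc_differentiable => //; split => //=; first exact: chart_img_fun.
  by rewrite chart_funK // cu0 mulg1.
have dh : differentiable h (f u0).
  rewrite f0; have /differentiableP/is_diff_slicel[] // : differentiable (mulc a b c) (chart_fun a p, chart_fun b (p^-1)%g).
  apply: mulc_differentiable => //; split => /=; [exact: chart_img_fun|exact: chart_img_fun|].
  by rewrite !chart_funK // mulgV.
have /differentiableP dhf := differentiable_comp df dh.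
suff [dc _] : is_diff u0 (fun v => chart_fun c (p * chart_inv c v * p^-1)%g) ('d (h \o f) u0).
  exact: dc.
apply: near_is_diff dhf; near=> v.
have av : chart_dom a (p * chart_inv c v)%g.
  near: v; have : {for u0, continuous (fun v => p * chart_inv c v)%g}.
    apply: (continuous_comp (f := chart_inv c) (g := fun q => (p * q)%g)).
      exact: chart_inv_continuous.
    exact: lie_mull_continuous.
  by apply; rewrite cu0 mulg1; exact: chart_dom_nbhs.
by rewrite /h /f /mulc /= !chart_funK.
Unshelve. all: by end_near. Qed.

End Charts.

Section AdjointChart.
Context {R : realType} {n : nat} {G : lieGroupType R n} (c : chart R n G).
Hypothesis ac : atlas c.
Hypothesis c1 : chart_dom c 1%g.
Implicit Types p q : G.

Let cf := chart_fun c.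
Let ci := chart_inv c.
Let u0 := cf 1%g.
Let conjc p v := cf (p * ci v * p^-1)%g.
Let m := mulc c c c.
Let inv u := cf ((ci u)^-1)%g.

Let u0_img : chart_img c u0. Proof. exact: chart_img_fun. Qed.
Let ci_u0 : ci u0 = 1%g. Proof. exact: chart_funK. Qed.

Let conjc_u0 p : conjc p u0 = u0.
Proof. by rewrite /conjc ci_u0 mulg1 mulgV. Qed.

Let conjc_diff p : is_diff u0 (conjc p) (chart_Ad c p).
Proof. by split => //; exact: conj_chart_differentiable. Qed.

Let ci_conjc p : \forall v \near u0, ci (conjc p v) = (p * ci v * p^-1)%g.
Proof.
by apply: filterS (conj_chart_near p ac c1) => v; exact: chart_funK.
Qed.

Lemma chart_AdM p q Y : chart_Ad c (p * q)%g Y = chart_Ad c p (chart_Ad c q Y).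
Proof.
have dpq : is_diff u0 (conjc p \o conjc q) (chart_Ad c p \o chart_Ad c q).
  have dp : is_diff (conjc q u0) (conjc p) (chart_Ad c p) by rewrite conjc_u0; exact: conjc_diff.
  exact: is_diff_comp (conjc_diff q) dp.
have [_ e] : is_diff u0 (conjc (p * q)%g) (chart_Ad c p \o chart_Ad c q).
  apply: near_is_diff dpq; near=> v; rewrite /= {1}/conjc.
  have -> : ci (conjc q v) = (q * ci v * q^-1)%g by near: v; exact: ci_conjc.
  by rewrite /conjc invgM !mulgA.
exact: (congr1 (fun f => f Y) e).
Unshelve. all: by end_near. Qed.

Lemma chart_Ad1 Y : chart_Ad c 1%g Y = Y.
Proof.
have [_ e] : is_diff u0 (conjc 1%g) id.
  apply: near_is_diff (is_diff_id u0); near=> v; rewrite /conjc invg1 mulg1 mul1g.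
  have iv : chart_img c v by near: v; exact: chart_img_nbhs.
  by have [vE _] := chart_invK iv; exact: esym vE.
exact: (congr1 (fun f => f Y) e).
Unshelve. all: by end_near. Qed.

Definition inv_dom u := chart_img c u /\ chart_dom c ((ci u)^-1)%g.

Let inv_dom_near : \forall u \near u0, inv_dom u.
Proof.
near=> u; split; first by near: u; exact: chart_img_nbhs.
near: u; have : {for u0, continuous (fun u => (ci u)^-1)%g}.
  apply: (continuous_comp (f := ci) (g := fun q => (q^-1)%g)).
    exact: chart_inv_continuous.
  exact: lie_inv_continuous.
by apply; rewrite ci_u0 invg1; exact: chart_dom_nbhs.
Unshelve. all: by end_near. Qed.

Let ci_inv u : inv_dom u -> ci (inv u) = ((ci u)^-1)%g.
Proof. by move=> [_ du]; exact: chart_funK. Qed.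

Let mul_inv_dom u : inv_dom u -> mulc_dom c c c (u, inv u).
Proof.
move=> du; split => /=; first by case: du.
  by case: du => _; exact: chart_img_fun.
by rewrite -/ci ci_inv // mulgV.
Qed.

Let mul_inv u : inv_dom u -> m (u, inv u) = u0.
Proof. by move=> du; rewrite /m /mulc /= -/ci ci_inv // mulgV. Qed.

Let mul_u0_dom u : inv_dom u -> mulc_dom c c c (u, u0).
Proof.
move=> [iu _]; split => //=; rewrite -/ci ci_u0 mulg1.
by have [_] := chart_invK iu.
Qed.

Let inv_differentiable u : inv_dom u -> differentiable inv u.
Proof. by move=> du; have [h _] := lie_inv_smooth _ _ ac ac 1%N; exact: h. Qed.

Let m_diff x : mulc_dom c c c x -> is_diff x m ('d m x).
Proof. by move=> dx; apply/differentiableP; exact: mulc_differentiable. Qed.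

(** Conjugation by [ci u] is a left translation followed by a right translation. For [u] in
    [inv_dom] both are read in the single chart [c], so that the dependence on [u] can be
    differentiated. *)
Let chart_AdE u Y : inv_dom u ->
  chart_Ad c (ci u) Y = 'd m (u, inv u) ('d m (u, u0) (0, Y), 0).
Proof.
move=> du; have [iu _] := du.
have mu0 : m (u, u0) = u.
  by rewrite /m /mulc /= -/ci ci_u0 mulg1; have [] := chart_invK iu.
have d1 : is_diff u0 (fun v => m (u, v)) (fun v => 'd m (u, u0) (0, v)).
  by apply: is_diff_slicer; apply: m_diff; exact: mul_u0_dom.
have d2 : is_diff (m (u, u0)) (fun w => m (w, inv u)) (fun w => 'd m (u, inv u) (w, 0)).
  by rewrite mu0; apply: is_diff_slicel; apply: m_diff; exact: mul_inv_dom.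
have [_ e] : is_diff u0 (conjc (ci u)) (fun v => 'd m (u, inv u) ('d m (u, u0) (0, v), 0)).
  apply: near_is_diff (is_diff_comp d1 d2); near=> v.
  rewrite /conjc /m /mulc /= -/ci ci_inv // [ci (chart_fun c _)]chart_funK //.
  near: v; have : {for u0, continuous (fun v => ci u * ci v)%g}.
    apply: (continuous_comp (f := ci) (g := fun q => (ci u * q)%g)).
      exact: chart_inv_continuous.
    exact: lie_mull_continuous.
  apply; rewrite ci_u0 mulg1; apply: chart_dom_nbhs; by have [] := chart_invK iu.
exact: (congr1 (fun f => f Y) e).
Unshelve. all: by end_near. Qed.

Let pderiv_differentiable u v : inv_dom u -> differentiable (fun u => 'D_v m (u, inv u)) u.
Proof.
move=> du; apply: (differentiable_graph (f := 'D_v m) (g := inv)).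
  by apply: mulc_deriv_differentiable => //; exact: mul_inv_dom.
exact: inv_differentiable.
Qed.

Let Ad_differentiable_u0 Y : differentiable (fun u => chart_Ad c (ci u) Y) u0.
Proof.
have du0 : inv_dom u0 by exact: nbhs_singleton inv_dom_near.
pose e (i : 'I_n) : 'rV[R]_n := delta_mx 0 i.
pose h u := \sum_(i < n) ('D_(0, Y) m (u, u0) 0 i *: 'D_(e i, 0) m (u, inv u)).
have hE : \forall u \near u0, h u = chart_Ad c (ci u) Y.
  near=> u; have du : inv_dom u by near: u; exact: inv_dom_near.
  apply: (pdiffl_sum _ _ (chart_AdE Y du)).
    exact: (is_diff_derive _ (m_diff (mul_u0_dom du))).
  by move=> i; exact: (is_diff_derive _ (m_diff (mul_inv_dom du))).
have dh : differentiable h u0.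
  apply: differentiable_rV => j.
  have -> : (fun u => h u 0 j : R) = \sum_(i < n) (fun u => 'D_(0, Y) m (u, u0) 0 i * 'D_(e i, 0) m (u, inv u) 0 j).
    by apply/funext => u; rewrite fct_sumE summxE; apply: eq_bigr => i _; rewrite mxE.
  apply: differentiable_sum => i; apply: differentiableM.
    apply: (differentiable_comp (f := fun u => 'D_(0, Y) m (u, u0)) (g := fun r : 'rV[R]_n => r 0 i)); last exact: differentiable_coord.
    have := mulc_deriv_differentiable (0, Y) ac ac ac (mul_u0_dom du0).
    by move=> /differentiableP/is_diff_slicel[].
  apply: (differentiable_comp (f := fun u => 'D_(e i, 0) m (u, inv u)) (g := fun r : 'rV[R]_n => r 0 j)); last exact: differentiable_coord.
  exact: pderiv_differentiable.
by have [] := near_is_diff hE (differentiableP dh).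
Unshelve. all: by end_near. 
Qed.

Let brT X Y := 'D_X (fun u => chart_Ad c (ci u) Y) u0.
(** The right-invariant Maurer-Cartan form: right translation by the inverse of [ci u] carries the
    tangent vector [w] at [u] to the identity. *)
Let xi u w := 'D_(w, 0) m (u, inv u).

Let inv_u0 : inv u0 = u0. Proof. by rewrite /inv ci_u0 invg1. Qed.

Let xi_u0 w : xi u0 w = w.
Proof.
have du0 : inv_dom u0 by exact: nbhs_singleton inv_dom_near.
rewrite /xi (is_diff_derive _ (m_diff (mul_inv_dom du0))) inv_u0.
have d := is_diff_slicel (m_diff (mul_u0_dom du0)).
have [_ e] : is_diff u0 (fun a => m (a, u0)) id.
  apply: near_is_diff (is_diff_id u0); near=> v.
  have iv : chart_img c v by near: v; exact: chart_img_nbhs.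
  by rewrite /m /mulc /= -/ci ci_u0 mulg1; have [] := chart_invK iv.
have [_ e'] := d.
have : (fun a : 'rV[R]_n => 'd m (u0, u0) (a, 0)) = id by rewrite -e'.
exact: (congr1 (fun f => f w)).
Unshelve. all: by end_near. Qed.

Let xi_linear u : inv_dom u -> linear (xi u).
Proof.
move=> du k a b; have xiE w := is_diff_derive (w, 0) (m_diff (mul_inv_dom du)).
rewrite /xi !xiE.
have -> : ((k *: a + b, 0) : 'rV[R]_n * 'rV[R]_n) = k *: (a, 0) + (b, 0).
  by rewrite [RHS]surjective_pairing /= scaler0 addr0.
exact: linearP.
Qed.

(** Writing [v] as [(v u^-1) u] reduces the derivative of [Ad] at [u] to the one at the identity,
    taken along [xi u w]. *)
Let chart_Ad_is_diff u Y : inv_dom u ->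
  is_diff u (fun v => chart_Ad c (ci v) Y) (fun w => brT (xi u w) (chart_Ad c (ci u) Y)).
Proof.
move=> du; set Z := chart_Ad c (ci u) Y.
have d1 := is_diff_slicel (m_diff (mul_inv_dom du)).
have d2 : is_diff (m (u, inv u)) (fun v => chart_Ad c (ci v) Z) (brT^~ Z).
  rewrite (mul_inv du).
  have d := differentiableP (Ad_differentiable_u0 Z).
  by split; [exact: Ad_differentiable_u0|apply/funext => X; rewrite /brT (is_diff_derive _ d)].
have d3 : is_diff u (fun v => chart_Ad c (ci (m (v, inv u))) Z) (fun w => brT (xi u w) Z).
  have [d e] := is_diff_comp d1 d2; split; first exact: d.
  rewrite e; apply/funext => w; congr (brT _ Z).
  by rewrite /xi (is_diff_derive _ (m_diff (mul_inv_dom du))).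
apply: near_is_diff d3; near=> v.
rewrite /Z -chart_AdM; congr (chart_Ad c _ Y).
have <- : (ci v * ci (inv u) * ci u = ci v)%g by rewrite (ci_inv du) -mulgA mulVg mulg1.
congr (_ * _)%g; rewrite /m /mulc /= -/ci; apply: chart_funK.
near: v; have : {for u, continuous (fun v => ci v * ci (inv u))%g}.
  apply: (continuous_comp (f := ci) (g := fun q => (q * ci (inv u))%g)).
    by apply: chart_inv_continuous; case: du.
  exact: lie_mulr_continuous.
by apply; rewrite (ci_inv du) mulgV; exact: chart_dom_nbhs.
Unshelve. all: by end_near. Qed.

(** The differential equation of [Ad]. Later arguments see the Maurer-Cartan form only through its
    linearity near [u0], its continuity at [u0] and its value there. *)
Lemma chart_Ad_derivative : exists xi : 'rV[R]_n -> 'rV[R]_n -> 'rV[R]_n,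
  [/\ \forall u \near u0, linear (xi u) /\ forall Y,
        is_diff u (fun v => chart_Ad c (ci v) Y)
          (fun w => 'D_(xi u w) (fun v => chart_Ad c (ci v) (chart_Ad c (ci u) Y)) u0),
      forall w, {for u0, continuous (xi^~ w)} & xi u0 = id].
Proof.
exists xi; split.
- near=> u; have du : inv_dom u by near: u; exact: inv_dom_near.
  split; first exact: xi_linear.
  by move=> Y; exact: chart_Ad_is_diff.
- move=> w; apply: differentiable_continuous; apply: pderiv_differentiable.
  exact: nbhs_singleton inv_dom_near.
- by apply/funext => w; exact: xi_u0.
Unshelve. all: by end_near. Qed.

Lemma chart_nbhs1 (S : set G) : (\forall u \near u0, S (ci u)) -> nbhs (1%g : G) S.
Proof.
move=> Su; near=> p.
have cp : chart_dom c p by near: p; exact: chart_dom_nbhs.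
rewrite -(chart_funK cp); near: p.
exact: chart_fun_continuous Su.
Unshelve. all: by end_near. Qed.

End AdjointChart.

(** * The adjoint representation *)

Section MeanValue.
Context {R : realType}.

(** The scalar mean value theorem on each coordinate along the segment; the norm is a maximum of
    entries, so each coordinate may use its own intermediate point. *)
Lemma mean_value_bound {n m} (f : 'rV[R]_n -> 'rV[R]_m) (df : R -> 'rV[R]_n -> 'rV[R]_m) u v e :
  (forall t, 0 <= t <= 1 -> is_diff (v + t *: (u - v)) f (df t)) ->
  (forall t, 0 <= t <= 1 -> `|df t (u - v)| <= e) -> `|f u - f v| <= e.
Proof.
move=> dfP dfe; pose w := u - v; pose line (t : R) := v + t *: w.
have e0 : 0 <= e by rewrite (le_trans _ (dfe 0 _)) // lexx ler01.
apply: mx_norm_le => // i j; pose g t : R := f (line t) i j.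
have dline t : is_diff t line (fun s => s *: w).
  by apply: is_diff_eq; apply/funext => s; rewrite /= add0r.
have dg (t : R) : 0 <= t <= 1 -> is_derive t 1 g (df t w i j).
  move=> t01; have dt : is_diff (line t) f (df t) by exact: dfP.
  have dfl := is_diff_comp (dline t) dt.
  have dr : derivable (f \o line) t 1 by case: dfl => d _; exact: diff_derivable.
  have -> : df t w = 'D_1 (f \o line) t by rewrite (is_diff_derive (1 : R) dfl) /= scale1r.
  apply: (DeriveDef _ _); first exact: (derivable_mxP (f \o line) t 1).1 dr i j.
  by rewrite derive_mx // mxE.
have cg : {within `[0, 1], continuous g}.
  apply: derivable_within_continuous => t; rewrite in_itv /= => t01.
  by have [] := dg t t01.
have [t t01 gt] : exists2 t, t \in `[0, 1]%R & g 1 - g 0 = df t w i j * (1 - 0).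
  apply: (MVT_segment ler01) => // t; rewrite in_itv /= => /andP[t0 t1].
  by apply: dg; rewrite !ltW.
have <- : df t w i j = (f u - f v) i j.
  move: gt; rewrite subr0 mulr1 => <-; rewrite /g /line scale1r scale0r addr0 /w.
  by rewrite [v + _]addrC subrK !mxE.
by move: t01; rewrite in_itv /= => t01; exact: le_trans (mx_entry_le _ _ _) (dfe t t01).
Qed.

Lemma near_norm {V : normedModType R} (x : V) (P : set V) : nbhs x P ->
  exists2 d, 0 < d & forall y, `|y - x| < d -> P y.
Proof.
by move=> /nbhs_normP[d d0 dP]; exists d => // y yx; apply: dP; rewrite /ball_ /= distrC.
Qed.

Lemma norm_segment {n} (x u v : 'rV[R]_n) (t d : R) : 0 <= t <= 1 ->
  `|u - x| < d -> `|v - x| < d -> `|v + t *: (u - v) - x| < d.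
Proof.
move=> /andP[t0 t1] ux vx.
have -> : v + t *: (u - v) - x = t *: (u - x) + (1 - t) *: (v - x).
  by apply/matrixP => i j; rewrite !mxE; ring.
rewrite (le_lt_trans (ler_normD _ _)) // !normrZ (ger0_norm t0) ger0_norm ?subr_ge0 //.
have [->|t'] := eqVneq t 1; first by rewrite subrr mul0r addr0 mul1r.
have : t * `|u - x| + (1 - t) * `|v - x| < t * d + (1 - t) * d.
  by apply: ler_ltD; [rewrite ler_wpM2l // ltW|rewrite ltr_pM2l // subr_gt0 lt_neqAle t'].
by rewrite -mulrDl [t + _]addrC subrK mul1r.
Qed.

Lemma mx_linear_is_diff {n m} (f : 'rV[R]_n -> 'rV[R]_m) (lf : linear f) x : is_diff x f f.
Proof.
pose F : {linear 'rV[R]_n -> 'rV[R]_m} := HB.pack f (GRing.isLinear.Build R _ _ *:%R _ lf).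
have cF : continuous F by exact: mx_linear_continuous.
have dF : differentiable F x by exact: linear_differentiable.
have eF : 'd F x = F :> (_ -> _) by exact: diff_lin.
by split; [exact: dF|exact: eF].
Qed.

Lemma linear_family_near {n m} (df : 'rV[R]_n -> 'rV[R]_n -> 'rV[R]_m) u0 :
  (\forall u \near u0, linear (df u)) -> (forall w, {for u0, continuous (df^~ w)}) ->
  forall e, 0 < e -> \forall u \near u0, forall w, `|df u w - df u0 w| <= e * `|w|.
Proof.
move=> ldfP cdf e e0; pose e' := e / n.+1%:R; have e'0 : 0 < e' by rewrite divr_gt0.
have ldf0 := nbhs_singleton ldfP.
near=> u => w; have ldf : linear (df u) by near: u.
rewrite (row_sum_delta w) (linf_sum ldf) (linf_sum ldf0) -sumrB -row_sum_delta.
have ei i : `|df u (delta_mx 0 i) - df u0 (delta_mx 0 i)| <= e'.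
  move: i; near: u; apply: filter_forall => i.
  by move/cvgrPdistC_le : (cdf (delta_mx 0 i)); exact.
have -> : e * `|w| = e' * `|w| * n.+1%:R by rewrite /e'; field.
rewrite (le_trans (ler_norm_sum _ _ _)) // (@le_trans _ _ (\sum_(i < n) e' * `|w|)) //.
  apply: ler_sum => i _; rewrite (linfZ ldf) (linfZ ldf0) -scalerBr normrZ mulrC.
  by rewrite ler_pM // mx_entry_le.
by rewrite sumr_const card_ord -[leLHS]mulr_natr ler_wpM2l ?mulr_ge0 ?ler_nat // ltW.
Unshelve. all: by end_near. Qed.

(** The mean value bound for [f - df u0], whose derivative is uniformly small near [u0]. *)
Lemma strict_of_derivative {n m} (f : 'rV[R]_n -> 'rV[R]_m) (df : 'rV[R]_n -> 'rV[R]_n -> 'rV[R]_m) u0 :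
  (\forall u \near u0, linear (df u) /\ is_diff u f (df u)) ->
  (forall w, {for u0, continuous (df^~ w)}) ->
  forall e, 0 < e -> exists2 d, 0 < d & forall u v, `|u - u0| < d -> `|v - u0| < d ->
    `|f u - f v - df u0 (u - v)| <= e * `|u - v|.
Proof.
move=> dfP cdf e e0; have [ldf0 _] := nbhs_singleton dfP.
have dfe : \forall u \near u0, forall w, `|df u w - df u0 w| <= e * `|w|.
  by apply: linear_family_near => //; apply: filterS dfP => u [].
have [d d0 near0] := near_norm (filterI dfP dfe); exists d => // u v ud vd.
have -> : f u - f v - df u0 (u - v) = (f u - df u0 u) - (f v - df u0 v).
  by rewrite (linfB ldf0); apply/matrixP => i j; rewrite !mxE; ring.
apply: (@mean_value_bound _ _ (f \- df u0) (fun t => df (v + t *: (u - v)) \- df u0)) => t t01.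
  have [[_ d1] _] := near0 _ (norm_segment t01 ud vd).
  by have d2 := mx_linear_is_diff ldf0 (v + t *: (u - v)); exact: is_diffB.
by have [_] := near0 _ (norm_segment t01 ud vd); exact.
Qed.

Lemma le0_of_le_pow2 (a : R) : (forall k, a <= 2^-1 ^+ k) -> a <= 0.
Proof.
move=> ak; rewrite leNgt; apply/negP => a0; pose k := Num.bound a^-1.
have := ak k; rewrite leNgt => /negP; apply.
rewrite -[a in ltRHS]invrK exprVn ltf_pV2 ?posrE ?invr_gt0 ?exprn_gt0 //.
have a1 : 0 <= a^-1 by rewrite invr_ge0 ltW.
rewrite (lt_trans (archi_boundP a1)) // -natrX ltr_nat; exact: ltn_expl.
Qed.

End MeanValue.

Section Adjoint.
Context {R : realType} {n : nat} {G : lieGroupType R n} {g : lieAlgType R}.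
Variable L : lie_algebra_of G g.

Let c := tan_chart L.
Let tan := tan_map L.
Let ci := chart_inv c.
Let u0 := chart_fun c 1%g.
Let H Y u := chart_Ad c (ci u) Y.
Let br X Y := 'D_X (H Y) u0.
Let ac : atlas c := tan_chart_atlas L.
Let c1 : chart_dom c 1%g := tan_chart_one L.

Let chart_Ad_linear p : linear (chart_Ad c p).
Proof. by move=> k x y; rewrite /chart_Ad; exact: linearP. Qed.

Lemma tan_map_inverse : {tani : 'rV[R]_n -> g | [/\ linear tani, cancel tan tani, cancel tani tan &
  forall p x, Ad L p x = tani (chart_Ad c p (tan x))]}.
Proof.
exists (tan^-1)%VF; split.
- exact: linearP.
- by move=> x; rewrite lker0_lfunK //; apply/eqP; exact: tan_map_inj.
- by move=> y; rewrite limg_lfunVK // [limg _]tan_map_surj memvf.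
- move=> p x; rewrite /Ad; apply: linfunE => k a b.
  by rewrite [tan_map L _]linearP (chart_Ad_linear p k) linearP.
Qed.

Let tani := sval tan_map_inverse.

Let tani_linear : linear tani. Proof. by case: (svalP tan_map_inverse). Qed.
Let tan_mapK : cancel tan tani. Proof. by case: (svalP tan_map_inverse). Qed.
Let tan_mapVK : cancel tani tan. Proof. by case: (svalP tan_map_inverse). Qed.
Let AdE p x : Ad L p x = tani (chart_Ad c p (tan x)).
Proof. by case: (svalP tan_map_inverse). Qed.

Lemma tan_Ad p x : tan (Ad L p x) = chart_Ad c p (tan x).
Proof. by rewrite AdE tan_mapVK. Qed.

Lemma AdM p q : Ad L (p * q)%g = (Ad L p \o Ad L q)%VF.
Proof.
apply/lfunP => x; rewrite [RHS]comp_lfunE [LHS]AdE [RHS]AdE tan_Ad.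
by congr (tani _); exact: chart_AdM.
Qed.

Lemma Ad1 : Ad L 1%g = \1%VF.
Proof.
by apply/lfunP => x; rewrite [LHS]AdE [RHS]id_lfunE chart_Ad1 // tan_mapK.
Qed.

Lemma AdVK p x : Ad L p^-1%g (Ad L p x) = x.
Proof. by rewrite -[LHS]comp_lfunE -AdM mulVg Ad1 id_lfunE. Qed.

Let Hu0 Y : H Y u0 = Y.
Proof. by rewrite /H /ci chart_funK // chart_Ad1. Qed.

Let brE x y : br (tan x) (tan y) = tan (lie x y).
Proof. by rewrite tan_map_lie. Qed.

Let brE' X Y : br X Y = tan (lie (tani X) (tani Y)).
Proof. by rewrite -brE !tan_mapVK. Qed.

Let br_linearl Y : linear (br^~ Y).
Proof. by move=> k a b; rewrite !brE' tani_linear lie_is_linearl linearP. Qed.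

Let br_linearr X : linear (br X).
Proof. by move=> k a b; rewrite !brE' tani_linear lie_is_linearr linearP. Qed.

Let H_is_diff Y : is_diff u0 (H Y) (br^~ Y).
Proof.
have [xi [/nbhs_singleton[_ dY] _ xi0]] := chart_Ad_derivative ac c1.
by have := dY Y; rewrite -/(H Y) -/(H Y u0) Hu0 xi0.
Qed.

(** Obtained by differentiating [Ad (p v p^-1) Ad p = Ad p Ad v] at [v = 1]. *)
Lemma Ad_lie p x y : Ad L p (lie x y) = lie (Ad L p x) (Ad L p y).
Proof.
rewrite -[LHS]tan_mapK -[RHS]tan_mapK -brE !tan_Ad -brE; congr (tani _).
set X := tan x; set Y := tan y; pose A := chart_Ad c p.
pose conj v := chart_fun c (p * ci v * p^-1)%g.
have dc : is_diff u0 conj A by split => //; exact: conj_chart_differentiable.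
have conj0 : conj u0 = u0 by rewrite /conj /ci chart_funK // mulg1 mulgV.
have d1 : is_diff u0 (H (A Y) \o conj) (br^~ (A Y) \o A).
  have dH : is_diff (conj u0) (H (A Y)) (br^~ (A Y)) by rewrite conj0; exact: H_is_diff.
  exact: is_diff_comp dc dH.
have dA : is_diff (H Y u0) A A by exact: (mx_linear_is_diff (chart_Ad_linear p)).
have d2 := is_diff_comp (H_is_diff Y) dA.
have [_ e] : is_diff u0 (A \o H Y) (br^~ (A Y) \o A).
  apply: near_is_diff d1; near=> v.
  have cv : ci (conj v) = (p * ci v * p^-1)%g.
    by apply: chart_funK; near: v; exact: conj_chart_near.
  have e1 : A (H Y v) = chart_Ad c (p * ci v)%g Y := esym (chart_AdM ac c1 _ _ _).
  have e2 : H (A Y) (conj v) = chart_Ad c (ci (conj v) * p)%g Y := esym (chart_AdM ac c1 _ _ _).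
  apply: etrans e2 _; apply: etrans (esym e1); congr (chart_Ad c _ Y).
  by rewrite cv -mulgA mulVg mulg1.
by have [_ e'] := d2; have := congr1 (fun f => f X) (etrans (esym e') e).
Unshelve. all: by end_near. Qed.

Let H_derivative : exists xi : 'rV[R]_n -> 'rV[R]_n -> 'rV[R]_n,
  [/\ \forall u \near u0, linear (xi u),
      \forall u \near u0, forall Y, is_diff u (H Y) (fun w => br (xi u w) (H Y u)),
      forall w, {for u0, continuous (xi^~ w)} & xi u0 = id].
Proof.
have [xi [xiP cxi xi0]] := chart_Ad_derivative ac c1; exists xi; split => //.
  by apply: filterS xiP => u [].
by apply: filterS xiP => u [].
Qed.

Let H_strict Y e : 0 < e -> exists2 d, 0 < d & forall u v, `|u - u0| < d -> `|v - u0| < d ->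
  `|H Y u - H Y v - br (u - v) Y| <= e * `|u - v|.
Proof.
move=> e0; have [xi [lxi dxi cxi xi0]] := H_derivative.
have := @strict_of_derivative _ _ _ (H Y) (fun u w => br (xi u w) (H Y u)) u0.
rewrite xi0 Hu0; apply => //.
  near=> u; split; last by move: Y; near: u.
  have lu : linear (xi u) by near: u.
  by move=> k a b; rewrite lu br_linearl.
move=> w; have [C C0 brC] := mx_bilinear_bounded br_linearl br_linearr.
have cH : H Y u @[u --> u0] --> H Y u0.
  by have [dH _] := H_is_diff Y; exact: differentiable_continuous.
exact: (bilinear_cvg br_linearl br_linearr brC (cxi w) cH).
Unshelve. all: by end_near. Qed.

(** A linear test for membership in [I], see [lam_eq0]: being linear, it can be composed with [Ad]
    and differentiated. *)
Let lam (I : {vspace g}) Y := coords (tani Y - projv I (tani Y)).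

Let lam_linear I : linear (lam I).
Proof.
move=> k a b; rewrite /lam tani_linear linearP -coords_linear; congr coords.
by rewrite scalerBr opprD addrACA.
Qed.

Let lam_eq0 I Y : lam I Y = 0 <-> tani Y \in I.
Proof.
rewrite /lam -(linf0 coords_linear); split=> [/coords_inj/eqP|YI].
  by rewrite subr_eq0 => /eqP ->; exact: memv_proj.
by congr coords; rewrite projv_id // subrr.
Qed.

(** The function [lam U (Ad u y)] vanishes identically, hence so does its derivative at the
    identity, which is [lam U] of a bracket with [y]. *)
Lemma Ad_invariant_ideal (U : {vspace g}) :
  (forall p x, x \in U -> Ad L p x \in U) -> is_lie_ideal U.
Proof.
move=> AdU x y Uy; pose h := lam U \o H (tan y).
have dl : is_diff (H (tan y) u0) (lam U) (lam U) by exact: (mx_linear_is_diff (lam_linear U)).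
have dh := is_diff_comp (H_is_diff (tan y)) dl.
have h0 : h = cst 0.
  apply/funext => u; apply/(lam_eq0 U (H (tan y) u)).
  by rewrite /H -AdE; exact: AdU.
have [_ e] : is_diff u0 h 0 by rewrite h0; exact: is_diff_cst.
have : lam U (br (tan x) (tan y)) = 0.
  have [_ e'] := dh; have : (lam U \o br^~ (tan y)) = 0 by rewrite -e' -e.
  exact: (congr1 (fun f => f (tan x))).
by move/lam_eq0; rewrite brE tan_mapK.
Qed.

(** Uniqueness for a linear differential equation: [z], the class of [Ad u x - x] modulo [I],
    vanishes at [u0] and has derivative bounded by a multiple of [z]. Each use of the mean value
    bound halves the estimate of [z]. *)
Lemma Ad_central_near (I : {vspace g}) x : is_lie_ideal I -> (forall y, lie y x \in I) ->
  \forall u \near u0, Ad L (ci u) x - x \in I.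
Proof.
move=> idI xI; pose z u := lam I (H (tan x) u) - lam I (tan x).
pose B X (r : 'rV[R]_(\dim {:g})) := lam I (br X (tan (of_coords r))).
have of_lin : linear (@of_coords R g) by exact: passmx.vecof_linear.
have Bl r : linear (B^~ r) by move=> k a b; rewrite /B br_linearl lam_linear.
have Br X : linear (B X).
  by move=> k a b; rewrite /B of_lin linearP (br_linearr X) lam_linear.
have [C C0 BC] := mx_bilinear_bounded Bl Br.
(* Brackets with [x] and with elements of [I] vanish under [lam I], so the equation closes up on
   [z]. *)
have zE X u : lam I (br X (H (tan x) u)) = B X (z u).
  rewrite /z -(linfB (lam_linear I)) /B {2}/lam coordsK.
  set D := tani (_ - _).
  have -> : H (tan x) u = tan (D - projv I D) + tan (projv I D) + tan x.
    have -> : tan (D - projv I D) + tan (projv I D) = tan D by rewrite -linearD subrK.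
    by have -> : tan D = H (tan x) u - tan x; [exact: tan_mapVK|rewrite subrK].
  rewrite !(linfD (br_linearr X)) !(linfD (lam_linear I)).
  rewrite -{2 3}(tan_mapVK X) !brE.
  rewrite [X in _ + X + _](_ : _ = 0); last first.
    by apply/lam_eq0; rewrite tan_mapK; apply: idI; exact: memv_proj.
  by rewrite [X in _ + _ + X](_ : _ = 0) ?addr0 //; apply/lam_eq0; rewrite tan_mapK.
have [xi [lxi dxi cxi xi0]] := H_derivative.
have xi1 := linear_family_near lxi cxi ltr01.
have z0 : z u0 = 0 by rewrite /z Hu0 subrr.
have dz u : is_diff u (H (tan x)) (fun w => br (xi u w) (H (tan x) u)) ->
    is_diff u z (fun w => B (xi u w) (z u)).
  move=> dH; have dl : is_diff (H (tan x) u) (lam I) (lam I) by exact: (mx_linear_is_diff (lam_linear I)).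
  have d1 := is_diff_comp dH dl.
  apply: is_diff_eq (is_diffB d1 (is_diff_cst (lam I (tan x)) u)) _.
  by apply/funext => w; rewrite /= -zE; exact: subr0.
have z1 : \forall u \near u0, `|z u| <= 1.
  have [d _] := dz u0 (nbhs_singleton dxi (tan x)).
  have cz : z u @[u --> u0] --> z u0 by exact: differentiable_continuous.
  by move: cz; rewrite z0 => /cvgr0_norm_le; exact.
have [d d0 near0] := near_norm (filterI (filterI xi1 dxi) z1).
(* Near [u0] the operator [xi] at most doubles norms, and [2 * C * d1 <= 1/2] yields the halving. *)
pose d1 := Num.min d (4 * (C + 1))^-1.
have C10 : 0 < C + 1 by rewrite ltr_wpDl.
have d10 : 0 < d1 by rewrite lt_min d0 invr_gt0 mulr_gt0.
have d1d u : `|u - u0| < d1 -> `|u - u0| < d by move=> /lt_le_trans; apply; rewrite ge_min lexx.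
have zk k : forall u, `|u - u0| < d1 -> `|z u| <= 2^-1 ^+ k.
  elim: k => [|k IHk] u ud; first by have [_] := near0 _ (d1d _ ud).
  rewrite -[z u]subr0 -z0; have u00 : `|u0 - u0| < d1 by rewrite subrr normr0.
  apply: (@mean_value_bound _ _ _ z (fun t w => B (xi (u0 + t *: (u - u0)) w) (z (u0 + t *: (u - u0))))) => t t01.
    apply: dz; have [[_ +] _] := near0 _ (d1d _ (norm_segment t01 ud u00)); exact.
  have tu := norm_segment t01 ud u00; move: (u0 + _) tu => v vd.
  have [[xi2 _] _] := near0 _ (d1d _ vd).
  rewrite (le_trans (BC _ _)) // exprS.
  have xiv : `|xi v (u - u0)| <= 2 * d1.
    have -> : xi v (u - u0) = (xi v (u - u0) - xi u0 (u - u0)) + (u - u0) by rewrite xi0 subrK.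
    rewrite (le_trans (ler_normD _ _)) // mulrDl mul1r lerD //; last exact: ltW.
    by rewrite (le_trans (xi2 _)) // mul1r ltW.
  suff h1 : C * `|xi v (u - u0)| <= 2^-1.
    by apply: (ler_pM _ _ h1 (IHk _ vd)); rewrite ?normr_ge0 ?mulr_ge0.
  rewrite (le_trans (ler_wpM2l C0 xiv)) //.
  have : d1 <= (4 * (C + 1))^-1 by rewrite ge_min lexx orbT.
  rewrite -[leRHS]mul1r ler_pdivlMr ?mulr_gt0 // => h.
  have := mulr_ge0 C0 (ltW d10); nra.
have nd1 : \forall u \near u0, `|u - u0| < d1.
  by apply/nbhs_normP; exists d1 => // v; rewrite /ball_ /= distrC.
near=> u.
have zu : z u = 0.
  apply/eqP; rewrite -normr_le0; apply: le0_of_le_pow2 => k; apply: zk.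
  by near: u.
by move: zu; rewrite /z -(linfB (lam_linear I)) => /lam_eq0; rewrite (linfB tani_linear) /H -AdE tan_mapK.
Unshelve. all: by end_near. Qed.

(* Unification unfolds [Ad L p] down to a differential and diverges, so that
   from here on [Ad L] is replaced with a variable. *)
Lemma Ad_strict A : A = Ad L -> exists2 T : 'Hom('rV[R]_n, g), limg T = fullv &
  forall x e, 0 < e -> exists2 d, 0 < d & forall u v, `|u - u0| < d -> `|v - u0| < d ->
    `|coords (A (ci u) x) - coords (A (ci v) x) - coords (lie (T (u - v)) x)|
      <= e * `|u - v|.
Proof.
move=> AE; have {AE}AE' p x : A p x = tani (chart_Ad c p (tan x)) by rewrite AE; exact: AdE.
pose T : 'Hom('rV[R]_n, g) := linfun tani.
have TE u : T u = tani u by exact: (linfunE tani_linear).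
exists T.
  apply/eqP; rewrite eqEsubv subvf /=; apply/subvP => x _; apply/memv_imgP; exists (tan x); first exact: memvf.
  by rewrite TE tan_mapK.
move=> x e e0; pose Lam Y := coords (tani Y).
have lLam : linear Lam by move=> k a b; rewrite /Lam tani_linear coords_linear.
have [C C0 LamC] := mx_linear_bounded lLam.
have C10 : 0 < C + 1 by rewrite ltr_wpDl.
have [d d0 Hd] := H_strict (tan x) (divr_gt0 e0 C10).
have E1 w : Lam (H (tan x) w) = coords (A (ci w) x) := congr1 coords (esym (AE' _ _)).
have E2 w : Lam (br w (tan x)) = coords (lie (T w) x).
  by rewrite /Lam brE' !tan_mapK -TE.
have key a b d' : `|Lam a - Lam b - Lam d'| <= C * `|a - b - d'|.
  by rewrite -!(linfB lLam).
exists d => // u v ud vd.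
rewrite -(E1 u) -(E1 v) -(E2 (u - v)); apply: (le_trans (key _ _ _)).
rewrite (le_trans (ler_wpM2l C0 (Hd u v ud vd))) //.
by apply: ler_pdivD1 => //; exact: ltW.
Qed.

End Adjoint.

(** * The adjoint group and its action on quotients *)

Section AdjointGroup.
Context {R : realType} {n : nat} {G : lieGroupType R n} {g : lieAlgType R}.
Variable L : lie_algebra_of G g.
Variable A : G -> 'End(g).
Hypothesis AE : A = Ad L.

Lemma gAdM p q : A (p * q)%g = (A p \o A q)%VF. Proof. by rewrite AE; exact: AdM. Qed.

Lemma gAd1 : A 1%g = \1%VF. Proof. by rewrite AE; exact: Ad1. Qed.

Lemma gAdVK p x : A p^-1%g (A p x) = x. Proof. by rewrite AE; exact: AdVK. Qed.

Lemma gAd_lie p x y : A p (lie x y) = lie (A p x) (A p y).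
Proof. by rewrite AE; exact: Ad_lie. Qed.

(** The set [S] quantifies over all [x] central modulo [I], in particular over [I] itself; this
    gives stability of [I] and makes [S] a subgroup. *)
Lemma gAd_central (I : {vspace g}) : connected [set: G] -> is_lie_ideal I ->
  forall p x, (forall y, lie y x \in I) -> A p x - x \in I.
Proof.
move=> cG idI.
pose S := [set p : G | forall x, (forall y, lie y x \in I) -> A p x - x \in I].
have SI p x : S p -> x \in I -> A p x \in I.
  move=> Sp xI; rewrite -[A p x](subrK x) rpredD //.
  by apply: Sp => y; exact: idI.
suff ST : S = [set: G] by move=> p x; have : S p by [rewrite ST]; exact.
apply: (connected_subgroup cG).
- move=> a b Sa Sb x xI; rewrite gAdM comp_lfunE.
  have -> : A a (A b x) - x = A a (A b x - x) + (A a x - x).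
    by rewrite [A a (_ - _)]linearB addrA subrK.
  have h0 : A b x - x \in I := Sb x xI.
  have h1 := SI a _ Sa h0.
  have h2 := Sa x xI.
  exact: memvD h1 h2.
- move=> a Sa x xI.
  have aI : (A a @: I)%VS = I.
    apply/eqP; rewrite eqEdim; apply/andP; split.
      by apply/subvP => _ /memv_imgP[y yI ->]; exact: SI.
    rewrite limg_dim_eq //; apply/eqP; rewrite -subv0; apply/subvP => y.
    rewrite memv_cap memv_ker memv0 => /andP[_ /eqP y0].
    by rewrite -(gAdVK a y) y0 linear0.
  have : A a x - x \in (A a @: I)%VS by rewrite aI; exact: Sa.
  move=> /memv_imgP[y yI e].
  have -> : A a^-1%g x - x = - y.
    by rewrite -(gAdVK a y) -e linearB /= gAdVK opprB.
  by rewrite rpredN.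
(* The neighbourhood given by [Ad_central_near] depends on [x]; a basis of [W] reduces to finitely
   many of them. *)
- have [W WE] : exists W : {vspace g}, forall x, x \in W <-> forall y, lie y x \in I.
    apply: vspace_comprehension => [y|k u v uI vI y]; first by rewrite lie0r mem0v.
    by rewrite lie_is_linearr memvD // memvZ.
  have : nbhs (1%g : G) [set p | forall i : 'I_(\dim W), A p (vbasis W)`_i - (vbasis W)`_i \in I].
    have nI (i : 'I_(\dim W)) : \forall u \near chart_fun (tan_chart L) 1%g,
        A (chart_inv (tan_chart L) u) (vbasis W)`_i - (vbasis W)`_i \in I.
      rewrite AE; apply: (Ad_central_near L idI); apply/WE.
      by apply: vbasis_mem; rewrite mem_nth // size_tuple.
    exact: (chart_nbhs1 (tan_chart_one L) (filter_forall _ nI)).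
  apply: filterS => p pI x /WE /coord_vbasis ->.
  rewrite linear_sum -sumrB; apply: memv_suml => i _.
  by rewrite linearZ -scalerBr memvZ // pI.
Qed.

Lemma gAd_invariant_ideal (U : {vspace g}) :
  (forall p x, x \in U -> A p x \in U) -> is_lie_ideal U.
Proof. by rewrite AE; exact: Ad_invariant_ideal. Qed.

Let c := tan_chart L.
Let ci := chart_inv c.
Let u0 := chart_fun c 1%g.

Context {k : lieAlgType R} (pi : 'Hom(g, k)).
Hypothesis pi_surj : limg pi = fullv.
Hypothesis pi_lie : forall x y, pi (lie x y) = lie (pi x) (pi y).
Variable rho : G -> 'End(k).
Hypothesis rhoE : forall p x, rho p (pi x) = pi (A p x).

Let pi_lift y : exists x, y = pi x.
Proof.
have : y \in limg pi by rewrite pi_surj memvf.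
by move=> /memv_imgP[x _ ->]; exists x.
Qed.

Lemma rho1 : rho 1%g = \1%VF.
Proof. by apply/lfunP => y; have [x ->] := pi_lift y; rewrite rhoE gAd1 !id_lfunE. Qed.

Lemma rhoM p q : rho (p * q)%g = (rho p \o rho q)%VF.
Proof.
by apply/lfunP => y; have [x ->] := pi_lift y; rewrite comp_lfunE !rhoE gAdM comp_lfunE.
Qed.

Lemma rho_lie p x y : rho p (lie x y) = lie (rho p x) (rho p y).
Proof.
have [x' ->] := pi_lift x; have [y' ->] := pi_lift y.
by rewrite -pi_lie !rhoE gAd_lie pi_lie.
Qed.

(** Row [i] of the matrix is the image of a basis vector, which lifts to [g]; strict
    differentiability of [Ad] there is pushed forward by [pi], one row at a time. *)
Lemma rho_strict : exists2 T : 'Hom('rV[R]_n, k), limg T = fullv &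
  strict_diff (fun u => hmx (rho (ci u))) u0 (fun w => hmx (ad (T w))).
Proof.
have [T Tsurj TP] := Ad_strict AE; exists (pi \o T)%VF.
  by rewrite limg_comp Tsurj pi_surj.
have lpi : linear (mulmxr (hmx pi) : 'rV[R]_(\dim {:g}) -> 'rV[R]_(\dim {:k})) by exact: linearP.
have [C C0 piC] := mx_linear_bounded lpi.
have C10 : 0 < C + 1 by rewrite ltr_wpDl.
move=> e e0.
have near_i (i : 'I_(\dim {:k})) : \forall d \near 0^'+, forall u v, `|u - u0| < d -> `|v - u0| < d ->
    `|row i (hmx (rho (ci u)) - hmx (rho (ci v)) - hmx (ad ((pi \o T)%VF (u - v))))| <= e * `|u - v|.
  have [x ex] := pi_lift (of_coords (delta_mx 0 i)).
  have rowE' (B : 'End(k)) : row i (hmx B) = coords (B (pi x)).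
    by rewrite rowE -ex [coords _]rVof_hmx [passmx.rVof _ _]of_coordsK.
  have [d' d'0 d'P] := TP x _ (divr_gt0 e0 C10).
  near=> d => u v ud vd.
  have dd' : d < d' by near: d; exact: nbhs_right_lt.
  have h := d'P u v (lt_trans ud dd') (lt_trans vd dd').
  have -> : row i (hmx (rho (ci u)) - hmx (rho (ci v)) - hmx (ad ((pi \o T)%VF (u - v)))) =
      (coords (A (ci u) x) - coords (A (ci v) x) - coords (lie (T (u - v)) x)) *m hmx pi.
    have rowB (M N : 'M[R]_(\dim {:k})) : row i (M - N) = row i M - row i N by exact: linearB.
    rewrite !rowB !rowE' !rhoE adE comp_lfunE -pi_lie !mulmxBl.
    by rewrite /coords -!rVof_hmx.
  rewrite (le_trans (piC _)) //.
  rewrite (le_trans (ler_wpM2l C0 h)) //.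
  by apply: ler_pdivD1 => //; exact: ltW.
have near0 : \forall d \near 0^'+, 0 < d :> R by exact: nbhs_right_gt.
have FF : Filter ((0 : R)^'+) by exact _.
have nall := filter_forall FF near_i.
have nall0 := filterI near0 nall.
have [d [d0 dP]] := @filter_ex _ _ (at_right_proper_filter (0 : R)) _ (nall0 FF).
exists d => // u v ud vd; apply: mx_norm_le => [|i j]; first by rewrite mulr_ge0 // ltW.
have := dP i u v ud vd; apply: le_trans.
by have := mx_entry_le (row i (hmx (rho (ci u)) - hmx (rho (ci v)) - hmx (ad ((pi \o T)%VF (u - v))))) 0 j; rewrite [row _ _ _ _]mxE.
Unshelve. all: by end_near. Qed.

End AdjointGroup.

(** * Radical, quotients, compact and non-compact ideals *)

Section SolvableIdeals.
Context {K : fieldType} {g : lieAlgType K}.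
Implicit Types U W : {vspace g}.

Lemma derived_seriesS U W k : (U <= W)%VS -> (derived_series U k <= derived_series W k)%VS.
Proof. by move=> UW; elim: k => [|k IHk] //=; exact: lie_prodS. Qed.

Lemma derived_series_ideal U k : is_lie_ideal U -> is_lie_ideal (derived_series U k).
Proof. by move=> iU; elim: k => [|k IHk] //=; exact: lie_prod_ideal. Qed.

Lemma derived_seriesD U j k : derived_series U (j + k) = derived_series (derived_series U k) j.
Proof. exact: iterD. Qed.

(** The [k]-th derived algebra of [U + W] lies in that of [U] plus [W], so it enters [W] when the
    derived series of [U] ends. *)
Lemma addv_solvable U W : is_lie_ideal U -> is_lie_ideal W ->
  lie_solvable U -> lie_solvable W -> lie_solvable (U + W)%VS.
Proof.
move=> iU iW [k Uk] [j Wj]; exists (j + k)%N; rewrite derived_seriesD.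
suff /(_ k) : forall k, (derived_series (U + W) k <= derived_series U k + W)%VS.
  by rewrite Uk add0v => sW; apply/eqP; rewrite -subv0 -Wj derived_seriesS.
elim=> [|i IHk] //=.
apply: subv_trans (lie_prodS IHk IHk) _; apply/lie_prod_subP => a b.
move=> /memv_addP[u1 U1 [w1 W1 ->]] /memv_addP[u2 U2 [w2 W2 ->]].
rewrite lieDl !lieDr -addrA; apply: memv_add; first exact: memv_lie_prod.
by apply: memvD; [exact: iW|apply: memvD; [exact: ideal_lieP|exact: iW]].
Qed.

Lemma solvable_sub_radical U : is_lie_ideal U -> lie_solvable U -> (U <= radical g)%VS.
Proof. by move=> iU sU; apply: (vsupP _).1. Qed.

Lemma radical_solvable : lie_solvable (radical g : {vspace g}).
Proof.
pose Q n := `[< exists2 U : {vspace g}, is_lie_ideal U /\ lie_solvable U & \dim U = n >].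
have exQ : exists n, Q n.
  by exists 0%N; apply/asboolP; exists 0%VS; [split; [exact: ideal0|exists 0%N]|exact: dimv0].
have ubQ n : Q n -> (n <= \dim {:g})%N by move=> /asboolP[U _ <-]; rewrite dimvS // subvf.
case: (ex_maxnP exQ ubQ) => n /asboolP[U [iU sU] dU] maxn.
have sr : (radical g <= U)%VS.
  apply: (vsupP _).2 => W [iW sW].
  have dUW : (\dim (U + W) <= \dim U)%N.
    rewrite dU; apply: maxn; apply/asboolP; exists (U + W)%VS => //.
    by split; [exact: addv_ideal|exact: addv_solvable].
  have /eqP -> : (U == U + W)%VS by rewrite eqEdim addvSl.
  exact: addvSr.
have [k Uk] := sU; exists k.
by apply/eqP; rewrite -subv0 -Uk derived_seriesS.
Qed.

End SolvableIdeals.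

Section Homomorphisms.
Context {K : fieldType} {g h : lieAlgType K} (p : 'Hom(g, h)).
Hypothesis p_surj : limg p = fullv.
Hypothesis p_lie : forall x y, p (lie x y) = lie (p x) (p y).

Lemma surj_lift y : exists x, y = p x.
Proof.
have : y \in limg p by rewrite p_surj memvf.
by move=> /memv_imgP[x _ ->]; exists x.
Qed.

Lemma img_ideal U : is_lie_ideal U -> is_lie_ideal (p @: U)%VS.
Proof.
move=> iU y _ /memv_imgP[u Uu ->]; have [x ->] := surj_lift y.
by rewrite -p_lie memv_img // iU.
Qed.

Lemma img_derived_series U k : (derived_series (p @: U) k <= p @: derived_series U k)%VS.
Proof.
elim: k => [|k IHk] //=; apply: subv_trans (lie_prodS IHk IHk) _.
apply/lie_prod_subP => _ _ /memv_imgP[u Uu ->] /memv_imgP[v Vv ->].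
by rewrite -p_lie memv_img // memv_lie_prod.
Qed.

Lemma img_solvable U : lie_solvable U -> lie_solvable (p @: U)%VS.
Proof.
move=> [k Uk]; exists k; apply/eqP; rewrite -subv0.
by apply: subv_trans (img_derived_series U k) _; rewrite Uk limg0.
Qed.

(** The Killing form is not preserved by quotients in general; it is when [x] centralises the
    kernel, since [ad x] then factors through [p]. *)
Lemma kil_factor x y : (forall v, p v = 0 -> lie x v = 0) -> kil x y = kil (p x) (p y).
Proof.
move=> xk; apply: (@ltr_factor _ _ _ p) => // [|v pv].
  by apply/lfunP => v; rewrite !comp_lfunE !adE !p_lie.
by rewrite comp_lfunE !adE xk // p_lie pv lie0r.
Qed.

End Homomorphisms.

Lemma surj_factor {K : fieldType} {g h1 h2 : vectType K} (p1 : 'Hom(g, h1)) (p2 : 'Hom(g, h2)) :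
  limg p1 = fullv -> (forall x, p1 x = 0 -> p2 x = 0) ->
  exists p : 'Hom(h1, h2), forall x, p (p1 x) = p2 x.
Proof.
move=> s1 k12; exists (p2 \o p1^-1)%VF => x; rewrite comp_lfunE.
apply/eqP; rewrite -subr_eq0 -linearB; apply/eqP; apply: k12.
by rewrite linearB /= limg_lfunVK ?subrr // s1 memvf.
Qed.

Lemma lie_surj_factor {K : fieldType} {g h1 h2 : lieAlgType K}
    (p1 : 'Hom(g, h1)) (p2 : 'Hom(g, h2)) :
  limg p1 = fullv -> limg p2 = fullv ->
  (forall x y, p1 (lie x y) = lie (p1 x) (p1 y)) ->
  (forall x y, p2 (lie x y) = lie (p2 x) (p2 y)) ->
  (forall x, p1 x = 0 -> p2 x = 0) ->
  exists p : 'Hom(h1, h2), [/\ forall x, p (p1 x) = p2 x, limg p = fullv &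
    forall u v, p (lie u v) = lie (p u) (p v)].
Proof.
move=> s1 s2 l1 l2 /(surj_factor s1)[p pE]; exists p; split => // [|u v].
  apply/eqP; rewrite eqEsubv subvf /=; apply/subvP => v _.
  by have [u ->] := surj_lift s2 v; rewrite -pE memv_img // memvf.
have [u' ->] := surj_lift s1 u; have [v' ->] := surj_lift s1 v.
by rewrite -l1 !pE l2.
Qed.

Section Quotients.
Context {K : fieldType} {g : lieAlgType K}.

Lemma quot_map_limg (I : lie_ideal g) : limg (quot_map I) = fullv.
Proof.
apply/eqP; rewrite eqEsubv subvf /=; apply/subvP => a _.
by have [x <-] := quot_map_surj a; rewrite memv_img ?memvf.
Qed.

Lemma quot_map0 (I : lie_ideal g) x : quot_map I x = 0 <-> x \in (I : {vspace g}).
Proof. by rewrite -quot_map_eq0; split=> /eqP. Qed.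

Lemma semisimple_quot_abelian (I : {vspace lie_quot (radical g)}) :
  is_lie_ideal I -> lie_prod I I = 0%VS -> I = 0%VS.
Proof.
move=> iI I0; pose J := (quot_map (radical g) @^-1: I)%VS.
have iJ : is_lie_ideal J by exact: quot_preim_ideal.
have JJ : (lie_prod J J <= radical g)%VS.
  apply/lie_prod_subP => x y; rewrite -!memv_preim => xI yI.
  by apply/quot_map0; rewrite quot_map_lie; apply/eqP; rewrite -memv0 -I0 memv_lie_prod.
have sJ : lie_solvable J.
  have [k rk] := radical_solvable (g := g); exists (k + 1)%N; apply/eqP.
  by rewrite -subv0 -rk derived_seriesD derived_seriesS.
apply/eqP; rewrite -subv0; apply/subvP => y yI; rewrite memv0.
have [x xy] := quot_map_surj y; rewrite -xy quot_map_eq0.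
by apply: (subvP (solvable_sub_radical iJ sJ)); rewrite -memv_preim xy.
Qed.

End Quotients.

(** For an ideal, [ad x] maps [g] into [U], and cyclicity of the trace moves the inclusion of [U] to
    the other side. *)
Lemma killing_form_ideal {R : realType} {g : lieAlgType R} (U : {vspace g}) (x y : subvs_of U) :
  is_lie_ideal U -> killing_form x y = kil (vsval x) (vsval y).
Proof.
move=> iU; pose pr : 'Hom(g, subvs_of U) := linfun (vsproj U).
pose inc : 'Hom(subvs_of U, g) := linfun vsval.
have prK v : v \in U -> inc (pr v) = v by move=> Uv; rewrite !lfunE /= vsprojK.
pose adU (z : subvs_of U) : 'End(subvs_of U) :=
  linfun (fun w => vsproj U (lie (vsval z) (vsval w))).
have adUE z : adU z = (pr \o ad (vsval z) \o inc)%VF.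
  apply/lfunP => w; rewrite !comp_lfunE adE linfunE; first by rewrite !lfunE.
  by move=> a u v; rewrite linearP lie_is_linearr linearP.
transitivity (ltr (adU x \o adU y)%VF); first by [].
have -> : (adU x \o adU y)%VF = ((pr \o ad (vsval x) \o ad (vsval y)) \o inc)%VF.
  apply/lfunP => w; rewrite !adUE !comp_lfunE prK // adE ideal_lieP //; exact: subvsP.
rewrite ltr_comp; congr ltr; apply/lfunP => v.
by rewrite !comp_lfunE prK // adE ideal_lieP // subvsP.
Qed.

Section CompactIdeals.
Context {R : realType} {s : lieAlgType R}.
Hypothesis ss : forall I : {vspace s}, is_lie_ideal I -> lie_prod I I = 0%VS -> I = 0%VS.
Let N : {vspace s} := noncompact_ideals s.
Let iN : is_lie_ideal N := @idealP _ _ (noncompact_ideals s).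
Implicit Types a b I : {vspace s}.

Lemma compact_simple_kil a x : compact_simple a -> x \in a -> x != 0 -> kil x x < 0.
Proof.
move=> [[ia _ _] ca] ax x0; rewrite -(vsprojK ax) -killing_form_ideal //; apply: ca.
by apply: contra_neq x0 => x0; rewrite -(vsprojK ax) x0 linear0.
Qed.

Lemma noncompact_sub a : noncompact_simple a -> (a <= N)%VS.
Proof. by move=> na; apply: (vsupP _).1. Qed.

(** A compact and a non-compact simple ideal meet in 0, so [ad x] composed with [ad y] vanishes for
    [x] and [y] in them. *)
Lemma compact_sub_perp a : compact_simple a -> (a <= perp N)%VS.
Proof.
move=> ca; have [sa _] := ca; have [ia _ _] := sa.
have Na : (N <= perp a)%VS.
  apply: (vsupP _).2 => b nb; have [sb _] := nb; have [ib _ _] := sb.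
  have ab0 : (a :&: b)%VS = 0%VS.
    have iab := capv_ideal ia ib.
    case: (simple_ideal_minimal sa iab (capvSl _ _)) => // ea.
    case: (simple_ideal_minimal sb iab (capvSr _ _)) => // eb.
    by case: nb => _ []; rewrite -eb ea.
  apply/subvP => y yb; apply/perpP => x xa.
  rewrite /kil (_ : (_ \o _)%VF = 0) ?(linf0 ltr_linear) //.
  apply/lfunP => v; rewrite comp_lfunE !adE [RHS]lfunE /=; apply/eqP.
  rewrite -memv0 -ab0 memv_cap [X in X && _]ideal_lieP //=.
  by rewrite ib // ideal_lieP.
by apply/subvP => x ax; apply/perpP => y /(subvP Na)/perpP/(_ x ax); rewrite kilC.
Qed.

Let cap_perp (I a : {vspace s}) : is_lie_ideal I -> (a <= I)%VS -> (a <= perp I)%VS -> a = 0%VS.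
Proof.
by move=> iI aI aI'; apply/eqP; rewrite -subv0 -(ideal_cap_perp ss iI) subv_cap aI.
Qed.

(** A maximal negative definite ideal [D] in [perp N] is everything: otherwise its complement there
    contains a simple ideal, necessarily compact because it is orthogonal to [N], and adding it
    enlarges [D]. *)
Lemma perp_noncompact_negdef x : x \in perp N -> x != 0 -> kil x x < 0.
Proof.
pose P (D : {vspace s}) := [/\ is_lie_ideal D, (D <= perp N)%VS &
  forall x, x \in D -> x != 0 -> kil x x < 0].
pose Q n := `[< exists2 D, P D & \dim D = n >].
have exQ : exists n, Q n.
  exists 0%N; apply/asboolP; exists 0%VS; last exact: dimv0.
  by split=> [||y]; [exact: ideal0|exact: sub0v|rewrite memv0 => /eqP ->; rewrite eqxx].
have ubQ n : Q n -> (n <= \dim {:s})%N by move=> /asboolP[U _ <-]; rewrite dimvS // subvf.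
case: (ex_maxnP exQ ubQ) => n /asboolP[D [iD DN negD] dD] maxn.
have iE := capv_ideal (perp_ideal iN) (perp_ideal iD).
have E0 : (perp N :&: perp D)%VS = 0%VS.
  apply/eqP/negPn/negP => /(exists_simple_ideal ss iE)[e se].
  rewrite subv_cap => /andP[eN eD]; have [ie _ _] := se.
  have ce : compact_simple e.
    apply: contrapT => nce; have /eqP[] := simple_ideal_neq0 se.
    by apply: (cap_perp iN) => //; apply: noncompact_sub.
  have : (\dim (D + e) <= n)%N.
    apply: maxn; apply/asboolP; exists (D + e)%VS => //; split.
    - exact: addv_ideal.
    - by rewrite subv_add DN.
    - move=> _ /memv_addP[d Dd [y ey ->]] dy0.
      have dy : kil d y = 0 by apply: (perpP _ _ (subvP eD _ ey)).
      rewrite (linfD (kil_linearl _)) !(linfD (kil_linearr _)) (kilC y) dy addr0 add0r.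
      have [d0|d0] := eqVneq d 0.
        rewrite d0 (linf0 (kil_linearl _)) add0r (compact_simple_kil ce) //.
        by apply: contra_neq dy0 => ->; rewrite d0 addr0.
      have [->|y0] := eqVneq y 0; first by rewrite (linf0 (kil_linearl _)) addr0 negD.
      have := compact_simple_kil ce ey y0; have := negD _ Dd d0; lra.
  rewrite -dD => dDe; have /eqP eDe : (D == D + e)%VS by rewrite eqEdim addvSl.
  have /eqP[] := simple_ideal_neq0 se.
  by apply: (cap_perp iD) => //; rewrite eDe addvSr.
move=> xN; apply: negD.
have /memv_addP[d Dd [v pv e]] : x \in (D + perp D)%VS by rewrite ideal_add_perp // memvf.
suff v0 : v = 0 by rewrite e v0 addr0.
apply/eqP; rewrite -memv0 -E0 memv_cap pv andbT.
have -> : v = x - d by rewrite e addrC addKr.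
by rewrite memvB // (subvP DN).
Qed.

(** A simple ideal orthogonal to both sums would be contained in one of them. *)
Lemma compact_ideals_perp : compact_ideals s = perp N.
Proof.
have iC : is_lie_ideal (compact_ideals s) by apply: vsup_is_ideal => U [[]].
apply/eqP; rewrite eqEsubv; apply/andP; split.
  by apply: (vsupP _).2 => a; exact: compact_sub_perp.
have iE := capv_ideal (perp_ideal iN) (perp_ideal iC).
have E0 : (perp N :&: perp (compact_ideals s))%VS = 0%VS.
  apply/eqP/negPn/negP => /(exists_simple_ideal ss iE)[e se].
  rewrite subv_cap => /andP[eN eC]; have /eqP[] := simple_ideal_neq0 se.
  have [ce|nce] := pselect (compact_simple e).
    by apply: (cap_perp iC) => //; apply: (vsupP _).1.
  by apply: (cap_perp iN) => //; apply: noncompact_sub.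
have CN : (compact_ideals s <= perp N)%VS by apply: (vsupP _).2 => a; exact: compact_sub_perp.
apply/subvP => x xN.
have /memv_addP[d Dd [v pv e]] : x \in (compact_ideals s + perp (compact_ideals s))%VS.
  by rewrite ideal_add_perp // memvf.
suff v0 : v = 0 by rewrite e v0 addr0.
apply/eqP; rewrite -memv0 -E0 memv_cap pv andbT.
have -> : v = x - d by rewrite e addrC addKr.
by rewrite memvB // (subvP CN).
Qed.

End CompactIdeals.

(** * Inner automorphisms of a compact Lie algebra *)

Section GramMatrix.
Context {R : realType} {n : nat}.

Lemma gram_form (B : 'rV[R]_n -> 'rV[R]_n -> R^o) :
  (forall v, linear (B^~ v)) -> (forall u, linear (B u)) -> forall x y,
  (x *m (\matrix_(i, j) B (delta_mx 0 i) (delta_mx 0 j)) *m y^T) 0 0 = B x y.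
Proof.
move=> Bl Br x y; rewrite {2}(row_sum_delta y) (linf_sum (Br x)) mxE.
apply: eq_bigr => j _; rewrite (linfZ (Br x)) mulrC mxE; congr (_ * _).
rewrite mxE {2}(row_sum_delta x) (linf_sum (Bl _)); apply: eq_bigr => i _.
by rewrite (linfZ (Bl _)) mxE.
Qed.

Lemma gram_inj (M N : 'M[R]_n) :
  (forall x y : 'rV_n, (x *m M *m y^T) 0 0 = (x *m N *m y^T) 0 0) -> M = N.
Proof.
move=> MN; apply/matrixP => i j; have := MN (delta_mx 0 i) (delta_mx 0 j).
by rewrite -!rowE trmx_delta -!colE !mxE.
Qed.

End GramMatrix.

(** The first hypothesis is adherence of [p] to [A] in the form in which [closedE] delivers it. *)
Lemma frequently_eq0 {R : realType} {V : topologicalType} {W : normedModType R} (A : set V)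
    (p : V) (f : V -> W) :
  ~ (\forall x \near p, ~ A x) -> {for p, continuous f} -> (forall x, A x -> f x = 0) -> f p = 0.
Proof.
move=> Ap cf fA; apply: contrapT => /eqP fp; apply: Ap.
have cfp : f x @[x --> p] --> f p by exact: cf.
have nf : \forall x \near p, f x != 0 by exact: (cvgr_neq0 _ cfp fp).
by apply: filterS nf => x /eqP fx /fA.
Qed.

Section MatrixExponentials.
Context {R : realType} {q : lieAlgType R}.
Let m := \dim {:q}.

Definition lie_br (u v : 'rV[R]_m) : 'rV[R]_m := coords (lie (of_coords u) (of_coords v)).

Lemma of_coords_linear : linear (@of_coords R q).
Proof. exact: passmx.vecof_linear. Qed.

Lemma lie_brl v : linear (lie_br^~ v).
Proof. by move=> a x y; rewrite /lie_br of_coords_linear lie_is_linearl coords_linear. Qed.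

Lemma lie_brr u : linear (lie_br u).
Proof. by move=> a x y; rewrite /lie_br of_coords_linear lie_is_linearr coords_linear. Qed.

Lemma coords_mulmx (a : 'End(q)) x : coords x *m hmx a = coords (a x).
Proof. by rewrite /coords rVof_hmx. Qed.

Lemma mulmx_coords (a : 'End(q)) (u : 'rV[R]_m) : u *m hmx a = coords (a (of_coords u)).
Proof. by rewrite -coords_mulmx of_coordsK. Qed.

Lemma br_hom_hmx (a : 'End(q)) :
  br_hom lie_br (hmx a) <-> forall x y, lie (a x) (a y) = a (lie x y).
Proof.
split=> [ha x y|ha u v]; last first.
  by rewrite /lie_br !mulmx_coords !coordsK ha.
have := ha (coords x) (coords y); rewrite /lie_br !coords_mulmx !coordsK.
exact: coords_inj.
Qed.

Lemma br_der_hmx (D : 'End(q)) :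
  br_der lie_br (hmx D) -> forall x y, D (lie x y) = lie (D x) y + lie x (D y).
Proof.
move=> hD x y; have := hD (coords x) (coords y).
rewrite /lie_br !coords_mulmx !coordsK -(linfD coords_linear).
exact: coords_inj.
Qed.

Lemma is_expP (A E : 'End(q)) : is_exp A E <-> hmx E = expm (hmx A).
Proof.
have itE v k : coords (iter k A v) = coords v *m hmx A ^+ k.
  elim: k => [|k IHk]; first by rewrite expr0 mulmx1.
  by rewrite exprSr mulmxA -IHk coords_mulmx.
have cv v : series (fun k => (k`!%:R : R)^-1 *: coords (iter k A v)) @ \oo -->
    coords v *m expm (hmx A).
  have lv : linear (mulmx (coords v) : 'M[R]_m -> 'rV[R]_m) by exact: linearP.
  rewrite (_ : series _ = mulmx (coords v) \o series (exp_term (hmx A))); last first.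
    apply/funext => N; rewrite /series /= mulmx_sumr; apply: eq_bigr => k _.
    by rewrite itE /exp_term -scalemxAr.
  apply: continuous_cvg; first exact: (mx_linear_continuous lv).
  exact: expm_cvg.
split=> [eE|eE v]; last by rewrite -coords_mulmx eE.
apply/row_matrixP => i; rewrite !rowE.
have := cv (of_coords (delta_mx 0 i)) => c1; have c2 := eE (of_coords (delta_mx 0 i)).
rewrite of_coordsK in c1; rewrite mulmx_coords.
exact: cvg_unique c2 c1.
Qed.

Lemma exp_ad x : exists2 e : 'End(q), is_exp (ad x) e & hmx e = expm (hmx (ad x)).
Proof.
by have [e he] := hmx_surj (expm (hmx (ad x))); exists e => //; apply/is_expP.
Qed.

Lemma ad_br_der x : br_der lie_br (hmx (ad x)).
Proof.
move=> u v; rewrite /lie_br !mulmx_coords !coordsK !adE -(linfD coords_linear).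
by congr coords; rewrite lie_leibniz.
Qed.

Lemma hmx_ad_linear : linear (fun x : q => hmx (ad x)).
Proof. by move=> a x y; rewrite ad_is_linear hmx_linear. Qed.

Lemma expmK (X : 'M[R]_m) : expm X *m expm (- X) = 1%:M.
Proof. by rewrite -expmD_comm ?subrr ?expm0 // mulmxN mulNmx. Qed.

(** [a^-1] is an inverse only once [a] is known to be injective; [inverse_pairV] converts. *)
Definition inverse_pair (a b : 'End(q)) := (a \o b = \1)%VF /\ (b \o a = \1)%VF.

Lemma exp_ad_inverse x e : is_exp (ad x) e ->
  exists2 e', is_exp (ad (- x)) e' & inverse_pair e e'.
Proof.
move=> /is_expP eE; have [e' xe' eE'] := exp_ad (- x); exists e' => //.
rewrite (linfN hmx_ad_linear) in eE'.
split; apply: hmx_inj; rewrite hmx_comp hmx1 eE eE'; last exact: expmK.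
by rewrite -{2}(opprK (hmx (ad x))) expmK.
Qed.

Lemma inner_exp x e : is_exp (ad x) e -> @inner_aut R q e.
Proof. by move=> xe; rewrite -(comp_lfun1r e); apply: inner_autM xe _; exact: inner_aut1. Qed.

Lemma inner_aut_comp (a b : 'End(q)) : inner_aut a -> inner_aut b -> inner_aut (a \o b)%VF.
Proof.
move=> ia ib; elim: ia => [|x e a' xe _ IHa]; first by rewrite comp_lfun1l.
by rewrite -comp_lfunA; exact: inner_autM xe IHa.
Qed.

Lemma inner_aut_inv (a : 'End(q)) : inner_aut a -> exists2 b, inner_aut b & inverse_pair a b.
Proof.
elim=> [|x e a' xe _ [b ib [ab ba]]].
  by exists \1%VF; [exact: inner_aut1|split; rewrite comp_lfun1l].
have [e' xe' [ee' e'e]] := exp_ad_inverse xe; exists (b \o e')%VF.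
  by apply: inner_aut_comp ib _; exact: inner_exp xe'.
split; first by rewrite comp_lfunA -(comp_lfunA e) ab comp_lfun1r.
by rewrite comp_lfunA -(comp_lfunA b) e'e comp_lfun1r.
Qed.

Lemma inner_aut_lie (a : 'End(q)) : inner_aut a -> forall x y, lie (a x) (a y) = a (lie x y).
Proof.
elim=> [|z e a' /is_expP ze _ IHa] x y; first by rewrite !id_lfunE.
rewrite !comp_lfunE -IHa; apply: (br_hom_hmx e).1; rewrite ze.
by apply: expm_br_hom; [exact: lie_brl|exact: lie_brr|exact: ad_br_der].
Qed.

End MatrixExponentials.

Section CompactAlgebra.
Context {R : realType} {q : lieAlgType R}.
Hypothesis negdef : forall x : q, x != 0 -> kil x x < 0.
Let m := \dim {:q}.
Let of_lin := @of_coords_linear R q.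

Let kil_nondeg (x : q) : (forall y, kil x y = 0) -> x = 0.
Proof.
move=> x0; apply/eqP/negPn/negP => /negdef; by rewrite x0 ltxx.
Qed.

(** Nondegeneracy provides [x] with [kil x y] equal to the trace of [D \o ad y]. For [E := D - ad x]
    the number [kil (E y) z] is the trace of [E \o ad (lie y z)], which is 0, so [E] vanishes. *)
Lemma derivation_inner (D : 'End(q)) :
  (forall x y, D (lie x y) = lie (D x) y + lie x (D y)) -> exists x, D = ad x.
Proof.
move=> derD; pose e (i : 'I_m) : q := of_coords (delta_mx 0 i).
pose k x : q := of_coords (\row_i kil x (e i)).
have lk : linear k.
  move=> a x y; rewrite /k -of_lin; congr of_coords.
  by apply/rowP => i; rewrite !mxE kil_linearl.
have sum_e y : y = \sum_i coords y 0 i *: e i.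
  rewrite -{1}(coordsK y) {1}(row_sum_delta (coords y)) (linf_sum of_lin).
  by apply: eq_bigr => i _; rewrite (linfZ of_lin).
pose K := linfun k.
have K0 : lker K == 0%VS.
  rewrite -subv0; apply/subvP => x; rewrite memv_ker memv0 (linfunE lk) => /eqP kx0.
  apply/eqP/kil_nondeg => y; rewrite (sum_e y) (linf_sum (kil_linearr x)) big1 // => i _.
  rewrite (linfZ (kil_linearr x)); have := congr1 coords kx0.
  rewrite /k of_coordsK (linf0 coords_linear) => /rowP/(_ i); rewrite !mxE => ->.
  exact: scaler0.
pose t y := ltr (D \o ad y)%VF.
have lt : linear (t : q -> R^o).
  by move=> a x y; rewrite /t ad_is_linear comp_lfunDr -comp_lfunZr; exact: ltr_linear.
have [x xt] : exists x, forall y, kil x y = t y.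
  exists ((K^-1)%VF (of_coords (\row_i t (e i)))) => y; set x := (K^-1)%VF _.
  have : K x = of_coords (\row_i t (e i)) by rewrite lker0_lfunVK.
  rewrite (linfunE lk) => /(congr1 coords); rewrite !of_coordsK => /rowP xe.
  rewrite (sum_e y) (linf_sum (kil_linearr x)) (linf_sum lt); apply: eq_bigr => i _.
  by rewrite (linfZ (kil_linearr x)) (linfZ lt); have := xe i; rewrite !mxE => ->.
exists x; pose E := (D - ad x)%VF.
have EE y : E y = D y - lie x y by rewrite /E add_lfunE opp_lfunE adE.
have derE y z : E (lie y z) = lie (E y) z + lie y (E z).
  rewrite !EE derD lie_leibniz lieBr lieDl lieNl opprD !addrA; congr (_ - _).
  by rewrite addrAC.
have trE y : ltr (E \o ad y)%VF = 0.
  by rewrite /E comp_lfunDl comp_lfunNl (linfB ltr_linear) -/(t y) -xt subrr.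
have adEE y : ad (E y) = ((E \o ad y) - (ad y \o E))%VF.
  apply/lfunP => z; rewrite add_lfunE opp_lfunE !comp_lfunE !adE derE.
  by rewrite addrK.
apply/eqP; rewrite -subr_eq0; apply/eqP; rewrite -/E.
apply/lfunP => y; rewrite [RHS]lfunE /=; apply: kil_nondeg => z.
rewrite /kil adEE comp_lfunDl comp_lfunNl (linfB ltr_linear).
rewrite -!comp_lfunA [X in _ - X]ltr_comp -comp_lfunA -(linfB ltr_linear).
by rewrite -comp_lfunNr -comp_lfunDr -ad_lie trE.
Qed.

Let S : 'M[R]_m := \matrix_(i, j) - kil (of_coords (delta_mx 0 i)) (of_coords (delta_mx 0 j) : q).

Let SE (x y : 'rV[R]_m) : (x *m S *m y^T) 0 0 = - kil (of_coords x) (of_coords y : q).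
Proof.
apply: (@gram_form R m (fun x y => - kil (of_coords x) (of_coords y))) => [v|u] a u1 u2.
  by rewrite of_lin kil_linearl opprD scalerN.
by rewrite of_lin kil_linearr opprD scalerN.
Qed.

Let S_sym : S^T = S.
Proof. by apply/matrixP => i j; rewrite !mxE kilC. Qed.

Let S_pos (x : 'rV[R]_m) : x != 0 -> 0 < (x *m S *m x^T) 0 0.
Proof.
move=> x0; rewrite SE oppr_gt0 negdef //; apply: contra_neq x0 => x0.
by rewrite -(of_coordsK x) x0 (linf0 coords_linear).
Qed.

Let kil_aut (a b : 'End(q)) x y : inverse_pair a b ->
  (forall x y, lie (a x) (a y) = a (lie x y)) -> kil (a x) (a y) = kil x y.
Proof.
move=> [ab ba] ha.
have abK z : a (b z) = z by rewrite -comp_lfunE ab id_lfunE.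
have adaE z : ad (a z) = (a \o ad z \o b)%VF.
  by apply/lfunP => w; rewrite !comp_lfunE !adE -ha abK.
rewrite /kil !adaE -!comp_lfunA ltr_comp !comp_lfunA.
rewrite -(comp_lfunA _ b a) ba comp_lfun1r -(comp_lfunA _ b a) ba comp_lfun1r.
by [].
Qed.

Let S_inner (a : 'End(q)) : inner_aut a -> hmx a *m S *m (hmx a)^T = S.
Proof.
move=> ia; have [b _ ab] := inner_aut_inv ia; apply: gram_inj => x y.
rewrite SE; have -> : x *m (hmx a *m S *m (hmx a)^T) *m y^T = (x *m hmx a) *m S *m (y *m hmx a)^T.
  by rewrite trmx_mul !mulmxA.
by rewrite SE !mulmx_coords !coordsK (kil_aut _ _ ab) //; exact: inner_aut_lie.
Qed.

(** [hom_local_surj] for the exponential of [ad]: its linear part covers all derivations, as they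
    are inner. *)
Lemma near_identity_inner : exists2 e, 0 < e & forall phi, br_hom (@lie_br R q) phi ->
  `|phi - 1%:M| < e -> exists2 a : 'End(q), inner_aut a & hmx a = phi.
Proof.
have lF : linear (fun u : 'rV[R]_m => hmx (ad (of_coords u : q))).
  by move=> a u v; rewrite of_lin hmx_ad_linear.
pose F (u : 'rV[R]_m) := expm (hmx (ad (of_coords u : q))).
have [C C0 FC] := mx_linear_bounded lF; have C10 : 0 < C + 1 by rewrite ltr_wpDl.
have [||||e e0 eP] := @hom_local_surj R m _ (@lie_brl R q) (@lie_brr R q) m F 0 (linfun (fun u : 'rV[R]_m => hmx (ad (of_coords u : q)))).
- move=> e e0; have [d d0 dP] := expm_strict (m := m) (divr_gt0 e0 C10).
  exists (d / (C + 1)); first exact: divr_gt0.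
  have small w : `|w| < d / (C + 1) -> `|hmx (ad (of_coords w : q))| < d.
    move=> wd; rewrite (le_lt_trans (FC w)) //.
    rewrite (@le_lt_trans _ _ ((C + 1) * `|w|)) ?ler_wpM2r ?lerDl //.
    by rewrite mulrC -ltr_pdivlMr.
  move=> u v; rewrite !subr0 => ud vd; rewrite (linfunE lF) (linfB lF).
  rewrite (le_trans (dP _ _ (small _ ud) (small _ vd))) // -(linfB lF).
  have e'0 : 0 <= e / (C + 1) by rewrite ltW // divr_gt0.
  rewrite (le_trans (ler_wpM2l e'0 (FC _))) //.
  by rewrite mulrCA ler_pdivD1 // ltW.
- by rewrite /F (linf0 lF) expm0.
- exists 1 => // u _; split.
    by apply: expm_br_hom; [exact: lie_brl|exact: lie_brr|exact: ad_br_der].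
  by have [] := mulmx1_unit (expmK (hmx (ad (of_coords u : q)))).
- move=> D hD; have [D' D'E] := hmx_surj D; rewrite -D'E in hD *.
  have [x ->] := derivation_inner (br_der_hmx hD).
  apply/memv_imgP; exists (coords x); first exact: memvf.
  by rewrite (linfunE lF) coordsK.
exists e => // phi hphi phi1; have [u ->] := eP _ hphi phi1.
by have [a xa ha] := exp_ad (of_coords u : q); exists a => //; exact: inner_exp xa.
Qed.

Let inner_bounded : exists2 C, 0 <= C & forall a : 'End(q), inner_aut a -> `|hmx a| <= C.
Proof.
have [C CP] := isometry_bounded S_sym S_pos.
exists `|C| => // a ia; apply: le_trans (ler_norm C).
by apply: CP; exact: S_inner.
Qed.

(** Flattening by [mxvec] brings the set into a space of row vectors, where bounded closed sets are
    compact. A limit [M] is an automorphism; multiplied by the inverse of a nearby inner one it is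
    close to 1, hence inner. *)
Lemma inner_compact : compact [set mxvec (hmx a) | a in @inner_aut R q].
Proof.
have [C C0 CP] := inner_bounded.
apply: bounded_closed_compact.
  exists C; split; first exact: num_real.
  move=> x Cx _ [a ia <-]; apply: (@le_trans _ _ C); last exact: ltW.
  apply: mx_norm_le => // i j; rewrite ord1; case/mxvec_indexP: j => k l.
  by rewrite mxvecE (le_trans (mx_entry_le _ _ _)) // CP.
rewrite closedE => p Ap; pose M : 'M[R]_m := vec_mx p.
have lvec : linear (vec_mx : 'rV[R]_(m * m) -> 'M[R]_m) by exact: linearP.
have cvec := mx_linear_continuous lvec.
have Mhom : br_hom (@lie_br R q) M.
  move=> u v; apply/eqP; rewrite -subr_eq0; apply/eqP; rewrite /M.
  have lu (w : 'rV[R]_m) : linear (fun p : 'rV[R]_(m * m) => w *m (vec_mx p : 'M[R]_m)).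
    by move=> k x y; rewrite lvec mulmxDr scalemxAr.
  apply: (frequently_eq0 (f := fun p => lie_br (u *m vec_mx p) (v *m vec_mx p) - lie_br u v *m vec_mx p) Ap).
    have [C' C'0 brC] := mx_bilinear_bounded (@lie_brl R q) (@lie_brr R q).
    have cu : u *m (vec_mx x : 'M[R]_m) @[x --> p] --> u *m M by exact: (mx_linear_continuous (lu u)).
    have cv : v *m (vec_mx x : 'M[R]_m) @[x --> p] --> v *m M by exact: (mx_linear_continuous (lu v)).
    have cuv := bilinear_cvg (@lie_brl R q) (@lie_brr R q) brC cu cv.
    have cw : lie_br u v *m (vec_mx x : 'M[R]_m) @[x --> p] --> lie_br u v *m M.
      exact: (mx_linear_continuous (lu _)).
    exact: (cvgB (cuv (nbhs_filter p)) cw).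
  move=> _ [a ia <-]; rewrite mxvecK; apply/eqP; rewrite subr_eq0; apply/eqP.
  by apply: (br_hom_hmx a).2; exact: inner_aut_lie.
have [e e0 eP] := near_identity_inner.
have C10 : 0 < m%:R * C + 1 by rewrite ltr_wpDl ?mulr_ge0.
(* The factor [m%:R * C + 1] bounds the effect of multiplying by [hmx b], so that [M *m hmx b] lands
   within [e] of the identity. *)
have [a ia aM] : exists2 a : 'End(q), inner_aut a & `|M - hmx a| < e / (m%:R * C + 1).
  apply: contrapT => na; apply: Ap.
  have /cvgrPdist_lt/(_ _ (divr_gt0 e0 C10)) : vec_mx x @[x --> p] --> M by exact: cvec.
  apply: filterS => x xM [a ia ax]; apply: na; exists a => //.
  by rewrite -[hmx a]mxvecK ax.
have [b ib [ab ba]] := inner_aut_inv ia.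
have hba : hmx b *m hmx a = 1%:M by rewrite -hmx_comp ab hmx1.
have hab : hmx a *m hmx b = 1%:M by rewrite -hmx_comp ba hmx1.
have [||c ic cE] := eP (M *m hmx b).
- by apply: br_homM => //; apply: (br_hom_hmx b).2; exact: inner_aut_lie.
- rewrite -hab -mulmxBl (le_lt_trans (mulmx_norm _ _)) //.
  rewrite (@le_lt_trans _ _ ((m%:R * C + 1) * `|M - hmx a|)) //; last first.
    by rewrite mulrC -ltr_pdivlMr.
  rewrite -mulrA [`|_| * `|_|]mulrC mulrA ler_wpM2r //.
  by rewrite (@le_trans _ _ (m%:R * C)) ?ler_wpM2l ?CP // lerDl.
exists (a \o c)%VF; first exact: inner_aut_comp.
by rewrite hmx_comp cE -mulmxA hba mulmx1 /M vec_mxK.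
Qed.

End CompactAlgebra.

Lemma inverse_pairV {R : realType} {q : lieAlgType R} (a b : 'End(q)) :
  inverse_pair a b -> (a^-1)%VF = b.
Proof.
move=> [ab ba]; have ka : lker a == 0%VS.
  rewrite -subv0; apply/subvP => v; rewrite memv_ker memv0 => /eqP av.
  by rewrite -[v]id_lfunE -ba comp_lfunE av linear0.
by rewrite -[LHS]comp_lfun1r -ab comp_lfunA lker0_compVf // comp_lfun1l.
Qed.

(** * The image of the group on a compact semisimple quotient *)

Section AdjointImage.
Context {R : realType} {n : nat} {G : lieGroupType R n} {g : lieAlgType R}.
Variable L : lie_algebra_of G g.
Hypothesis cG : connected [set: G].
Variable A : G -> 'End(g).
Hypothesis AE : A = Ad L.
Context {q : lieAlgType R} (pi : 'Hom(g, q)).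
Hypothesis pi_surj : limg pi = fullv.
Hypothesis pi_lie : forall x y, pi (lie x y) = lie (pi x) (pi y).
Variable rho : G -> 'End(q).
Hypothesis rhoE : forall p x, rho p (pi x) = pi (A p x).
Hypothesis negdef : forall x : q, x != 0 -> kil x x < 0.

Let m := \dim {:q}.
Let c := tan_chart L.
Let ci := chart_inv c.
Let u0 := chart_fun c 1%g.
Let F u := hmx (rho (ci u)).

Let rM p r : rho (p * r)%g = (rho p \o rho r)%VF. Proof. exact: (rhoM AE pi_surj rhoE). Qed.
Let r1 : rho 1%g = \1%VF. Proof. exact: (rho1 AE pi_surj rhoE). Qed.

Let rV p : inverse_pair (rho p) (rho p^-1%g).
Proof. by split; rewrite -rM ?mulgV ?mulVg r1. Qed.

Let F0 : F u0 = 1%:M.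
Proof. by rewrite /F /u0 /ci chart_funK ?r1 ?hmx1 //; exact: tan_chart_one. Qed.

Let rho_hom p : br_hom (@lie_br R q) (hmx (rho p)).
Proof.
by apply: (br_hom_hmx _).2 => x y; rewrite (rho_lie AE pi_surj pi_lie rhoE).
Qed.

Let rho_unit p : hmx (rho p) \in unitmx.
Proof.
have [h _] := rV p; have := hmx_comp (rho p) (rho p^-1%g); rewrite h hmx1.
by move=> /esym/mulmx1_unit[].
Qed.

Let F_strict : exists2 T : 'Hom('rV[R]_n, q), limg T = fullv &
  strict_diff F u0 (fun w => hmx (ad (T w))).
Proof. exact: (rho_strict AE pi_surj pi_lie rhoE). Qed.

Let lin_adT (T : 'Hom('rV[R]_n, q)) : linear (fun w => hmx (ad (T w))).
Proof. by move=> a x y; rewrite linearP hmx_ad_linear. Qed.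

(** Strict differentiability places [rho] close to 1 near the identity of [G], where
    [near_identity_inner] applies; connectedness does the rest. *)
Lemma rho_inner p : inner_aut (rho p).
Proof.
pose S := [set p : G | inner_aut (rho p)].
suff ST : S = [set: G] by have : S p by rewrite ST.
apply: (connected_subgroup cG).
- by move=> a b Sa Sb; rewrite /S /= rM; exact: inner_aut_comp.
- move=> a /inner_aut_inv[b ib ab]; rewrite /S /=.
  by rewrite -(inverse_pairV (rV a)) (inverse_pairV ab).
- have [e e0 eP] := near_identity_inner negdef.
  have [T _ sT] := F_strict; have [d d0 dP] := sT 1 ltr01.
  have [C C0 CP] := mx_linear_bounded (lin_adT T).
  have C10 : 0 < C + 1 by rewrite ltr_wpDl.
  have nI : \forall u \near u0, inner_aut (rho (ci u)).
    apply/nbhs_normP; exists (Num.min d (e / (C + 1))).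
      by rewrite /= lt_min d0 divr_gt0.
    move=> u; rewrite /ball_ /= distrC lt_min => /andP[ud ue].
    have [|a ia ha] := eP _ (rho_hom (ci u)).
      rewrite -F0 -/(F u) -(subrK (hmx (ad (T (u - u0)))) (_ - _)).
      have u00 : `|u0 - u0| < d by rewrite subrr normr0.
      rewrite (le_lt_trans (ler_normD _ _)) //.
      rewrite (@le_lt_trans _ _ ((C + 1) * `|u - u0|)) //; last by rewrite mulrC -ltr_pdivlMr.
      by rewrite mulrDl addrC lerD // ?dP // CP.
    by rewrite -(hmx_inj ha).
  exact: (chart_nbhs1 (tan_chart_one L) nI).
Qed.

Let local_surj : exists2 e, 0 < e & forall phi, br_hom (@lie_br R q) phi ->
  `|phi - 1%:M| < e -> exists p, phi = hmx (rho p).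
Proof.
have [T Tsurj sT] := F_strict.
have [||||e e0 eP] := @hom_local_surj R m _ (@lie_brl R q) (@lie_brr R q) n F u0 (linfun (fun w => hmx (ad (T w)))).
- move=> e e0; have [d d0 dP] := sT e e0; exists d => // u v ud vd.
  by rewrite (linfunE (lin_adT T)) dP.
- exact: F0.
- by exists 1 => // u _; split; [exact: rho_hom|exact: rho_unit].
- move=> D hD; have [D' D'E] := hmx_surj D; rewrite -D'E in hD *.
  have [x ->] := derivation_inner negdef (br_der_hmx hD).
  have : x \in limg T by rewrite Tsurj memvf.
  move=> /memv_imgP[w _ ->]; apply/memv_imgP; exists w; first exact: memvf.
  by rewrite (linfunE (lin_adT T)).
- by exists e => // phi h1 h2; have [u ->] := eP _ h1 h2; exists (ci u).
Qed.

Lemma inner_rho a : inner_aut a -> exists p, rho p = a.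
Proof.
elim=> [|x e b xe _ [p <-]]; first by exists 1%g.
suff [r <-] : exists r, rho r = e by exists (r * p)%g.
have [e0 e00 eP] := local_surj.
have [d d0 dP] := expm_strict (m := m) (@ltr01 R).
pose X := hmx (ad x); pose mn := Num.min d (e0 / 2).
have mn0 : 0 < mn by rewrite lt_min d0 divr_gt0.
(* [local_surj] reaches only automorphisms near 1, so the exponential of [ad x] is taken as the
   power of exponent [k.+1] of that of [ad x] divided by [k.+1]. *)
pose k := Num.bound (`|X| / mn).
have kX : `|X| / mn < k.+1%:R.
  have /archi_boundP : 0 <= `|X| / mn by rewrite divr_ge0 // ltW.
  by move=> /lt_trans; apply; rewrite ltr_nat.
pose Y := hmx (ad (k.+1%:R^-1 *: x)).
have YE : Y = k.+1%:R^-1 *: X by rewrite /Y (linfZ hmx_ad_linear).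
have Ymn : `|Y| < mn.
  rewrite YE normrZ normfV normr_nat mulrC ltr_pdivrMr // mulrC.
  by rewrite -ltr_pdivrMr.
have [Yd Ye] : `|Y| < d /\ `|Y| < e0 / 2 by move: Ymn; rewrite lt_min => /andP[].
have [||r0 r0E] := eP (expm Y).
- by apply: expm_br_hom; [exact: lie_brl|exact: lie_brr|exact: ad_br_der].
- have := dP Y 0 Yd; rewrite normr0 expm0 !subr0 mul1r => /(_ d0) h.
  rewrite -(subrK Y (_ - _)) (le_lt_trans (ler_normD _ _)) //.
  by rewrite (splitr e0) ltr_leD // ?(le_lt_trans h) // ltW.
have pow j : exists r, hmx (rho r) = expm (Y *+ j).
  elim: j => [|j [r rE]]; first by exists 1%g; rewrite r1 hmx1 mulr0n expm0.
  exists (r * r0)%g; rewrite rM hmx_comp rE -r0E mulrS expmD_comm //.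
  by rewrite -scaler_nat -scalemxAl -scalemxAr.
have [r rE] := pow k.+1; exists r; apply: hmx_inj; have := (is_expP (ad x) e).1 xe; rewrite rE => ->.
by rewrite YE -scaler_nat scalerA divff ?scale1r // pnatr_eq0.
Unshelve. all: by []. Qed.

Lemma inner_orbit_rho (h : 'Hom(q, R^o)) :
  inner_orbit_at h = [set (h \o rho p^-1%g)%VF | p in [set: G]].
Proof.
apply/seteqP; split=> [_ [a ia <-]|_ [p _ <-]].
  have [p <-] := inner_rho ia; exists p => //.
  by rewrite (inverse_pairV (rV p)).
by exists (rho p); [exact: rho_inner|rewrite (inverse_pairV (rV p))].
Qed.

End AdjointImage.

(** For any connected [H] with Lie algebra [q], this is [inner_orbit_rho] with [pi] the identity. *)
Lemma inner_orbit_coadjoint {R : realType} {q : lieAlgType R} (h : 'Hom(q, R^o)) :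
  (forall x : q, x != 0 -> kil x x < 0) -> algebra_coadjoint_orbit (inner_orbit_at h).
Proof.
move=> negdef; exists h; split => // n H L cH; rewrite /coadjoint_orbit_at.
have [A AE] : exists A, A = Ad L by exists (Ad L).
rewrite -AE; apply: (inner_orbit_rho cH AE (pi := \1%VF)) => //.
- exact: lim1g.
- by move=> x y; rewrite !id_lfunE.
- by move=> p x; rewrite !id_lfunE.
Qed.

(** * Bounded orbits *)

Section InvariantForm.
Context {R : realType} {k : lieAlgType R}.
Let m := \dim {:k}.
Variable S : 'M[R]_m.
Hypothesis S_sym : S^T = S.
Hypothesis S_pos : forall x : 'rV[R]_m, x != 0 -> 0 < (x *m S *m x^T) 0 0.
Hypothesis S_skew : forall y : k, hmx (ad y) *m S = - (S *m (hmx (ad y))^T).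

(** For the invariant inner product, the square of the length of [lie x y] is minus the product of
    [y] with [lie x (lie x y)]. *)
Let lie_lie_eq0 (x y : k) : lie x (lie x y) = 0 -> lie x y = 0.
Proof.
move=> xxy; apply: (coords_inj (R := R)); rewrite (linf0 coords_linear); apply: contrapT => /eqP xy0.
have := S_pos xy0; rewrite -adE -coords_mulmx -[_ *m hmx _ *m S]mulmxA S_skew mulmxN mulNmx.
rewrite mulmxA -[_ *m (hmx _)^T *m _]mulmxA -trmx_mul coords_mulmx coords_mulmx !adE xxy (linf0 coords_linear).
by rewrite trmx0 mulmx0 oppr0 mxE ltxx.
Qed.

Let abelian_central (W : {vspace k}) x y : is_lie_ideal W -> lie_prod W W = 0%VS ->
  x \in W -> lie x y = 0.
Proof.
move=> iW W0 xW; apply: lie_lie_eq0; apply/eqP; rewrite -memv0 -W0.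
by apply: memv_lie_prod => //; exact: ideal_lieP.
Qed.

(** The last nonzero derived algebra is abelian, hence central by [abelian_central]. If it were the
    derived algebra of [U], then [lie b (lie b a) = 0] on [U] would already give [lie b a = 0]; so
    the derived length drops to 1. *)
Lemma solvable_ideal_central (W : {vspace k}) x y : is_lie_ideal W -> lie_solvable W ->
  x \in W -> lie x y = 0.
Proof.
move=> iW [j Wj] xW; apply: (abelian_central _ iW _ xW).
elim: j Wj => [|[|j] IHj] // Wj.
  rewrite -[RHS]Wj /=; apply/eqP; rewrite eqEsubv; apply/andP; split.
    by rewrite -[X in (_ <= X)%VS]/(derived_series W 0); apply/lie_prod_subP => a b _; exact: iW.
  by rewrite /= in Wj; rewrite Wj sub0v.
apply: IHj; set U := derived_series W j in Wj *.
have iU : is_lie_ideal U by exact: derived_series_ideal.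
apply/eqP; rewrite -subv0; apply/lie_prod_subP => a b aU bU; rewrite memv0; apply/eqP.
apply: lie_lie_eq0; rewrite lieC; apply/eqP; rewrite oppr_eq0; apply/eqP.
by apply: (abelian_central _ (lie_prod_ideal iU iU)) => //; exact: memv_lie_prod.
Qed.

Lemma skew_kil (y : k) : kil y y <= 0 /\ (kil y y = 0 -> forall z, lie y z = 0).
Proof.
have [h1 h2] := skew_trace_sqr S_sym S_pos (S_skew y).
rewrite /kil /ltr hmx_comp; split => // /h2 y0 z.
by rewrite -adE (hmx_inj (etrans y0 (esym (linf0 hmx_linear)))) lfunE.
Qed.

End InvariantForm.

Lemma quot_repE {K : fieldType} {T : Type} {g k : vectType K} (pi : 'Hom(g, k)) (A : T -> 'End(g)) :
  limg pi = fullv -> (forall p x, pi x = 0 -> pi (A p x) = 0) ->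
  exists rho : T -> 'End(k), forall p x, rho p (pi x) = pi (A p x).
Proof.
move=> pis inv; have rhoP p : exists B : 'End(k), forall x, B (pi x) = pi (A p x).
  have [|B BE] := @surj_factor K g k k pi (pi \o A p)%VF pis.
    by move=> x x0; rewrite comp_lfunE inv.
  by exists B => x; rewrite BE comp_lfunE.
by have [rho rhoP'] := choice rhoP; exists rho.
Qed.

Section BoundedOrbit.
Context {R : realType} {n : nat} {G : lieGroupType R n} {g : lieAlgType R}.
Variable L : lie_algebra_of G g.
Hypothesis cG : connected [set: G].
Variable A : G -> 'End(g).
Hypothesis AE : A = Ad L.
Variable f : 'Hom(g, R^o).
Hypothesis f_bounded : exists M, forall p, `|coords (f \o A p)%VF| <= M.

Lemma orbit_kernel : exists J : lie_ideal g, forall x, x \in (J : {vspace g}) <-> forall p, f (A p x) = 0.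
Proof.
have [J JE] : exists J : {vspace g}, forall x, x \in J <-> forall p, f (A p x) = 0.
  apply: vspace_comprehension => [p|a u v u0 v0 p]; first by rewrite !linear0.
  by rewrite (linearP (A p)) (linearP f) /= u0 v0 scaler0 addr0.
have iJ : is_lie_ideal J.
  apply: (gAd_invariant_ideal AE) => p x /JE xJ; apply/JE => r.
  by have := xJ (r * p)%g; rewrite (gAdM AE) comp_lfunE.
by exists (LieIdeal iJ).
Qed.

Let orbit_bound : exists2 C, 0 <= C & forall p x, `|f (A p x)| <= C * `|coords x|.
Proof.
have [M fM] := f_bounded.
pose ev (r : 'rV[R]_(\dim {:'Hom(g, R^o)})) (s : 'rV[R]_(\dim {:g})) : R^o :=
  (of_coords r : 'Hom(g, R^o)) (of_coords s).
have [||C C0 evC] := @mx_bilinear_bounded R _ _ _ _ R^o ev.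
- by move=> v a r s; rewrite /ev /of_coords (passmx.vecof_linear _) add_lfunE scale_lfunE.
- by move=> u a r s; rewrite /ev /of_coords (passmx.vecof_linear _) linearP.
have M0 : 0 <= M by rewrite (le_trans _ (fM 1%g)).
exists (C * M); first exact: mulr_ge0.
move=> p x; have := evC (coords (f \o A p)%VF) (coords x).
rewrite /ev !coordsK comp_lfunE => /le_trans; apply.
by rewrite ler_wpM2r // ler_wpM2l.
Qed.

(** Dimensions cannot decrease forever, so finitely many translates of [f] cut out [J] and serve as
    coordinates on [g / J]. *)
Let finite_kernel : exists ps : seq G, forall x, (forall i : 'I_(size ps), f (A (nth 1%g ps i) x) = 0) ->
  forall p, f (A p x) = 0.
Proof.
pose Ker ps := foldr (fun p U => lker (f \o A p) :&: U)%VS (fullv : {vspace g}) ps.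
have KerP ps x : (forall i : 'I_(size ps), f (A (nth 1%g ps i) x) = 0) -> x \in Ker ps.
  elim: ps => [|p ps IHps] h; first exact: memvf.
  rewrite /= memv_cap memv_ker comp_lfunE (h ord0) eqxx /=.
  by apply: IHps => i; exact: (h (lift ord0 i)).
pose Q d := `[< exists ps, \dim (Ker ps) = d >].
have exQ : exists d, Q d by exists (\dim (Ker [::])); apply/asboolP; exists [::].
case: (ex_minnP exQ) => d /asboolP[ps dps] mind; exists ps => x /KerP xK p.
have /mind : Q (\dim (Ker (p :: ps))) by apply/asboolP; exists (p :: ps).
rewrite -dps => dle.
have /eqP e : Ker (p :: ps) == Ker ps by rewrite eqEdim capvSr.
by move: xK; rewrite -e memv_cap memv_ker comp_lfunE => /andP[/eqP].
Qed.

Variable J : lie_ideal g.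
Hypothesis JE : forall x, x \in (J : {vspace g}) <-> forall p, f (A p x) = 0.
Let k := lie_quot J.
Let pi : 'Hom(g, k) := quot_map J.
Let m := \dim {:k}.

Let pi_surj : limg pi = fullv. Proof. exact: quot_map_limg. Qed.
Let pi_lie x y : pi (lie x y) = lie (pi x) (pi y). Proof. exact: quot_map_lie. Qed.
Let pi0 x : pi x = 0 <-> x \in (J : {vspace g}). Proof. exact: quot_map0. Qed.

Variable rho : G -> 'End(k).
Hypothesis rhoE : forall p x, rho p (pi x) = pi (A p x).

(** The class of [x] modulo [J] is a fixed linear function of the finitely many values
    [f (A p_i x)]. Acting by [p] replaces these with [f (A (p_i p) x)], which obey the same
    bound. *)
Let rho_bounded : exists2 C, 0 <= C & forall p, `|hmx (rho p)| <= C.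
Proof.
have [C C0 fC] := orbit_bound; have [ps psP] := finite_kernel.
pose t x : 'rV[R]_(size ps) := \row_i f (A (nth 1%g ps i) x).
have lt : linear t by move=> a x y; apply/rowP => i; rewrite !mxE !linearP.
pose T := linfun t; have TE x : T x = t x by exact: (linfunE lt).
pose Lam := (pi \o T^-1)%VF.
have LamT x : Lam (T x) = pi x.
  rewrite comp_lfunE; apply/eqP; rewrite -subr_eq0 -linearB; apply/eqP/pi0/JE.
  apply: psP => i; have /rowP/(_ i) : t ((T^-1)%VF (T x) - x) = 0.
    by rewrite -TE linearB /= limg_lfunVK ?subrr // memv_img // memvf.
  by rewrite !mxE.
have lL : linear (fun r => coords (Lam r)) by move=> a r s; rewrite linearP coords_linear.
have [C' C'0 LC] := mx_linear_bounded lL.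
have lift i : {x : g | of_coords (delta_mx 0 i : 'rV[R]_m) = pi x}.
  by apply: cid; exact: (surj_lift pi_surj).
pose B := \sum_(i < m) `|coords (sval (lift i))|.
exists (C' * (C * B)); first by rewrite !mulr_ge0 // sumr_ge0.
move=> p; apply: mx_norm_le => [|i j]; first by rewrite !mulr_ge0 // sumr_ge0.
have -> : hmx (rho p) i j = coords (rho p (of_coords (delta_mx 0 i))) 0 j.
  by rewrite -mulmx_coords -rowE [RHS]mxE.
rewrite (svalP (lift i)) rhoE -LamT (le_trans (mx_entry_le _ _ _)) //.
rewrite (le_trans (LC _)) // ler_wpM2l // TE.
apply: (@le_trans _ _ (C * `|coords (sval (lift i))|)).
  apply: mx_norm_le => [|i' j']; first by rewrite mulr_ge0.
  rewrite /t mxE; have := fC (nth 1%g ps j' * p)%g (sval (lift i)).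
  by rewrite (gAdM AE) comp_lfunE.
rewrite ler_wpM2l // /B (bigD1 i) //= lerDl sumr_ge0 //.
Qed.

Let invariant : exists S : 'M[R]_m, [/\ S^T = S,
  forall x : 'rV[R]_m, x != 0 -> 0 < (x *m S *m x^T) 0 0 &
  forall p, hmx (rho p) *m S *m (hmx (rho p))^T = S].
Proof.
have rM p r := rhoM AE pi_surj rhoE p r.
have r1 := rho1 AE pi_surj rhoE.
have [C C0 rC] := rho_bounded.
have [||||S [sS pS aS]] := @invariant_form R m [set hmx (rho p) | p in [set: G]].
- by exists 1%g => //; rewrite r1 hmx1.
- by move=> _ _ [p _ <-] [r _ <-]; exists (r * p)%g => //; rewrite rM hmx_comp.
- move=> _ [p _ <-]; exists (hmx (rho p^-1%g)); first by exists p^-1%g.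
  by rewrite -hmx_comp -rM mulVg r1 hmx1.
- by exists C => _ [p _ <-]; exact: rC.
by exists S; split => // p; apply: aS; exists p.
Qed.

(** Differentiates the invariance of [S]. With [a t] the difference quotient of [rho] along a line
    in the chart, invariance reads [a S + S a^T + t a S a^T = 0]; then [t] tends to 0. *)
Let ad_skew (S : 'M[R]_m) : (forall p, hmx (rho p) *m S *m (hmx (rho p))^T = S) ->
  forall y : k, hmx (ad y) *m S = - (S *m (hmx (ad y))^T).
Proof.
move=> aS y; have [T Tsurj sT] := rho_strict AE pi_surj pi_lie rhoE.
have : y \in limg T by rewrite Tsurj memvf.
move=> /memv_imgP[w _ ->] {y}; set D := hmx (ad (T w)).
pose u0 := chart_fun (tan_chart L) 1%g; pose F u := hmx (rho (chart_inv (tan_chart L) u)).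
have F0 : F u0 = 1%:M.
  rewrite /F /u0 chart_funK ?(rho1 AE pi_surj rhoE) ?hmx1 //; exact: tan_chart_one.
pose a t := t^-1 *: (F (u0 + t *: w) - 1%:M).
have lT : linear (fun w => hmx (ad (T w))) by move=> b u v; rewrite linearP hmx_ad_linear.
have ca : a t @[t --> 0^'+] --> D.
  apply/cvgrPdist_le => e e0.
  have w10 : 0 < `|w| + 1 by rewrite ltr_wpDl.
  have [d d0 dP] := sT _ (divr_gt0 e0 w10).
  near=> t; have t0 : 0 < t by near: t; exact: nbhs_right_gt.
  have td : t < d / (`|w| + 1) by near: t; apply: nbhs_right_lt; exact: divr_gt0.
  have tw : `|t *: w| < d.
    rewrite normrZ gtr0_norm // (@le_lt_trans _ _ (t * (`|w| + 1))) ?ler_wpM2l ?lerDl ?ltW //.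
    by rewrite -ltr_pdivlMr.
  have := dP (u0 + t *: w) u0; rewrite addrAC subrr add0r normr0 => /(_ tw d0).
  rewrite -/(F _) -/(F u0) F0 (linfZ lT) -/D => h.
  have -> : D - a t = - (t^-1 *: (F (u0 + t *: w) - 1%:M - t *: D)).
    by rewrite /a [in RHS]scalerBr scalerA mulVf ?gt_eqF // scale1r opprB.
  rewrite normrN normrZ normfV gtr0_norm // mulrC ler_pdivrMr //.
  rewrite (le_trans h) // normrZ gtr0_norm //.
  by rewrite [t * _]mulrC mulrCA ler_pdivD1 // ltW.
pose f2 (x y : 'M[R]_m) : 'M[R]_m := x *m S *m y^T.
have f2l y : linear (f2^~ y) by move=> b u v; rewrite /f2 !mulmxDl -!scalemxAl.
have f2r x : linear (f2 x) by move=> b u v; rewrite /f2 linearP mulmxDr -scalemxAr.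
have [C C0 f2C] := mx_bilinear_bounded f2l f2r.
have c1 : f2 (a t) 1%:M @[t --> 0^'+] --> f2 D 1%:M.
  exact: (bilinear_cvg f2l f2r f2C ca (cvg_cst _)).
have c2 : f2 1%:M (a t) @[t --> 0^'+] --> f2 1%:M D.
  exact: (bilinear_cvg f2l f2r f2C (cvg_cst _) ca).
have c3 : f2 (a t) (a t) @[t --> 0^'+] --> f2 D D.
  exact: (bilinear_cvg f2l f2r f2C ca ca).
have c4 : t *: f2 (a t) (a t) @[t --> 0^'+] --> (0 : R) *: f2 D D.
  by apply: cvgZ c3; apply: cvg_at_right_filter; exact: cvg_id.
have c5 := cvgD (cvgD c1 c2) c4.
have z0 : \forall t \near 0^'+, f2 (a t) 1%:M + f2 1%:M (a t) + t *: f2 (a t) (a t) = 0.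
  near=> t; have t0 : 0 < t by near: t; exact: nbhs_right_gt.
  have FE : F (u0 + t *: w) = 1%:M + t *: a t.
    by rewrite /a scalerA divff ?gt_eqF // scale1r [RHS]addrC subrK.
  have := aS (chart_inv (tan_chart L) (u0 + t *: w)); rewrite -/(F _) FE.
  move: (a t) => X; rewrite -/(f2 _ _) (linfD (f2l _)) !(linfD (f2r _)).
  rewrite !(linfZ (f2l _)) !(linfZ (f2r _)).
  have -> : f2 1%:M 1%:M = S by rewrite /f2 mul1mx trmx1 mulmx1.
  move: (f2 X 1%:M) (f2 1%:M X) (f2 X X) => P Q Z e.
  have : t *: (P + Q + t *: Z) = 0.
    by apply: (addrI S); rewrite addr0 -[RHS]e !scalerDr !addrA [_ + t *: P + _]addrAC.
  by move=> /eqP; rewrite scaler_eq0 gt_eqF //= => /eqP.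
have nz0 : f2 D 1%:M + f2 1%:M D + (0 : R) *: f2 D D = 0.
  apply: contrapT => /eqP nz; have FF : Filter ((0 : R)^'+) by exact _.
  have nz' := cvgr_neq0 _ (c5 FF FF) nz.
  have [t [/eqP h1 h2]] := @filter_ex _ _ (at_right_proper_filter (0 : R)) _ (filterI (nz' FF) z0).
  exact: h1.
move: nz0; rewrite scale0r addr0 /f2 trmx1 mulmx1 mul1mx => /eqP.
by rewrite addr_eq0 => /eqP.
Unshelve. all: by end_near. Qed.

Let kil_k (y : k) : kil y y <= 0 /\ (kil y y = 0 -> forall z, lie y z = 0).
Proof.
have [S [sS pS aS]] := invariant; exact: (skew_kil sS pS (ad_skew aS)).
Qed.

Let solvable_k (W : {vspace k}) x y : is_lie_ideal W -> lie_solvable W -> x \in W -> lie x y = 0.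
Proof.
have [S [sS pS aS]] := invariant; move=> iW sW xW.
exact: (solvable_ideal_central pS (ad_skew aS) y iW sW xW).
Qed.

Let radical_central x y : x \in (radical g : {vspace g}) -> lie y x \in (J : {vspace g}).
Proof.
move=> xr; apply/pi0; rewrite pi_lie lieC.
rewrite (@solvable_k (pi @: radical g)%VS) ?oppr0 ?memv_img //.
  by apply: (img_ideal pi_surj pi_lie); exact: (@idealP _ _ (radical g)).
by apply: (img_solvable pi_lie); exact: radical_solvable.
Qed.

Let s : lieAlgType R := semisimple_quot g.
Let ps : 'Hom(g, s) := quot_map (radical g).

Lemma noncompact_part_central x y : x \in (noncompact_part g : {vspace g}) -> lie y x \in (J : {vspace g}).
Proof.
have ps_surj : limg ps = fullv by exact: quot_map_limg.
have ps_lie u v : ps (lie u v) = lie (ps u) (ps v) by exact: quot_map_lie.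
have ps0 u : ps u = 0 <-> u \in (radical g : {vspace g}) by exact: quot_map0.
have [Z ZE] : exists Z : {vspace g}, forall z, z \in Z <-> forall u, lie u z \in (J : {vspace g}).
  apply: vspace_comprehension => [u|a u v uJ vJ w]; first by rewrite lie0r mem0v.
  by rewrite lieDr lieZr memvD // memvZ.
have iZ : is_lie_ideal Z.
  by move=> u z /ZE zJ; apply/ZE => w; apply: (@idealP _ _ J); exact: zJ.
(* [g / Z], with [Z] the elements central modulo [J], is a common quotient of [s], since [Z]
   contains the radical, and of [k], since it contains [J]. Killing forms of [s] and [k] are
   compared on it. *)
pose ZI := LieIdeal iZ; pose w := lie_quot ZI; pose pw : 'Hom(g, w) := quot_map ZI.
have pw0 u : pw u = 0 <-> u \in Z by exact: (quot_map0 ZI u).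
have pw_surj : limg pw = fullv by exact: quot_map_limg.
have pw_lie u v : pw (lie u v) = lie (pw u) (pw v) by exact: quot_map_lie.
have rZ u : u \in (radical g : {vspace g}) -> u \in Z by move=> ur; apply/ZE => v; exact: radical_central.
have [|sw [swE sw_surj sw_lie]] := lie_surj_factor ps_surj pw_surj ps_lie pw_lie.
  by move=> u /ps0/rZ uZ; apply/pw0.
have [|kw [kwE kw_surj kw_lie]] := lie_surj_factor pi_surj pw_surj pi_lie pw_lie.
  by move=> u /pi0 uJ; apply/pw0/ZE => v; exact: (@idealP _ _ J).
(* A non-compact simple ideal [b] lies in the image of [Z] or meets it in 0. In the second case [b]
   embeds in [g / Z], its form agrees with that of [k] and is negative definite, contradicting
   non-compactness. *)
have NZ : (noncompact_ideals s <= ps @: Z)%VS.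
  apply: (vsupP _).2 => b [sb ncb]; have [ib _ _] := sb.
  have iZ' : is_lie_ideal (ps @: Z)%VS by exact: (img_ideal ps_surj ps_lie iZ).
  have ibZ := capv_ideal ib iZ'.
  case: (simple_ideal_minimal sb ibZ (capvSl _ _)) => [bZ0|<-]; last exact: capvSr.
  case: ncb; split => // v v0; rewrite killing_form_ideal //.
  have v0' : vsval v != 0 by apply: contra_neq v0 => v0; apply: val_inj; exact: v0.
  have bv : vsval v \in b by exact: subvsP.
  move: (vsval v) v0' bv => {v0}v v0 bv; have [u uv] := surj_lift ps_surj v.
  have -> : kil v v = kil (pi u) (pi u).
    rewrite (kil_factor sw_surj sw_lie); last first.
      move=> z; have [z' ->] := surj_lift ps_surj z; rewrite swE => /pw0 zZ.
      apply/eqP; rewrite -memv0 -bZ0 memv_cap [X in X && _]ideal_lieP //=.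
      by apply: iZ'; exact: memv_img.
    rewrite (kil_factor kw_surj kw_lie); first by rewrite uv swE kwE.
    move=> z; have [z' ->] := surj_lift pi_surj z; rewrite kwE => /pw0/ZE zZ.
    by rewrite -pi_lie; apply/pi0.
  have [h1 h2] := kil_k (pi u); rewrite lt_neqAle h1 andbT; apply: contra_neq v0 => /h2 u0.
  apply/eqP; rewrite -memv0 -bZ0 memv_cap bv uv memv_img //=; apply/ZE => z.
  by apply/pi0; rewrite pi_lie lieC u0 oppr0.
move=> xn; suff /ZE : x \in Z by exact.
have /(subvP NZ)/memv_imgP[z zZ xz] : ps x \in (noncompact_ideals s : {vspace s}).
  by move: xn; rewrite /noncompact_part /= -memv_preim.
rewrite -(subrK z x) memvD // rZ //; apply/ps0.
by rewrite linearB /= xz subrr.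
Qed.

End BoundedOrbit.

(** * The complement defined by a Levi factor, and the theorem *)

Section LeviComplement.
Context {R : realType} {g : lieAlgType R}.
Let s : lieAlgType R := semisimple_quot g.
Let ps : 'Hom(g, s) := quot_map (radical g).
Let N : {vspace s} := noncompact_ideals s.
Let iN : is_lie_ideal N := @idealP _ _ (noncompact_ideals s).
Let gn : {vspace g} := noncompact_part g.
Let ps_surj : limg ps = fullv := quot_map_limg (radical g).
Let ps_lie x y : ps (lie x y) = lie (ps x) (ps y) := quot_map_lie (radical g) x y.
Let ss := @semisimple_quot_abelian R g.

Let gnE x : (x \in gn) = (ps x \in N).
Proof. by rewrite /gn /= -memv_preim. Qed.

(** Every class is represented by an element of [perp N] in [s]; it commutes with the kernel [N] of
    the map to the quotient, so [kil_factor] transports negativity. *)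
Lemma noncompact_quot_negdef (z : lie_quot (noncompact_part g)) : z != 0 -> kil z z < 0.
Proof.
pose pq : 'Hom(g, lie_quot (noncompact_part g)) := quot_map (noncompact_part g).
have pq_surj : limg pq = fullv := quot_map_limg _.
have pq_lie x y : pq (lie x y) = lie (pq x) (pq y) by exact: quot_map_lie.
have pq0 x : pq x = 0 <-> ps x \in N by rewrite -gnE; exact: quot_map0.
have [|sq [sqE sq_surj sq_lie]] := lie_surj_factor ps_surj pq_surj ps_lie pq_lie.
  by move=> x x0; apply/pq0; rewrite x0 mem0v.
have sq0 v : sq v = 0 <-> v \in N.
  by have [v' ->] := surj_lift ps_surj v; rewrite sqE; exact: pq0.
have [x ->] := surj_lift pq_surj z.
have /memv_addP[a aN [c cN xac]] : ps x \in (N + perp N)%VS.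
  by rewrite (ideal_add_perp ss iN) memvf.
have -> : pq x = sq c by rewrite -sqE xac linearD /= (sq0 a).2 // add0r.
move=> c0; rewrite -(kil_factor sq_surj sq_lie); last first.
  by move=> v /sq0 vN; rewrite lieC (lie_ideal_perp ss iN vN cN) oppr0.
apply: (perp_noncompact_negdef ss) => //.
by apply: contra_neq c0 => ->; rewrite linear0.
Qed.

Variable l : {vspace g}.
Hypothesis levi_l : is_levi_factor l.
Let lc := levi_compact l.

Let lcE x : (x \in lc) = (x \in l) && (ps x \in perp N).
Proof. by rewrite /lc /levi_compact memv_cap -memv_preim (compact_ideals_perp ss). Qed.

Lemma levi_compact_cap : (gn :&: lc)%VS = 0%VS.
Proof.
have [_ l0 _] := levi_l; apply/eqP; rewrite -subv0; apply/subvP => x.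
rewrite memv_cap gnE lcE => /and3P[xN xl xP]; rewrite -l0 memv_cap xl memv_ker /=.
by rewrite -memv0 -(ideal_cap_perp ss iN) memv_cap xN.
Qed.

Lemma levi_compact_add : (gn + lc)%VS = fullv.
Proof.
have [_ _ lsurj] := levi_l; apply/eqP; rewrite eqEsubv subvf /=; apply/subvP => x _.
have /memv_addP[a aN [c cN xac]] : ps x \in (N + perp N)%VS.
  by rewrite (ideal_add_perp ss iN) memvf.
have /memv_imgP[y yl cy] : c \in (ps @: l)%VS by rewrite lsurj memvf.
rewrite -(subrK y x) memv_add //; last by rewrite lcE yl -cy.
by rewrite gnE linearB /= xac cy addrK.
Qed.

Lemma levi_compact_lie x y : x \in lc -> y \in lc -> lie x y \in lc.
Proof.
have [lsub _ _] := levi_l; rewrite !lcE => /andP[xl xN] /andP[yl yN].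
by rewrite lsub //= ps_lie; apply: (perp_ideal iN).
Qed.

End LeviComplement.

Section Extension.
Context {R : realType} {V : vectType R} (U W : {vspace V}).
Hypothesis cap0 : (U :&: W)%VS = 0%VS.

Lemma extend0E (lam : 'Hom(subvs_of U, R^o)) x :
  extend0 W lam x = lam (vsproj U (daddv_pi U W x)).
Proof. by rewrite /extend0 !comp_lfunE [linfun _ _]lfunE. Qed.

Lemma extend0l (lam : 'Hom(subvs_of U, R^o)) x : x \in U -> extend0 W lam x = lam (vsproj U x).
Proof. by move=> xU; rewrite extend0E daddv_pi_id. Qed.

Lemma extend0r (lam : 'Hom(subvs_of U, R^o)) x : x \in W -> extend0 W lam x = 0.
Proof.
move=> xW; have xUW : x \in (U + W)%VS by rewrite (subvP (addvSr U W)).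
have := daddv_pi_add cap0 xUW; rewrite (daddv_pi_id (U := W)) 1?capvC // => /eqP.
by rewrite -subr_eq0 addrK => /eqP e; rewrite extend0E e !linear0.
Qed.

End Extension.

(** The set is the image of the compact group of matrices under an affine map; the inverse in
    [inner_orbit_at] is harmless because inner automorphisms form a group. *)
Lemma inner_orbit_compact {R : realType} {q : lieAlgType R} {V : vectType R}
    (h : 'Hom(q, R^o)) (P : 'Hom(q, R^o) -> V) (v : V) :
  (forall x : q, x != 0 -> kil x x < 0) -> linear P ->
  vcompact [set v + P a | a in inner_orbit_at h].
Proof.
move=> negdef lP; pose H (a : 'End(q)) := mxvec (hmx a).
have lH : linear H by move=> k a b; rewrite /H hmx_linear linearP.
have kerH : lker (linfun H) == 0%VS.
  rewrite -subv0; apply/subvP => a; rewrite memv_ker memv0 (linfunE lH) /H mxvec_eq0 => /eqP a0.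
  by apply/eqP; apply: hmx_inj; rewrite a0 (linf0 hmx_linear).
pose Lam w := coords (P (h \o ((linfun H)^-1)%VF w)%VF).
have lLam : linear Lam.
  by move=> k a b; rewrite /Lam linearP comp_lfunDr -comp_lfunZr lP coords_linear.
have -> : vcompact [set v + P a | a in inner_orbit_at h] =
    compact ((fun w => coords v + Lam w) @` [set mxvec (hmx a) | a in @inner_aut R q]).
  rewrite /vcompact; congr compact.
  have LamE a : coords v + Lam (H a) = coords (v + P (h \o a)%VF).
    rewrite (linfD coords_linear) /Lam; congr (_ + coords (P (h \o _)%VF)).
    by rewrite -(linfunE lH) lker0_lfunK.
  apply/seteqP; split=> [_ [_ [_ [a ia <-] <-] <-]|_ [_ [a ia <-] <-]].
    have [b ib ab] := inner_aut_inv ia; exists (H b); first by exists b.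
    by rewrite LamE (inverse_pairV ab).
  have [b ib [ab ba]] := inner_aut_inv ia; rewrite -/(H a) LamE.
  exists (v + P (h \o a)%VF) => //; exists (h \o a)%VF => //.
  by exists b => //; rewrite (@inverse_pairV _ _ b a).
apply: continuous_compact; last exact: inner_compact.
apply: continuous_subspaceT => w.
have cw : Lam x @[x --> w] --> Lam w by exact: (mx_linear_continuous lLam).
exact: (cvgD (cvg_cst (coords v)) cw).
Qed.

Theorem theorem3 (R : realType) (g : lieAlgType R)
    (n : nat) (G : lieGroupType R n) (L : lie_algebra_of G g)
    (Gconnected : connected [set: G])
    (l : {vspace g}) (levi_l : is_levi_factor l)
    (O : set 'Hom(g, R^o))
    (orbitO : coadjoint_orbit L O) (boundedO : vbounded O) :
  [/\ vclosed O, vcompact O &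
      exists (f1 : 'Hom(subvs_of (noncompact_part g), R^o))
             (Oq : set 'Hom(lie_quot (noncompact_part g), R^o)),
        [/\ group_fixed L f1,
            algebra_coadjoint_orbit Oq &
            O = [set extend0 (levi_compact l) f1 + h | h in pullback Oq]]].
Proof.
have [A AE] : exists A, A = Ad L by exists (Ad L).
have [f] := orbitO; rewrite /coadjoint_orbit_at -AE => OE.
have fB : exists M, forall p, `|coords (f \o A p)%VF| <= M.
  have [M [_ HM]] := boundedO; exists (M + 1) => p.
  apply: HM; first by rewrite ltrDl.
  by exists (f \o A p)%VF => //; rewrite OE; exists (p^-1)%g => //; rewrite invgK.
have [J JE] := orbit_kernel AE f.
have [rk rkE] : exists rho : G -> 'End(lie_quot J), forall p x, rho p (quot_map J x) = quot_map J (A p x).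
  apply: (quot_repE (quot_map_limg J)) => p x /quot_map0/JE xJ; apply/quot_map0/JE => r.
  by have := xJ (r * p)%g; rewrite (gAdM AE) comp_lfunE.
pose gnI := noncompact_part g; pose gn : {vspace g} := gnI.
have gnJ x y : x \in gn -> lie y x \in (J : {vspace g}).
  exact: (noncompact_part_central AE fB JE rkE).
have Jf x : x \in (J : {vspace g}) -> f x = 0.
  by move=> /JE/(_ 1%g); rewrite (gAd1 AE) id_lfunE.
have iJ : is_lie_ideal (J : {vspace g}) := @idealP _ _ J.
have ign : is_lie_ideal gn := @idealP _ _ gnI.
have fgn p x : x \in gn -> f (A p x) = f x.
  move=> xgn; apply/eqP; rewrite -subr_eq0 -linearB; apply/eqP/Jf.
  by apply: (gAd_central AE Gconnected iJ) => y; exact: gnJ.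
have Agn p x : x \in gn -> A p x \in gn.
  move=> xgn; rewrite -(subrK x (A p x)) memvD //.
  by apply: (gAd_central AE Gconnected ign) => y; exact: ign.
pose lc := levi_compact l.
have cap0 : (gn :&: lc)%VS = 0%VS := levi_compact_cap levi_l.
pose f1 : 'Hom(subvs_of gn, R^o) := (f \o linfun vsval)%VF.
have f1E x : x \in gn -> f1 (vsproj gn x) = f x.
  by move=> xgn; rewrite /f1 comp_lfunE lfunE /= vsprojK.
pose phi : 'Hom(g, R^o) := extend0 lc f1.
have phi_gn x : x \in gn -> phi x = f x by move=> xgn; rewrite /phi extend0l // f1E.
have phi_lc x : x \in lc -> phi x = 0 by move=> xlc; rewrite /phi extend0r.
have phiJ x y : x \in gn -> phi (lie y x) = 0.
  by move=> xgn; rewrite phi_gn ?ign // Jf // gnJ.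
(* Brackets with [gn] lie in both [gn] and [J], where [phi] agrees with [f] and [f] vanishes;
   brackets within [lc] stay in the subalgebra [lc], where [phi] is 0. *)
have phi_lie x y : phi (lie x y) = 0.
  have /memv_addP[u ug [w wl ->]] : x \in (gn + lc)%VS by rewrite (levi_compact_add levi_l) memvf.
  have /memv_addP[u' ug' [w' wl' ->]] : y \in (gn + lc)%VS by rewrite (levi_compact_add levi_l) memvf.
  rewrite lieDl [lie u _]lieC lieDr !(linearD phi) (linearN phi) /=.
  by rewrite (phiJ u _ ug) (phiJ u' _ ug') (phi_lc _ (levi_compact_lie levi_l wl wl')) oppr0 !addr0.
(* Everything is central modulo the derived algebra, so [gAd_central] puts [A p x - x] into it, and
   [phi] kills it. *)
have phi_A p x : phi (A p x) = phi x.
  apply/eqP; rewrite -subr_eq0 -linearB; apply/eqP.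
  have sub : (lie_prod fullv fullv <= lker phi)%VS.
    by apply/lie_prod_subP => u v _ _; rewrite memv_ker phi_lie.
  have : A p x - x \in lie_prod (fullv : {vspace g}) fullv.
    apply: (gAd_central AE Gconnected (lie_prod_ideal idealf idealf)) => y.
    by apply: memv_lie_prod; exact: memvf.
  by move=> /(subvP sub); rewrite memv_ker => /eqP.
pose pq : 'Hom(g, lie_quot gnI) := quot_map gnI.
have pq_surj : limg pq = fullv := quot_map_limg gnI.
have pq0 x : pq x = 0 <-> x \in gn by exact: quot_map0.
have pq_lie x y : pq (lie x y) = lie (pq x) (pq y) by exact: quot_map_lie.
(* The remainder [f - phi] vanishes on [gn]; its descent [h0] generates the orbit on the
   quotient. *)
have [h0 h0E] : exists h0 : 'Hom(lie_quot gnI, R^o), forall x, h0 (pq x) = (f - phi)%VF x.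
  apply: (surj_factor pq_surj) => x /pq0 xgn.
  by rewrite add_lfunE opp_lfunE phi_gn // subrr.
have [rho rhoE] : exists rho : G -> 'End(lie_quot gnI), forall p x, rho p (pq x) = pq (A p x).
  by apply: (quot_repE pq_surj) => p x /pq0 xgn; apply/pq0; exact: Agn.
have negdef := @noncompact_quot_negdef R g.
have orbE := inner_orbit_rho Gconnected AE pq_surj pq_lie rhoE negdef h0.
have fE p : (f \o A p)%VF = phi + ((h0 \o rho p) \o pq)%VF.
  apply/lfunP => x; rewrite [LHS]comp_lfunE [RHS]add_lfunE.
  have -> : ((h0 \o rho p) \o pq)%VF x = h0 (rho p (pq x)) by rewrite [LHS]comp_lfunE [LHS]comp_lfunE.
  by rewrite rhoE h0E add_lfunE opp_lfunE phi_A addrC subrK.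
have OE' : O = [set phi + (h \o pq)%VF | h in inner_orbit_at h0].
  rewrite orbE OE; apply/seteqP; split=> [_ [p _ <-]|_ [_ [p _ <-] <-]].
    by exists (h0 \o rho p^-1%g)%VF; [exists p|rewrite fE].
  by exists p => //; rewrite fE.
have cO : vcompact O.
  pose P (h : 'Hom(lie_quot gnI, R^o)) : 'Hom(g, R^o) := (h \o pq)%VF.
  have lP : linear P by move=> k a b; rewrite /P comp_lfunDl -comp_lfunZl.
  by rewrite OE'; exact: (inner_orbit_compact negdef lP).
split => //; first by apply: compact_closed => //; exact: norm_hausdorff.
exists f1, (inner_orbit_at h0); split.
- move=> p x; rewrite -AE -[in RHS](vsvalK x) !f1E ?fgn ?Agn //; exact: subvsP.
- exact: inner_orbit_coadjoint.
- rewrite OE'; apply/seteqP; split=> [_ [h ih <-]|_ [_ [h ih <-] <-]].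
    by exists (h \o pq)%VF => //; exists h.
  by exists h.
Qed.
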